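(* Let $\tau$ be a substitution tree with at least $2$ leaves, let $\mathfrak N$ be a set of internal nodes of $\tau$ containing every non-linear node of $\tau$, and let $\mathcal T_{\tau,\mathfrak N}$ be the set of marked trees $(t,\mathfrak I)\in\mathcal T_\tau$ with $\mathcal N(t,\mathfrak I)=\mathfrak N$, with exponential generating function $T_{\tau,\mathfrak N}$ (size = total number of leaves). Then $$T_{\tau,\mathfrak N}=z^{|\tau|}\,T^{\mathrm{root}}\,(T^{\oplus}_{\mathrm{not}\oplus})^{d_=}(T^{\ominus}_{\mathrm{not}\oplus})^{d_{\ne}}(T^{\mathrm{blo}}_{\mathrm{not}\oplus})^{d_{\overline{\mathfrak N}\to\mathfrak N}}(T'_{\mathrm{not}\oplus})^{d_{\overline{\mathfrak N}\to\ell}}\exp(n_L T_{\mathrm{not}\oplus})\,(T^{\oplus})^{d_{\mathfrak N\to\overline{\mathfrak N}}}(T^{\mathrm{blo}})^{d_{\mathfrak N\to\mathfrak N}}(T')^{d_{\mathfrak N\to\ell}}\prod_{\mathfrak n\in\mathfrak N}\mathrm{Occ}_{\mathrm{dec}(\mathfrak n),\mathcal P}(T),$$ where, counting parent–child edges of $\tau$: $d_=$ is the number of edges between two internal nodes not in $\mathfrak N$ with the same decoration (both $\oplus$ or both $\ominus$); $d_{\ne}$ the number of edges between two internal nodes not in $\mathfrak N$ with different decorations; $d_{\overline{\mathfrak N}\to\mathfrak N}$ the number of edges from an internal node not in $\mathfrak N$ to a child in $\mathfrak N$; $d_{\mathfrak N\to\overline{\mathfrak N}}$ from a node in $\mathfrak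 N$ to an internal child not in $\mathfrak N$; $d_{\mathfrak N\to\mathfrak N}$ from a node in $\mathfrak N$ to a child in $\mathfrak N$; $d_{\overline{\mathfrak N}\to\ell}$ from an internal node not in $\mathfrak N$ to a leaf; $d_{\mathfrak N\to\ell}$ from an internal node in $\mathfrak N$ to a leaf; $n_L$ is the number of internal nodes not in $\mathfrak N$; $\mathrm{dec}(\mathfrak n)$ is the decoration of $\mathfrak n$; and $T^{\mathrm{root}}=T^{\oplus}$ if the root of $\tau$ is not in $\mathfrak N$, $T^{\mathrm{root}}=T^{\mathrm{blo}}$ otherwise.
   Context: A prime graph has at least 3 vertices and only trivial modules. $\mathcal P$ is a set of prime labeled graphs stable under relabeling. Substitution trees: rooted non-plane trees with leaves labeled bijectively by $\{1,\dots,n\}$, internal nodes decorated by $\oplus$/$\ominus$ (linear nodes, $\ge2$ children) or a labeled graph $H$, $|H|\ge2$, with $|H|$ children (non-linear nodes); children ordered by minimal leaf label; a 2-vertex graph decoration is identified with $\oplus$ if it has an edge and $\ominus$ otherwise. $\mathcal T_{\mathcal P}$: modular decomposition trees (substitution trees with non-linear decorations prime, no $\oplus$-child of a $\oplus$-node nor $\ominus$-child of a $\ominus$-node) whose prime decorations are in $\mathcal P$. $T$, $T_{\mathrm{not}\oplus}$: exponential generating functions (by leaves) of $\mathcal T_{\mathcal P}$ and of its trees with root not $\oplus$; $'$ is $d/dz$. Blossoming $t\in\mathcal T_{\mathcal P}$ at a leaf $\ell$: in each prime decoration on the root-to-$\ell$ path the vertex corresponding to the subtree containing $\ell$ is relabeled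 $*$ (other labels reduced preserving order), $\ell$ is relabeled $*$ (the blossom) and other leaf labels reduced; results are blossomed trees, sized by non-blossom leaves. A blossom is $\oplus$-(resp. $\ominus$-)replaceable if its parent is not $\oplus$ (resp. $\ominus$). $T^{\mathrm{blo}}$: all blossomed trees; $T^{\mathrm{blo}}_{\mathrm{not}\oplus}$: those with root not $\oplus$; $T^{\oplus}$: those with $\oplus$-replaceable blossom; $T^{\ominus}_{\mathrm{not}\oplus}$: root not $\oplus$ and blossom $\ominus$-replaceable; $T^{\oplus}_{\mathrm{not}\oplus}$: root not $\oplus$, blossom $\oplus$-replaceable, excluding the single blossom. A marked tree is $(t,\mathfrak I)$ with $\mathfrak I$ a partial injection from leaf labels to $\mathbb N$. Induced subtree $t_{\mathfrak I}$: leaves are marked leaves $\ell$ relabeled $\mathfrak I(\ell)$; internal nodes are nodes of $t$ that are first common ancestors of $\ge2$ marked leaves, ancestry inherited; a node with decoration $H$ gets the decoration obtained by keeping vertices $k$ whose $k$-th subtree contains a marked leaf, relabeling $k$ by the minimum of $\mathfrak I$ on marked leaves of that subtree, and reducing labels; $\phi$ maps each node of $t_{\mathfrak I}$ to the corresponding node of $t$. $\mathcal T_\tau$ is the set of marked trees $(t,\mathfrak I)$ with $t\in\mathcal T_{\mathcal P}$ and $t_{\mathfrak I}$ isomorphic to $\tau$; $\mathcal N(t,\mathfrak I)$ is the set of internal nodes $\mathfrak n$ of $\tau$ such that $\phi(\mathfrak n)$ is non-linear. $\mathrm{Occ}_{G,\mathcal P}(z)=\sum_{H\in\mathcal P}\mathrm{Occ}_G(H)z^{|H|-|G|}/|H|!$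 where $\mathrm{Occ}_G(H)$ is the number of partial injections from the labels of $H$ onto $\{1,\dots,|G|\}$ whose relabeled induced subgraph equals $G$ (for $\oplus$, $\ominus$ decorations, $G$ is the complete/edgeless graph on the number of children).
   Formalization: In ''t_I isomorphic to τ'', a linear node of τ with k children is compared as the complete (⊕) or edgeless (⊖) graph on k vertices, as for Occ; identifying only 2-vertex graphs, the formula fails (P = labeled bulls, τ = ⊕ with 3 leaves, N = {root}). *)

(* Defs.v *)
From HB Require Import structures.
From mathcomp Require Import all_boot all_order all_algebra all_fingroup finmap.
From mathcomp Require Import boolp classical_sets cardinality.

Set Implicit Arguments.
Unset Strict Implicit.
Unset Printing Implicit Defensive.

Import GRing.Theory.
Local Open Scope ring_scope.

Record fps := Fps { coefs : nat -> rat }.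

Lemma fps_eqP (f g : fps) : coefs f =1 coefs g -> f = g.
Proof. by case: f g => [f] [g] /= /funext ->. Qed.

HB.instance Definition _ := gen_eqMixin fps.
HB.instance Definition _ := gen_choiceMixin fps.

Definition fps_zero := Fps (fun=> 0).
Definition fps_opp f := Fps (fun n => - coefs f n).
Definition fps_add f g := Fps (fun n => coefs f n + coefs g n).
Definition fps_one := Fps (fun n => (n == 0%N)%:R).
Definition fps_mul f g :=
  Fps (fun n => \sum_(i < n.+1) coefs f i * coefs g (n - i)%N).

Fact fps_addA : associative fps_add.
Proof. by move=> f g h; apply: fps_eqP => n /=; rewrite addrA. Qed.
Fact fps_addC : commutative fps_add.
Proof. by move=> f g; apply: fps_eqP => n /=; rewrite addrC. Qed.
Fact fps_add0 : left_id fps_zero fps_add.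
Proof. by move=> f; apply: fps_eqP => n /=; rewrite add0r. Qed.
Fact fps_addN : left_inverse fps_zero fps_opp fps_add.
Proof. by move=> f; apply: fps_eqP => n /=; rewrite addNr. Qed.

HB.instance Definition _ :=
  GRing.isZmodule.Build fps fps_addA fps_addC fps_add0 fps_addN.

Definition fps_trunc N f : {poly rat} := \poly_(i < N.+1) coefs f i.

Lemma coef_fps_trunc N f n : (n <= N)%N -> (fps_trunc N f)`_n = coefs f n.
Proof. by move=> nN; rewrite coef_poly ltnS nN. Qed.

Lemma coefs_mul_trunc N f g n : (n <= N)%N ->
  coefs (fps_mul f g) n = (fps_trunc N f * fps_trunc N g)`_n.
Proof.
move=> nN; rewrite coefM; apply: eq_bigr => -[i /= lt_in] _.
have le_iN : (i <= N)%N := leq_trans (lt_in : (i <= n)%N) nN.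
by rewrite !coef_fps_trunc // (leq_trans (leq_subr _ _)).
Qed.

Fact fps_mulC : commutative fps_mul.
Proof. by move=> f g; apply: fps_eqP => n; rewrite !(@coefs_mul_trunc n) // mulrC. Qed.
Fact fps_mulA : associative fps_mul.
Proof.
move=> f g h; apply: fps_eqP => n.
transitivity ((fps_trunc n f * (fps_trunc n g * fps_trunc n h))`_n).
  rewrite coefM; apply: eq_bigr => -[i /= le_in] _.
  by rewrite coef_fps_trunc // -coefs_mul_trunc // leq_subr.
rewrite mulrA coefM; apply: eq_bigr => -[i /= le_in] _.
by rewrite coef_fps_trunc ?leq_subr // -coefs_mul_trunc.
Qed.
Fact fps_mul1 : left_id fps_one fps_mul.
Proof.
move=> f; apply: fps_eqP => n /=; rewrite big_ord_recl /= mul1r subn0.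
by rewrite big1 ?addr0 // => i _; rewrite mul0r.
Qed.
Fact fps_mulDl : left_distributive fps_mul fps_add.
Proof.
move=> f g h; apply: fps_eqP => n /=; rewrite -big_split /=.
by apply: eq_bigr => i _; rewrite mulrDl.
Qed.
Fact fps_one_neq0 : fps_one != 0.
Proof. by apply/eqP => /(congr1 (fun f => coefs f 0)). Qed.

HB.instance Definition _ := GRing.Zmodule_isComNzRing.Build fps
  fps_mulA fps_mulC fps_mul1 fps_mulDl fps_one_neq0.

Definition fps_z : fps := Fps (fun n => (n == 1%N)%:R).

Definition fps_deriv (f : fps) : fps := Fps (fun n => coefs f n.+1 *+ n.+1).

(* The composition f(g); meaningful when g has no constant term, so that g ^+ k
   contributes nothing to the coefficient of z^n for k > n. *)
Definition fps_comp (f g : fps) : fps :=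
  Fps (fun n => \sum_(k < n.+1) coefs f k * coefs (g ^+ k) n).

Definition fps_exp (g : fps) : fps :=
  fps_comp (Fps (fun n => (n`!%:R)^-1)) g.

(* The exponential generating function of a class with finitely many objects
   of each size ([fset_set] of an infinite set is a default value). *)
Definition egf (T : choiceType) (C : set T) (sz : T -> nat) : fps :=
  Fps (fun n => #|` fset_set [set x | C x /\ sz x = n]|%:R / n`!%:R).

(* A graph with vertex labels 1, ..., n; the vertex labeled k.+1 is the element
   k of 'I_n. *)
Record lgraph (n : nat) := LGraph {
  arcs : {set 'I_n * 'I_n};
  _ : [forall u, (u, u) \notin arcs] &&
      [forall u, forall v, ((u, v) \in arcs) == ((v, u) \in arcs)]
}.
HB.instance Definition _ n := [isSub for @arcs n].
HB.instance Definition _ n := [Finite of lgraph n by <:].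

Definition adj n (H : lgraph n) : rel 'I_n := fun u v => (u, v) \in arcs H.

Definition adjn n (H : lgraph n) (a b : nat) : bool :=
  match (insub a : option 'I_n), (insub b : option 'I_n) with
  | Some u, Some v => adj H u v
  | _, _ => false
  end.

(* The graph with an edge uv when u != v and e holds between u and v, in one
   order or the other. *)
Definition graph_arcs n (e : rel 'I_n) : {set 'I_n * 'I_n} :=
  [set p : 'I_n * 'I_n | (p.1 != p.2) && (e p.1 p.2 || e p.2 p.1)].

Fact graph_arcsP n (e : rel 'I_n) : [forall u, (u, u) \notin graph_arcs e] &&
  [forall u, forall v, ((u, v) \in graph_arcs e) == ((v, u) \in graph_arcs e)].
Proof.
apply/andP; split; first by apply/forallP => u; rewrite inE eqxx.
apply/forallP => u; apply/forallP => v.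
by rewrite !inE /= [v == u]eq_sym [e v u || _]orbC.
Qed.

Definition graph_of n (e : rel 'I_n) : lgraph n := LGraph (graph_arcsP e).

Definition complete n : lgraph n := graph_of (fun _ _ => true).
Definition edgeless n : lgraph n := graph_of (fun _ _ => false).

(* The subgraph of H induced by the list ks of distinct vertices, the i-th
   vertex of the list becoming vertex i. *)
Definition induced_graph n (H : lgraph n) (ks : seq nat) : lgraph (size ks) :=
  graph_of (fun i j : 'I_(size ks) => adjn H (nth 0%N ks i) (nth 0%N ks j)).

Definition relabel n (s : 'S_n) (H : lgraph n) : lgraph n :=
  graph_of (fun i j => adj H (s i) (s j)).

Definition is_module n (H : lgraph n) (M : {set 'I_n}) : Prop :=
  forall u v w, u \in M -> v \in M -> w \notin M -> adj H u w = adj H v w.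

Definition prime_graph n (H : lgraph n) : Prop :=
  (2 < n)%N /\
  forall M : {set 'I_n}, is_module H M -> (#|M| <= 1)%N \/ M = [set: 'I_n].

(* I is a partial injection from the vertices of H onto those of G which maps
   the subgraph of H induced by its domain to G. *)
Definition is_occ k n (G : lgraph k) (H : lgraph n)
    (I : {ffun 'I_n -> option 'I_k}) : bool :=
  [&& [forall u, forall v, (I u == I v) && (I u != None) ==> (u == v)],
      [forall a, exists u, I u == Some a]
    & [forall u, forall v,
        match I u, I v with
        | Some a, Some b => adj H u v == adj G a b
        | _, _ => true
        end]].

Definition Occ k n (G : lgraph k) (H : lgraph n) : nat :=
  #|[set I | is_occ G H I]|.

Definition OccP (P : forall n, {set lgraph n}) k (G : lgraph k) : fps :=
  Fps (fun m => \sum_(H in P (m + k)%N) (Occ G H)%:R / (m + k)`!%:R).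

Inductive dec :=
| Lin of bool
| Gr n of lgraph n.
Notation Oplus := (Lin true).
Notation Ominus := (Lin false).

(* The subtree of rank k (counted from 0) of a node decorated by a graph H
   corresponds to the vertex k of H. *)
Inductive tree :=
| Leaf of nat
| Node of dec & seq tree.
HB.instance Definition _ := gen_eqMixin tree.
HB.instance Definition _ := gen_choiceMixin tree.

Fixpoint leaves (t : tree) : seq nat :=
  match t with
  | Leaf l => [:: l]
  | Node _ ts => flatten (map leaves ts)
  end.

Definition nleaves (t : tree) : nat := size (leaves t).

Definition minleaf (t : tree) : nat :=
  foldr minn (head 0%N (leaves t)) (leaves t).

(* A 2-vertex decoration is identified with a linear one: the latter is chosen
   as its representative, so proper graph decorations have at least 3 vertices. *)
Definition dec_arity (d : dec) (k : nat) : bool :=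
  match d with
  | Lin _ => true
  | Gr n _ => (2 < n)%N && (n == k)
  end.

Definition dec_of n (H : lgraph n) : dec :=
  if n == 2%N then Lin (adjn H 0 1) else Gr H.

(* Non-plane trees are represented by ordering the children of every node by
   minimal leaf label, which makes isomorphic labeled trees equal. *)
Fixpoint wf_nodes (t : tree) : bool :=
  match t with
  | Leaf _ => true
  | Node d ts =>
      [&& (1 < size ts)%N, dec_arity d (size ts),
          sorted (fun u v => (minleaf u < minleaf v)%N) ts & all wf_nodes ts]
  end.

Definition subst_tree (t : tree) : bool :=
  wf_nodes t && perm_eq (leaves t) (iota 1 (nleaves t)).

Definition root_dec (t : tree) : option dec :=
  if t is Node d _ then Some d else None.

Definition is_lin (b : bool) (d : option dec) : bool :=
  if d is Some (Lin c) then b == c else false.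

Fixpoint md_nodes (t : tree) : Prop :=
  match t with
  | Leaf _ => True
  | Node d ts =>
      match d with
      | Lin b => all (fun u => ~~ is_lin b (root_dec u)) ts
      | Gr _ H => prime_graph H
      end /\ foldr (fun u => and (md_nodes u)) True ts
  end.

Definition md_tree (t : tree) : Prop := subst_tree t /\ md_nodes t.

Fixpoint decs_in (P : forall n, {set lgraph n}) (t : tree) : bool :=
  match t with
  | Leaf _ => true
  | Node d ts =>
      (if d is Gr n H then H \in P n else true) && all (decs_in P) ts
  end.

(* A node is given by its address, the list of the ranks of the children
   chosen on the path from the root. *)
Fixpoint subtree (t : tree) (p : seq nat) : option tree :=
  if p is k :: p' then
    if t is Node _ ts then
      if onth ts k is Some u then subtree u p' else None
    else None
  else Some t.

Definition dec_at (t : tree) (p : seq nat) : option dec :=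
  obind root_dec (subtree t p).

Definition nonlinear_at (t : tree) (p : seq nat) : bool :=
  if dec_at t p is Some (Gr _ _) then true else false.

Fixpoint inodes (t : tree) : seq (seq nat) :=
  match t with
  | Leaf _ => [::]
  | Node _ ts =>
      [::] :: flatten [seq [seq pk.2 :: q | q <- pk.1]
                      | pk <- zip (map inodes ts) (iota 0 (size ts))]
  end.

Definition arity_at (t : tree) (p : seq nat) : nat :=
  if subtree t p is Some (Node _ ts) then size ts else 0%N.

Definition edges (t : tree) : seq (seq nat * seq nat) :=
  [seq (p, rcons p k) | p <- inodes t, k <- iota 0 (arity_at t p)].

(* The children of a node on the path to the blossom are split into those that
   do not contain the blossom, ordered by minimal leaf label, and the one that
   does; in a graph decoration the latter corresponds to the last vertex, which
   stands for the vertex labeled *. *)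
Inductive btree :=
| Blossom
| BNode of dec & seq tree & btree.
HB.instance Definition _ := gen_eqMixin btree.
HB.instance Definition _ := gen_choiceMixin btree.

Fixpoint bsize (b : btree) : nat :=
  match b with
  | Blossom => 0%N
  | BNode _ ts b' => (sumn (map nleaves ts) + bsize b')%N
  end.

Definition broot_dec (b : btree) : option dec :=
  if b is BNode d _ _ then Some d else None.

Fixpoint bparent_dec (b : btree) : option dec :=
  match b with
  | Blossom => None
  | BNode d _ Blossom => Some d
  | BNode _ _ b' => bparent_dec b'
  end.

Definition replaceable (s : bool) (b : btree) : bool :=
  ~~ is_lin s (bparent_dec b).

Fixpoint reduce_labels (l : nat) (t : tree) : tree :=
  match t with
  | Leaf i => Leaf (if (l < i)%N then i.-1 else i)
  | Node d ts => Node d (map (reduce_labels l) ts)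
  end.

Definition del_nth (T : Type) (k : nat) (s : seq T) : seq T :=
  take k s ++ drop k.+1 s.

Definition star_dec (k : nat) (d : dec) : dec :=
  match d with
  | Lin b => Lin b
  | Gr n H => Gr (induced_graph H (rcons (del_nth k (iota 0 n)) k))
  end.

Fixpoint blossoming (l : nat) (t : tree) : btree :=
  match t with
  | Leaf _ => Blossom
  | Node d ts =>
      let k := find (fun u => l \in leaves u) ts in
      BNode (star_dec k d) (map (reduce_labels l) (del_nth k ts))
            (nth Blossom (map (blossoming l) ts) k)
  end.

Definition marking (t : tree) (J : {fmap nat -> nat}) : Prop :=
  (forall l, l \in domf J -> l \in leaves t) /\
  (forall l l' m, J.[? l]%fmap = Some m -> J.[? l']%fmap = Some m -> l = l').

(* Given, for each child of a node, the subtree induced by the marked leaves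
   below it, the list of those that exist, paired with the rank of the child,
   and ordered by minimal new leaf label. *)
Definition kept (us : seq (option tree)) : seq (nat * tree) :=
  sort (fun a b => (minleaf a.2 <= minleaf b.2)%N)
    (pmap (fun ku => omap (pair ku.1) ku.2) (zip (iota 0 (size us)) us)).

Definition induced_dec (d : dec) (ks : seq nat) : dec :=
  match d with
  | Lin b => Lin b
  | Gr _ H => dec_of (induced_graph H ks)
  end.

(* A node with exactly one child containing marked leaves is not a first common
   ancestor of marked leaves, and disappears. *)
Fixpoint induced_subtree (J : {fmap nat -> nat}) (t : tree) : option tree :=
  match t with
  | Leaf l => omap Leaf J.[? l]%fmap
  | Node d ts =>
      match kept (map (induced_subtree J) ts) with
      | [::] => None
      | [:: (_, u)] => Some u
      | us => Some (Node (induced_dec d (unzip1 us)) (unzip2 us))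
      end
  end.

(* The address in t of the node corresponding to the node at address p of the
   subtree induced by J. *)
Fixpoint phi (J : {fmap nat -> nat}) (t : tree) (p : seq nat) : seq nat :=
  match t with
  | Leaf _ => [::]
  | Node _ ts =>
      let down k q := k :: nth (fun=> [::]) (map (phi J) ts) k q in
      match unzip1 (kept (map (induced_subtree J) ts)), p with
      | [:: k], _ => down k p
      | _, [::] => [::]
      | ks, j :: p' => down (nth 0%N ks j) p'
      end
  end.

Definition dec_graph (k : nat) (d : dec) : lgraph k :=
  match d with
  | Lin true => complete k
  | Lin false => edgeless k
  | Gr _ H => graph_of (fun i j : 'I_k => adjn H i j)
  end.

Fixpoint graph_tree (t : tree) : tree :=
  match t with
  | Leaf l => Leaf l
  | Node d ts => Node (Gr (dec_graph (size ts) d)) (map graph_tree ts)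
  end.

(* Decorations are compared as graphs, the sign of a linear node with k children
   standing for the complete or edgeless graph on k vertices; this matters when
   k >= 3 vertices of a prime decoration induce such a graph. *)
Definition tree_iso (t u : tree) : Prop := graph_tree t = graph_tree u.

Definition nonlinear_nodes (tau t : tree) (J : {fmap nat -> nat}) :
    {fset seq nat} :=
  [fset p in inodes tau | nonlinear_at t (phi J t p)]%fset.

Section Series.
Variable P : forall n, {set lgraph n}.

Definition P_trees : set tree := [set t | md_tree t /\ decs_in P t].
Definition P_btrees : set btree :=
  [set b | exists t l, [/\ P_trees t, l \in leaves t & b = blossoming l t]].

Definition T_all : fps := egf P_trees nleaves.
Definition T_not_oplus : fps :=
  egf [set t | P_trees t /\ ~~ is_lin true (root_dec t)] nleaves.
Definition T_blo : fps := egf P_btrees bsize.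
Definition T_blo_not_oplus : fps :=
  egf [set b | P_btrees b /\ ~~ is_lin true (broot_dec b)] bsize.
Definition T_oplus : fps :=
  egf [set b | P_btrees b /\ replaceable true b] bsize.
Definition T_ominus_not_oplus : fps :=
  egf [set b | [/\ P_btrees b, ~~ is_lin true (broot_dec b)
                 & replaceable false b]] bsize.
Definition T_oplus_not_oplus : fps :=
  egf [set b | [/\ P_btrees b, ~~ is_lin true (broot_dec b),
                   replaceable true b & b <> Blossom]] bsize.

Definition marked_trees (tau : tree) : set (tree * {fmap nat -> nat}) :=
  [set tJ | [/\ P_trees tJ.1, marking tJ.1 tJ.2
              & exists2 u, induced_subtree tJ.2 tJ.1 = Some u
                         & tree_iso u tau]].

Definition T_marked (tau : tree) (N : {fset seq nat}) : fps :=
  egf [set tJ | marked_trees tau tJ /\ nonlinear_nodes tau tJ.1 tJ.2 = N]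
    (fun tJ => nleaves tJ.1).

Definition OccP_at (tau : tree) (p : seq nat) : fps :=
  if subtree tau p is Some (Node d ts) then OccP P (dec_graph (size ts) d)
  else 0.

End Series.

Definition same_sign (tau : tree) (p q : seq nat) : bool :=
  has (fun b => is_lin b (dec_at tau p) && is_lin b (dec_at tau q))
    [:: true; false].

Section Edges.
Variables (tau : tree) (N : {fset seq nat}).

Definition in_N p := (p \in inodes tau) && (p \in N).
Definition out_N p := (p \in inodes tau) && (p \notin N).
Definition is_leaf p := p \notin inodes tau.

Definition count_edges (e : rel (seq nat)) : nat :=
  count (fun pq => e pq.1 pq.2) (edges tau).

Definition d_eq :=
  count_edges (fun p q => [&& out_N p, out_N q & same_sign tau p q]).
Definition d_neq :=
  count_edges (fun p q => [&& out_N p, out_N q & ~~ same_sign tau p q]).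
Definition d_out_in := count_edges (fun p q => out_N p && in_N q).
Definition d_in_out := count_edges (fun p q => in_N p && out_N q).
Definition d_in_in := count_edges (fun p q => in_N p && in_N q).
Definition d_out_leaf := count_edges (fun p q => out_N p && is_leaf q).
Definition d_in_leaf := count_edges (fun p q => in_N p && is_leaf q).
Definition n_L := count out_N (inodes tau).

End Edges.

(* Main.v *)
Require Import Defs.
From HB Require Import structures.
From mathcomp Require Import all_boot all_order all_algebra all_fingroup finmap.
From mathcomp Require Import boolp classical_sets cardinality.
From mathcomp Require Import zify ring.

Set Implicit Arguments.
Unset Strict Implicit.
Unset Printing Implicit Defensive.

Import GRing.Theory Num.Theory.
Local Open Scope ring_scope.

(** A labeled non-plane tree has, over all choices of an order of the children of
    every node (the decorations being relabeled along, which P allows), total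
    weight 1 when a plane tree weighs the product of 1/k! over the numbers k of
    children of its nodes. As a plane tree with n leaves has n! labelings, every
    exponential generating function of the statement is the generating function
    of a weighted class of plane trees without labels, whose leaves only carry
    their marks. A marked tree inducing tau is then a tree with a single mark, in
    place of which is plugged a tree whose root is the node corresponding to the
    root of tau; the children of this root are, in any order, unmarked trees and
    marked trees inducing the subtrees of tau, and one concludes by induction on
    tau. Exchanging the signs of all linear nodes reduces the negative nodes to
    the positive ones. *)

(** * Formal power series and weighted sums *)

(** All root and blossom conditions concern the types of adjacent nodes. As leaves and non-linear
    nodes share the type [None], one family [path_gf a r] covers every blossomed series and both
    derivatives: it counts the chains of unrecorded nodes that can be inserted between a node of
    type [a] and a node of type [r] below it. The single blossom is excluded from the series with
    both constraints $\oplus$ because an empty chain would make two nodes of the same sign adjacent.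

    A blossom is not counted in the size, while a marked leaf is, so the identities between the two
    are proved after multiplication by z. Moreover the same blossomed tree arises from several pairs
    of a tree and a leaf; the pair in which the leaf has the largest label serves as representative.

    Sorting children by minimal label is destroyed as soon as labels are erased or a subtree is
    replaced. The weights remove this obstacle: order is discarded first, and every decomposition is
    carried out on plane trees whose children are in arbitrary order. *)

Lemma coefsD f g n : coefs (f + g) n = coefs f n + coefs g n.
Proof. by []. Qed.

Lemma coefsM f g n : coefs (f * g) n = \sum_(i < n.+1) coefs f i * coefs g (n - i)%N.
Proof. by []. Qed.

Lemma coefs1 n : coefs 1 n = (n == 0%N)%:R.
Proof. by []. Qed.

Lemma coefs_sum (I : Type) (r : seq I) (F : I -> fps) n :
  coefs (\sum_(i <- r) F i) n = \sum_(i <- r) coefs (F i) n.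
Proof. by elim/big_rec2: _ => // i y x _ <-. Qed.

Lemma coefs_zM f n : coefs (fps_z * f) n = if n is m.+1 then coefs f m else 0.
Proof.
rewrite coefsM; case: n => [|n]; first by rewrite big_ord1 /= mul0r.
rewrite 2!big_ord_recl /= mul0r add0r mul1r big1 ?addr0 ?subSS ?subn0 //.
by move=> i _; rewrite mul0r.
Qed.

(** Cancels the factor z that restores the blossom as a leaf. *)
Lemma fps_zI : injective ( *%R fps_z).
Proof.
move=> f g fg; apply: fps_eqP => n.
by have := congr1 (fun h => coefs h n.+1) fg; rewrite !coefs_zM.
Qed.

Lemma coefs_X_gt g k n : coefs g 0 = 0 -> (n < k)%N -> coefs (g ^+ k) n = 0.
Proof.
move=> g0; elim: k n => [//|k IH] n nk; rewrite exprS coefsM.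
rewrite big_ord_recl g0 mul0r add0r big1 // => i _.
by rewrite IH ?mulr0 //= /bump /=; have := ltn_ord i; lia.
Qed.

(** Powers beyond n do not reach the coefficient of index n, so a single truncation bound can serve
    all coefficients of a product, which lets sums be exchanged. *)
Lemma coefs_comp_wide f g n K : coefs g 0 = 0 -> (n < K)%N ->
  coefs (fps_comp f g) n = \sum_(k < K) coefs f k * coefs (g ^+ k) n.
Proof.
move=> g0 nK /=; rewrite -!(big_mkord xpredT (fun k => coefs f k * coefs (g ^+ k) n)).
rewrite [RHS](big_cat_nat (leq0n n.+1)) //= [X in _ + X]big_nat_cond.
by rewrite [X in _ + X]big1 ?addr0 // => k /andP[/andP[nk _] _]; rewrite coefs_X_gt ?mulr0.
Qed.

Lemma coefs_mul_comp f g h n K : coefs g 0 = 0 -> (n < K)%N ->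
  coefs (h * fps_comp f g) n = \sum_(k < K) coefs f k * coefs (h * g ^+ k) n.
Proof.
move=> g0 nK; rewrite coefsM.
under eq_bigr => i _ do
  rewrite (@coefs_comp_wide _ _ _ K) // ?(leq_ltn_trans (leq_subr _ _)) // mulr_sumr.
rewrite exchange_big; apply: eq_bigr => k _; rewrite [in RHS]coefsM mulr_sumr.
by apply: eq_bigr => i _; rewrite mulrCA.
Qed.

Lemma fps_expD f g : coefs f 0 = 0 -> coefs g 0 = 0 ->
  fps_exp (f + g) = fps_exp f * fps_exp g.
Proof.
move=> f0 g0; apply: fps_eqP => n.
have fg0 : coefs (f + g) 0 = 0 by rewrite coefsD f0 g0 addr0.
rewrite (@coefs_mul_comp _ _ _ _ n.+1) // [LHS]/=.
(* Both sides are sums of [c i j]: the left one along the antidiagonals i + j = k, the right one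
   over the square of side n + 1, whose part with i + j > n vanishes by [c0]. *)
pose c (i j : nat) : rat := i`!%:R^-1 * j`!%:R^-1 * coefs (f ^+ i * g ^+ j) n.
have c0 i j : (n < i + j)%N -> c i j = 0.
  move=> nij; rewrite /c coefsM big1 ?mulr0 // => k _.
  have [ki|ik] := ltnP k i; first by rewrite coefs_X_gt // mul0r.
  by rewrite [X in _ * X]coefs_X_gt ?mulr0 //; have := ltn_ord k; lia.
transitivity (\sum_(k < n.+1) \sum_(i < n.+1 | (i <= k)%N) c i (k - i)%N).
  apply: eq_bigr => k _; rewrite addrC exprDn coefs_sum mulr_sumr.
  transitivity (\sum_(i < k.+1) c i (k - i)%N).
    apply: eq_bigr => i _; rewrite /c mulrC [g ^+ _ * _]mulrC.
    have -> m h : coefs (h *+ m) n = m%:R * coefs h n.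
      by elim: m => [|m IH]; rewrite ?mul0r // mulrSr coefsD IH mulrSr mulrDl mul1r.
    rewrite mulrAC; congr (_ * _).
    have ik : (i <= k)%N by rewrite -ltnS.
    apply: (mulIf (x := k`!%:R)); first by rewrite pnatr_eq0 -lt0n fact_gt0.
    rewrite mulfVK ?pnatr_eq0 -?lt0n ?fact_gt0 // -(bin_fact ik) natrM mulrCA.
    rewrite natrM mulrACA !mulVf ?mulr1 ?pnatr_eq0 -?lt0n ?fact_gt0 //.
  rewrite -(big_mkord xpredT (fun i => c i (k - i)%N)).
  rewrite -(big_mkord (fun i => (i <= k)%N) (fun i => c i (k - i)%N)).
  rewrite [RHS](big_cat_nat (leq0n k.+1)) //= [X in _ + X]big_nat_cond.
  rewrite [X in _ + X]big1 ?addr0; last by move=> i /andP[] /andP[]; lia.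
  by rewrite big_nat_cond [RHS]big_nat_cond; apply: eq_bigl => i /=; lia.
rewrite (exchange_big_dep xpredT) //.
transitivity (\sum_(j < n.+1) \sum_(k < n.+1) c j k); last first.
  rewrite exchange_big; apply: eq_bigr => k _.
  rewrite [_ * g ^+ k]mulrC (@coefs_mul_comp _ _ _ _ n.+1) // mulr_sumr.
  by apply: eq_bigr => j _; rewrite /c [f ^+ _ * _]mulrC -mulrA mulrCA.
apply: eq_bigr => j _.
rewrite -(big_mkord xpredT (c j)).
rewrite -(big_mkord (fun k => (j <= k)%N) (fun k => c j (k - j)%N)).
rewrite big_mkcond (big_cat_nat (leq0n j)) /=; last by rewrite ltnW.
rewrite [X in X + _]big_nat_cond big1 ?add0r; last first.
  by move=> k /andP[/andP[_ kj] _]; rewrite leqNgt kj.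
rewrite -{1}[j : nat]add0n big_addn.
rewrite [RHS](big_cat_nat (leq0n (n.+1 - j))) ?leq_subr //=.
rewrite [X in _ = _ + X]big_nat_cond [X in _ = _ + X]big1 ?addr0; last first.
  by move=> k /andP[/andP[nk _] _]; apply: c0; lia.
by apply: eq_bigr => k _; rewrite leq_addl addnK.
Qed.

Lemma fps_exp0 : fps_exp 0 = 1.
Proof.
apply: fps_eqP => n; rewrite /= big_ord_recl /= big1 ?addr0.
  by rewrite fact0 invr1 mul1r.
by move=> i _; rewrite exprS mul0r mulr0.
Qed.

Lemma fps_expMn f n : coefs f 0 = 0 -> fps_exp (f *+ n) = fps_exp f ^+ n.
Proof.
move=> f0; elim: n => [|n IH]; first by rewrite mulr0n expr0 fps_exp0.
rewrite mulrS exprS fps_expD ?IH //.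
by elim: n {IH} => // n IH; rewrite mulrS coefsD f0 IH addr0.
Qed.

(** * Weighted sums over sets and generating functions of weighted classes *)

Definition wsum (X : choiceType) (A : set X) (w : X -> rat) : rat :=
  \sum_(x <- fset_set A) w x.

Lemma in_fset_setE (X : choiceType) (A : set X) x :
  finite_set A -> (x \in fset_set A) = `[<A x>].
Proof. by move=> finA; rewrite in_fset_set //; apply/idP/asboolP; rewrite inE. Qed.

(** An infinite set has the empty set as default value, so membership is contradictory there. For
    the same reason a sum over an infinite set is 0, and each class is proved finite in every
    size. *)
Lemma mem_fset_set (X : choiceType) (A : set X) x :
  x \in fset_set A -> A x.
Proof.
have [finA|ninA] := pselect (finite_set A).
  by rewrite in_fset_setE // => /asboolP.
by rewrite /fset_set; case: pselect.
Qed.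

Lemma mem_fset_setT (X : choiceType) (A : set X) x :
  finite_set A -> A x -> x \in fset_set A.
Proof. by move=> finA Ax; rewrite in_fset_setE //; apply/asboolP. Qed.

Lemma eq_wsum (X : choiceType) (A : set X) (w w' : X -> rat) :
  (forall x, A x -> w x = w' x) -> wsum A w = wsum A w'.
Proof.
move=> ww'; rewrite /wsum !big_seq; apply: eq_bigr => x xA; apply: ww'.
exact: mem_fset_set xA.
Qed.

Lemma wsum_cond (X : choiceType) (A B : set X) (w : X -> rat) :
  (forall x, A x <-> B x) -> wsum A w = wsum B w.
Proof. by move=> AB; congr wsum; apply/seteqP; split=> x /AB. Qed.

Lemma wsum_seq (X : choiceType) (s : seq X) (A : set X) (w : X -> rat) :
  uniq s -> (forall x, A x <-> x \in s) -> wsum A w = \sum_(x <- s) w x.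
Proof.
move=> us As; have -> : A = [set` s]%classic by apply/seteqP; split=> x /As.
apply: perm_big; apply: uniq_perm => // x.
by rewrite in_fset_setE; [apply/asboolP/idP | exact: finite_seq].
Qed.

Lemma finite_set_in_seq (X : choiceType) (s : seq X) (A : set X) :
  (forall x, A x -> x \in s) -> finite_set A.
Proof. by move=> As; apply: (@sub_finite_set _ A [set` s]%classic) => //; apply: finite_seq. Qed.

(** The disjoint union behind the decompositions below (by size, by sorted representative, by number
    of children and their positions): the last hypothesis gives both disjointness of the pieces and
    injectivity on each. *)
Lemma wsum_sigma (I : eqType) (X Y : choiceType) (r : seq I) (B : I -> set Y)
    (A : set X) (g : I -> Y -> X) (w : X -> rat) :
  uniq r -> (forall i, i \in r -> finite_set (B i)) ->
  (forall x, A x <-> exists i y, [/\ i \in r, B i y & x = g i y]) ->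
  (forall i i' y y', i \in r -> i' \in r -> B i y -> B i' y' ->
     g i y = g i' y' -> i = i' /\ y = y') ->
  wsum A w = \sum_(i <- r) wsum (B i) (fun y => w (g i y)).
Proof.
move=> ur finB AE inj.
rewrite (wsum_seq (s := [seq g i y | i <- r, y <- (fset_set (B i) : seq Y)])).
- by rewrite big_allpairs_dep.
- apply: allpairs_uniq_dep => [//|i ir|]; first exact: fset_uniq.
  move=> _ _ /allpairsPdep[i [y [ir yB ->]]] /allpairsPdep[i' [y' [ir' yB' ->]]] /=.
  by move=> /(inj i i' y y' ir ir' (mem_fset_set yB) (mem_fset_set yB')) [<- <-].
- move=> x; split=> [/AE[i [y [ir By ->]]]|/allpairsPdep[i [y [ir yB ->]]]].
    apply/allpairsPdep; exists i, y; split=> //.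
    by apply: mem_fset_setT; first exact: finB.
  by apply/AE; exists i, y; split=> //; apply: mem_fset_set yB.
Qed.

Lemma wsum_bij (X Y : choiceType) (B : set Y) (A : set X) (g : Y -> X) (w : X -> rat) :
  finite_set B -> (forall x, A x <-> exists2 y, B y & x = g y) ->
  (forall y y', B y -> B y' -> g y = g y' -> y = y') ->
  wsum A w = wsum B (w \o g).
Proof.
move=> finB AE inj.
rewrite (@wsum_sigma unit _ _ [:: tt] (fun=> B) _ (fun=> g)) ?big_seq1 //.
- move=> x; split=> [/AE[y By ->]|[[] [y [_ By ->]]]]; first by exists tt, y.
  by apply/AE; exists y.
- by move=> [] [] y y' _ _ By By' /(inj _ _ By By').
Qed.

Lemma wsum1 (X : choiceType) (A : set X) :
  wsum A (fun=> 1) = #|` fset_set A|%:R.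
Proof. by rewrite /wsum big_const_seq count_predT iter_addr_0. Qed.

Lemma wsumMr (X : choiceType) (A : set X) (w : X -> rat) (c : rat) :
  wsum A (fun x => w x * c) = wsum A w * c.
Proof. by rewrite /wsum mulr_suml. Qed.

Lemma wsum_prod (X Y : choiceType) (A : set X) (B : set Y) (C : set (X * Y)) w :
  finite_set A -> finite_set B -> (forall p, C p <-> A p.1 /\ B p.2) ->
  wsum C w = \sum_(x <- fset_set A) wsum B (fun y => w (x, y)).
Proof.
move=> finA finB CE.
rewrite (@wsum_sigma X _ Y (fset_set A) (fun=> B) _ pair) //.
- move=> [x y]; split=> [/CE /= [Ax By]|[i [y' [iA By [-> ->]]]]].
    by exists x, y; split=> //; apply: mem_fset_setT.
  by apply/CE; split=> //; apply: mem_fset_set iA.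
- by move=> x x' y y' _ _ _ _ [-> ->].
Qed.

Section GF.
Local Open Scope classical_set_scope.
Variables (X : choiceType) (w : X -> rat) (sz : X -> nat).

Definition gf (C : set X) : fps :=
  Fps (fun n => wsum [set x | C x /\ sz x = n] w).

Definition locfin (C : set X) := forall n, finite_set [set x | C x /\ sz x = n].

End GF.

Lemma eq_gf (X : choiceType) (w : X -> rat) sz (C D : set X) :
  (forall x, C x <-> D x) -> gf w sz C = gf w sz D.
Proof.
by move=> CD; apply: fps_eqP => n; apply: wsum_cond => x; rewrite /= CD.
Qed.

(** The product rule, for pairs encoded injectively by [g] with additive sizes and multiplicative
    weights. *)
Lemma wsumX_conv (X Y Z : choiceType) (wX : X -> rat) szX (C : set X)
    (wY : Y -> rat) szY (D : set Y) (A : set Z) (w : Z -> rat) (g : X * Y -> Z) n :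
  locfin szX C -> locfin szY D ->
  (forall z, A z <-> exists2 p, [/\ C p.1, D p.2 & (szX p.1 + szY p.2)%N = n] & z = g p) ->
  (forall p q, C p.1 -> D p.2 -> C q.1 -> D q.2 -> g p = g q -> p = q) ->
  (forall p, C p.1 -> D p.2 -> w (g p) = wX p.1 * wY p.2) ->
  wsum A w = coefs (gf wX szX C * gf wY szY D) n.
Proof.
move=> finC finD AE inj wE; rewrite coefsM.
rewrite -(big_mkord xpredT (fun i => coefs (gf wX szX C) i * coefs (gf wY szY D) (n - i)%N)).
pose B i := [set p : X * Y | (C p.1 /\ szX p.1 = i) /\ (D p.2 /\ szY p.2 = n - i)%N]%classic.
have finB i : finite_set (B i).
  apply: (@sub_finite_set _ _ ([set x | C x /\ szX x = i] `*` [set y | D y /\ szY y = n - i]%N)%classic).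
    by move=> [x y].
  exact: finite_setX.
rewrite (@wsum_sigma _ _ _ (index_iota 0 n.+1) B _ (fun=> g)).
- apply: eq_bigr => i _.
  rewrite (@wsum_prod _ _ [set x | C x /\ szX x = i]%classic
    [set y | D y /\ szY y = n - i]%N%classic) //=.
  rewrite /wsum mulr_suml !big_seq; apply: eq_bigr => x /mem_fset_set[Cx _].
  rewrite mulr_sumr !big_seq; apply: eq_bigr => y /mem_fset_set[Dy _].
  by rewrite wE.
- exact: iota_uniq.
- by [].
- move=> z; split=> [/AE[[x y] /= [Cx Dy xy] ->]|[i [[x y] [ir [[/= Cx xi] [Dy yi]] ->]]]].
    exists (szX x), (x, y); split=> //; first by rewrite mem_index_iota; lia.
    by split=> //; split=> //=; lia.
  by apply/AE; exists (x, y) => //=; split=> //; move: ir; rewrite mem_index_iota; lia.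
- move=> i i' p q _ _ [[Cp pi] [Dp _]] [[Cq qi] [Dq _]] /(inj p q Cp Dp Cq Dq) pq.
  by split=> //; rewrite -pi -qi pq.
Qed.

Section Seqs.
Local Open Scope classical_set_scope.
Variables (X : choiceType) (w : X -> rat) (sz : X -> nat).

Fixpoint seqcls (Cs : seq (set X)) (xs : seq X) : Prop :=
  match Cs, xs with
  | [::], [::] => True
  | C :: Cs', x :: xs' => C x /\ seqcls Cs' xs'
  | _, _ => False
  end.

Lemma seqclsP x0 Cs xs : seqcls Cs xs <->
  size xs = size Cs /\ forall i, (i < size Cs)%N -> nth set0 Cs i (nth x0 xs i).
Proof.
elim: Cs xs => [|C Cs IH] [|x xs] //=.
- by split=> // -[].
- by split=> // -[].
- split=> [[Cx /IH[-> H]]|[[Exs] H]]; first by split=> // -[|i] //= /H.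
  by split; [exact: (H 0%N) | apply/IH; split=> // i; apply: (H i.+1)].
Qed.

Lemma locfin_seqcls Cs : (forall C, C \in Cs -> locfin sz C) ->
  locfin (fun xs => sumn (map sz xs)) (seqcls Cs).
Proof.
elim: Cs => [|C Cs IH] finCs n.
  by apply: (@finite_set_in_seq _ [:: [::]]) => -[|x xs] [].
have finC : locfin sz C by apply: finCs; rewrite mem_head.
have finCs' : locfin (fun xs => sumn (map sz xs)) (seqcls Cs).
  by apply: IH => D DCs; apply: finCs; rewrite inE DCs orbT.
pose r := [seq x :: xs | x <- flatten [seq (fset_set [set x | C x /\ sz x = i] : seq X) | i <- iota 0 n.+1],
   xs <- flatten [seq (fset_set [set x | seqcls Cs x /\ sumn (map sz x) = i] : seq _) | i <- iota 0 n.+1]].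
apply: (@finite_set_in_seq _ r) => -[|x xs] /= [] // [Cx Cxs] xn.
apply/allpairsP; exists (x, xs); split; [| |by []]; apply/flatten_mapP.
  exists (sz x); first by rewrite mem_iota; lia.
  exact: mem_fset_setT.
exists (sumn (map sz xs)); first by rewrite mem_iota; lia.
exact: mem_fset_setT.
Qed.

Lemma gf_seqcls Cs : (forall C, C \in Cs -> locfin sz C) ->
  gf (fun xs => \prod_(x <- xs) w x) (fun xs => sumn (map sz xs)) (seqcls Cs)
  = \prod_(C <- Cs) gf w sz C.
Proof.
elim: Cs => [|C Cs IH] finCs.
  apply: fps_eqP => n; rewrite big_nil coefs1.
  rewrite /= (@wsum_seq _ (if n == 0%N then [:: [::]] else [::])).
  - by case: n => [|n] /=; rewrite ?big_seq1 ?big_nil.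
  - by case: n.
  - move=> -[|x xs]; case: n => [|n] //=; split=> // -[] //.
have finC : locfin sz C by apply: finCs; rewrite mem_head.
have finCs' D : D \in Cs -> locfin sz D by move=> DCs; apply: finCs; rewrite inE DCs orbT.
rewrite big_cons -IH //; apply: fps_eqP => n.
apply: (@wsumX_conv _ _ _ _ _ _ _ _ _ _ _ (fun p => p.1 :: p.2)) => //.
- exact: locfin_seqcls.
- move=> [|x xs] /=; first by split=> [[]|[]].
  split=> [[[Cx Cxs] <-]|[[y ys] /= [Cy Dy yn] [-> ->]]]; first by exists (x, xs).
  by [].
- by move=> [x xs] [y ys] _ _ _ _ [-> ->].
- by move=> [x xs] _ _ /=; rewrite big_cons.
Qed.

End Seqs.

(** * Reorderings of plane trees *)

Notation nt := (nth (Leaf 0%N)).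

(** Children are nested in a list, so the hypotheses on them have to be built by an inner recursion.
    They are indexed by rank because the vertices of decorations and the addresses of nodes are
    ranks. *)
Lemma tree_nind (Pr : tree -> Prop) : (forall l, Pr (Leaf l)) ->
  (forall d ts, (forall i, (i < size ts)%N -> Pr (nt ts i)) -> Pr (Node d ts)) ->
  forall t, Pr t.
Proof.
move=> PL PN; fix IH 1; case=> [l|d ts]; first exact: PL.
apply: PN; move: ts; fix IHs 1; case=> [i|t ts [_|i]].
- by clear IH; rewrite ltn0.
- exact: (IH t).
- exact: (IHs ts i).
Qed.

(** * Decorations under selection of vertices *)

Section Graphs.
Local Open Scope nat_scope.

Lemma adjn_ltn n (H : lgraph n) a b : adjn H a b -> (a < n) && (b < n).
Proof. by rewrite /adjn; case: insubP => // u -> _; case: insubP => // v ->. Qed.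

Lemma adjnE n (H : lgraph n) (u v : 'I_n) : adjn H u v = adj H u v.
Proof. by rewrite /adjn !valK. Qed.

Lemma adj_irr n (H : lgraph n) u : adj H u u = false.
Proof.
by case: H => A /= pA; rewrite /adj /=; case/andP: pA => /forallP/(_ u) /negbTE ->.
Qed.

Lemma adj_sym n (H : lgraph n) u v : adj H u v = adj H v u.
Proof.
by case: H => A /= pA; rewrite /adj /=; case/andP: pA => _ /forallP/(_ u)/forallP/(_ v)/eqP.
Qed.

Lemma adjn_irr n (H : lgraph n) a : adjn H a a = false.
Proof. by rewrite /adjn; case: insubP => // u _ _; rewrite adj_irr. Qed.

Lemma adjn_sym n (H : lgraph n) a b : adjn H a b = adjn H b a.
Proof. by rewrite /adjn; case: (insub a) => [u|]; case: (insub b) => [v|] //; rewrite adj_sym. Qed.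

Lemma lgraph_ext n (H K : lgraph n) :
  (forall u v : 'I_n, adj H u v = adj K u v) -> H = K.
Proof. by move=> HK; apply: val_inj; apply/setP => -[u v]; apply: HK. Qed.

Lemma adj_graph_of n (e : rel 'I_n) u v : adj (graph_of e) u v = (u != v) && (e u v || e v u).
Proof. by rewrite /adj /= inE. Qed.

(** Comparing the decorations [Gr H] rather than the graphs avoids transports along equalities of
    numbers of vertices. *)
Lemma Gr_ext n m (H : lgraph n) (K : lgraph m) : n = m ->
  (forall a b, a < n -> b < n -> adjn H a b = adjn K a b) -> Gr H = Gr K.
Proof.
move=> nm; case: m / nm in K * => HK; congr Gr; apply: lgraph_ext => u v.
by rewrite -!adjnE HK.
Qed.

Lemma Gr_inj n m (H : lgraph n) (K : lgraph m) : Gr H = Gr K ->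
  n = m /\ forall a b, adjn H a b = adjn K a b.
Proof.
move=> E; have nm : n = m by case: E.
split=> // a b.
(* The adjacency of a and b is read off the decoration as a boolean, whose type does not depend on
   the number of vertices. *)
by apply: (f_equal (fun d => if d is Gr n H then adjn H a b else false) E).
Qed.

Lemma adjn_induced n (H : lgraph n) ks a b : adjn (induced_graph H ks) a b =
  [&& a < size ks, b < size ks & adjn H (nth 0 ks a) (nth 0 ks b)].
Proof.
apply/idP/idP => [E|/and3P[ak bk E]].
  case/andP: (adjn_ltn E) => ak bk; rewrite ak bk /=.
  move: E; rewrite -[a]/(val (Ordinal ak)) -[b]/(val (Ordinal bk)) adjnE adj_graph_of.
  by case/andP=> _ /orP[] //; rewrite adjn_sym.
rewrite -[a]/(val (Ordinal ak)) -[b]/(val (Ordinal bk)) adjnE adj_graph_of /= E andbT.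
by apply: contraTneq E => -[->]; rewrite adjn_irr.
Qed.

(* The same relabeling as in [star_dec] and [induced_dec], but keeping graphs on
   two vertices as graphs. *)
Definition sel_dec (ks : seq nat) (d : dec) : dec :=
  if d is Gr n H then Gr (induced_graph H ks) else d.

Definition dec_ok k d : bool := if d is Gr n _ then n == k else true.

Lemma sel_dec_comp ks ks' d : all (gtn (size ks)) ks' ->
  sel_dec ks' (sel_dec ks d) = sel_dec (map (nth 0 ks) ks') d.
Proof.
case: d => // n H /allP ks'P; apply: Gr_ext; first by rewrite size_map.
move=> a b ak bk; rewrite !adjn_induced size_map.
have lt i : i < size ks' -> nth 0 ks' i < size ks by move/(mem_nth 0)/ks'P.
case: ltnP => //= ak'; case: ltnP => //= bk'.
by rewrite !(nth_map 0) // !lt.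
Qed.

Lemma sel_dec_iota k d : dec_ok k d -> sel_dec (iota 0 k) d = d.
Proof.
case: d => // n H /= /eqP nk; apply: Gr_ext; first by rewrite size_iota.
move=> a b; rewrite adjn_induced !size_iota => ak bk.
by rewrite ak bk /= !nth_iota.
Qed.

Lemma dec_ok_sel ks d : dec_ok (size ks) (sel_dec ks d).
Proof. by case: d => /=. Qed.

Definition dec_type (d : dec) : option bool := if d is Lin b then Some b else None.

Lemma dec_type_sel ks d : dec_type (sel_dec ks d) = dec_type d.
Proof. by case: d. Qed.

End Graphs.

Section Seqs2.
Local Open Scope nat_scope.
Variable T : eqType.
Implicit Types (s : seq T) (ks : seq nat).

Lemma perm_map_nth x ks s :
  perm_eq ks (iota 0 (size s)) -> perm_eq (map (nth x s) ks) s.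
Proof.
by move=> /(perm_map (nth x s)); rewrite map_nth_iota0 // take_size.
Qed.

Lemma perm_flatten_nth (ss ss' : seq (seq T)) : size ss = size ss' ->
  (forall i, i < size ss -> perm_eq (nth [::] ss i) (nth [::] ss' i)) ->
  perm_eq (flatten ss) (flatten ss').
Proof.
elim: ss ss' => [|s ss IH] [|s' ss'] //= [/IH{}IH] H.
by apply: perm_cat; [apply: (H 0) | apply: IH => i; apply: (H i.+1)].
Qed.

Lemma uniq_flatten_nth (ss : seq (seq T)) x i j : uniq (flatten ss) ->
  x \in nth [::] ss i -> x \in nth [::] ss j -> i = j.
Proof.
elim: ss i j => [|s ss IH] [|i] [|j] //=; rewrite cat_uniq => /and3P[_ /hasPn dis us] xi xj.
- have [jss|jss] := ltnP j (size ss); last by rewrite nth_default in xj.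
  have /dis : x \in flatten ss by apply/flattenP; exists (nth [::] ss j) => //; apply: mem_nth.
  by rewrite /= xi.
- have [jss|jss] := ltnP i (size ss); last by rewrite nth_default in xi.
  have /dis : x \in flatten ss by apply/flattenP; exists (nth [::] ss i) => //; apply: mem_nth.
  by rewrite /= xj.
- by rewrite (IH i j).
Qed.

Fixpoint seqs_in (Ls : seq (seq T)) : seq (seq T) :=
  if Ls is L :: Ls' then [seq x :: y | x <- L, y <- seqs_in Ls'] else [:: [::]].

Lemma mem_seqs_in x0 Ls s : (s \in seqs_in Ls) =
  (size s == size Ls) && all (fun i => nth x0 s i \in nth [::] Ls i) (iota 0 (size Ls)).
Proof.
elim: Ls s => [|L Ls IH] [|x s] //=.
  by apply/negbTE/negP => /allpairsP[[? ?] []].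
rewrite eqSS andbCA -(addn0 1) iotaDl all_map.
rewrite [all _ _](@eq_all _ _ (fun i => nth x0 s i \in nth [::] Ls i)) // -IH.
apply/allpairsP/andP => [[[y s'] /= [yL s'L [-> ->]]]//|[xL sL]].
by exists (x, s).
Qed.

Lemma uniq_seqs_in Ls : all uniq Ls -> uniq (seqs_in Ls).
Proof.
elim: Ls => //= L Ls IH /andP[uL /IH uLs]; apply: allpairs_uniq => //.
by move=> [x s] [y s'] _ _ [-> ->].
Qed.

Lemma sum_seqs_in (w : T -> rat) Ls :
  (\sum_(s <- seqs_in Ls) \prod_(x <- s) w x = \prod_(L <- Ls) \sum_(x <- L) w x)%R.
Proof.
elim: Ls => [|L Ls IH] /=; first by rewrite big_seq1 !big_nil.
rewrite big_allpairs_dep big_cons mulr_suml; apply: eq_bigr => x _.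
by rewrite -IH mulr_sumr; apply: eq_bigr => s _; rewrite big_cons.
Qed.

End Seqs2.

Section Order.
Local Open Scope nat_scope.

Definition ordr (key : nat -> nat) n := sort (relpre key leq) (iota 0 n).

Lemma perm_ordr key n : perm_eq (ordr key n) (iota 0 n).
Proof. by rewrite perm_sort. Qed.

Lemma sorted_ordr key n : (forall i j, i < n -> j < n -> key i = key j -> i = j) ->
  sorted (relpre key ltn) (ordr key n).
Proof.
move=> inj; rewrite -sorted_map ltn_sorted_uniq_leq; apply/andP; split.
  rewrite map_inj_in_uniq ?sort_uniq ?iota_uniq // => i j.
  by rewrite !mem_sort !mem_iota; apply: inj.
by rewrite sorted_map; apply: sort_sorted => i j; apply: leq_total.
Qed.

Lemma sorted_key_eq (T : eqType) (key : T -> nat) s s' : perm_eq s s' ->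
  sorted (relpre key ltn) s -> sorted (relpre key ltn) s' -> s = s'.
Proof.
move=> /perm_mem ss' sd sd'; apply: (irr_sorted_eq _ _ sd sd' ss') => [y x z|x] /=.
  exact: ltn_trans.
exact: ltnn.
Qed.

End Order.

(** A list with multiplicities rather than a set: a tree with equal subtrees is repeated, which lets
    the total weight be 1 for every tree. *)
Fixpoint reorders (t : tree) : seq tree :=
  match t with
  | Leaf l => [:: Leaf l]
  | Node d ts => [seq Node (sel_dec ks d) (map (nt us) ks) |
      ks <- permutations (iota 0 (size ts)), us <- seqs_in (map reorders ts)]
  end.

Lemma reorders_nodeP d ts t : t \in reorders (Node d ts) <->
  exists ks us, [/\ perm_eq ks (iota 0 (size ts)), size us = size ts,
    forall i, (i < size ts)%N -> nt us i \in reorders (nt ts i)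
    & t = Node (sel_dec ks d) (map (nt us) ks)].
Proof.
split=> [/allpairsP[[ks us] /= [pks usO ->]]|[ks [us [pks sz usO ->]]]].
  exists ks, us; move: pks usO; rewrite mem_permutations => pks.
  rewrite (mem_seqs_in (Leaf 0%N)) size_map => /andP[/eqP sz /allP usO]; split=> // i ilt.
  by have := usO i; rewrite mem_iota /= ilt => /(_ isT); rewrite (nth_map (Leaf 0%N)).
apply/allpairsP; exists (ks, us); split=> //=; first by rewrite mem_permutations.
rewrite (mem_seqs_in (Leaf 0%N)) size_map sz eqxx; apply/allP => i; rewrite mem_iota /= => ilt.
by rewrite (nth_map (Leaf 0%N)) ?usO.
Qed.

Lemma reorders_ind (R : tree -> tree -> Prop) : (forall l, R (Leaf l) (Leaf l)) ->
  (forall d ts us ks, perm_eq ks (iota 0 (size ts)) -> size us = size ts ->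
     (forall i, (i < size ts)%N -> nt us i \in reorders (nt ts i)) ->
     (forall i, (i < size ts)%N -> R (nt ts i) (nt us i)) ->
     R (Node d ts) (Node (sel_dec ks d) (map (nt us) ks))) ->
  forall t0 t, t \in reorders t0 -> R t0 t.
Proof.
move=> RL RN; elim/tree_nind => [l|d ts IH] t; first by rewrite inE => /eqP ->.
move=> /reorders_nodeP[ks [us [pks sz usO ->]]]; apply: RN => // i ilt.
by apply: IH => //; apply: usO.
Qed.

Definition root_type (t : tree) : option bool := if t is Node d _ then dec_type d else None.

Fixpoint arity_ok (t : tree) : bool :=
  if t is Node d ts then [&& (1 < size ts)%N, dec_ok (size ts) d & all arity_ok ts] else true.

Definition regular t := arity_ok t && uniq (leaves t).

Fixpoint weight (t : tree) : rat :=
  if t is Node _ ts then (size ts)`!%:R^-1 * foldr (fun u => *%R (weight u)) 1 ts else 1.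

Lemma weightE d ts : weight (Node d ts) = (size ts)`!%:R^-1 * \prod_(t <- ts) weight t.
Proof.
by rewrite /=; congr (_ * _); elim: ts => [|t ts IH] /=; rewrite ?big_nil ?big_cons ?IH.
Qed.

Lemma leaves_reorders t0 t : t \in reorders t0 -> perm_eq (leaves t) (leaves t0).
Proof.
move: t0 t; apply: reorders_ind => // d ts us ks pks sz _ IH /=.
apply: (@perm_trans _ (flatten (map leaves us))).
  by apply: perm_flatten; apply: perm_map; apply: perm_map_nth; rewrite sz.
apply: perm_flatten_nth; rewrite !size_map // sz => i ilt.
by rewrite !(nth_map (Leaf 0%N)) ?sz // IH.
Qed.

Lemma root_type_reorders t0 t : t \in reorders t0 -> root_type t = root_type t0.
Proof.
by move: t0 t; apply: reorders_ind => // d ts us ks pks sz _ IH /=; rewrite dec_type_sel.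
Qed.

Lemma arity_ok_reorders t0 t : t \in reorders t0 -> arity_ok t0 -> arity_ok t.
Proof.
move: t0 t; apply: reorders_ind => // d ts us ks pks sz _ IH /= /and3P[sz2 _ /allP wts].
rewrite size_map dec_ok_sel (perm_size pks) size_iota sz2 /=.
rewrite (perm_all _ (perm_map_nth _ _)) ?sz //; apply/allP => _ /(nthP (Leaf 0%N))[i ilt <-].
by rewrite sz in ilt; apply: IH => //; apply/wts/mem_nth.
Qed.

Lemma regular_reorders t0 t : t \in reorders t0 -> regular t0 -> regular t.
Proof.
by move=> tO /andP[w u]; rewrite /regular (arity_ok_reorders tO) // (perm_uniq (leaves_reorders tO)).
Qed.

Lemma arity_ok_node d ts i : arity_ok (Node d ts) -> (i < size ts)%N -> arity_ok (nt ts i).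
Proof. by move=> /and3P[_ _ /allP wts] ilt; apply: wts; apply: mem_nth. Qed.

Lemma regular_node d ts i : regular (Node d ts) -> (i < size ts)%N -> regular (nt ts i).
Proof.
move=> /andP[wt uts] ilt; rewrite /regular (arity_ok_node wt) //=.
elim: ts uts i ilt {wt} => //= t ts IH; rewrite cat_uniq => /and3P[ut _ uts] [|i] //.
exact: IH.
Qed.

Lemma leaves_gt0 t : arity_ok t -> (0 < size (leaves t))%N.
Proof.
elim/tree_nind: t => // d [|t ts] IH //= /and3P[_ _ /andP[wt _]].
by rewrite size_cat addn_gt0 (IH 0%N).
Qed.

Lemma reorders_refl t : arity_ok t -> t \in reorders t.
Proof.
elim/tree_nind: t => [l _|d ts IH wt]; first by rewrite inE.
apply/reorders_nodeP; exists (iota 0 (size ts)), ts; split=> //.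
  by move=> i ilt; apply: IH => //; apply: arity_ok_node wt _.
rewrite map_nth_iota0 // take_size sel_dec_iota //; by case/and3P: wt.
Qed.

Lemma reorders_sym t0 t : arity_ok t0 -> t \in reorders t0 -> t0 \in reorders t.
Proof.
move=> w0 tO; move: t0 t tO w0; apply: reorders_ind => [l _|d ts us ks pks sz _ IH wt].
  by rewrite inE.
have szk : size ks = size ts by rewrite (perm_size pks) size_iota.
have uk : uniq ks by rewrite (perm_uniq pks) iota_uniq.
have mk i : (i \in ks) = (i < size ts)%N by rewrite (perm_mem pks) mem_iota.
(* The inverse permutation: the child of old rank i stands at position [index i ks]. *)
pose ki := map (index^~ ks) (iota 0 (size ts)).
have kiK : map (nth 0%N ks) ki = iota 0 (size ts).
  rewrite -map_comp -[RHS]map_id; apply/eq_in_map => i; rewrite mem_iota /= => ilt.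
  by rewrite nth_index // mk.
have szki : size ki = size ks by rewrite size_map size_iota szk.
have kilt : all (gtn (size ks)) ki.
  by apply/allP => _ /mapP[i + ->]; rewrite mem_iota /= -mk -index_mem.
apply/reorders_nodeP; exists ki, (map (nt ts) ks); rewrite !size_map; split.
- have uki : uniq ki by rewrite (@map_uniq _ _ (nth 0%N ks)) // kiK iota_uniq.
  have ski : {subset ki <= iota 0 (size ks)} by move=> i /(allP kilt); rewrite mem_iota.
  apply: uniq_perm; [by [] | exact: iota_uniq |].
  by have [] := uniq_min_size uki ski; rewrite ?size_iota ?szki.
- by [].
- move=> i ilt; rewrite !(nth_map 0%N) //; apply: IH; first by rewrite -mk mem_nth.
  by apply: arity_ok_node wt _; rewrite -mk mem_nth.
- rewrite sel_dec_comp // kiK sel_dec_iota; last by case/and3P: wt.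
  congr Node; rewrite -[LHS](take_size ts) -[LHS](map_nth_iota0 (Leaf 0%N)) // -{1}kiK -map_comp.
  by apply/eq_in_map => i /(allP kilt) /= ilt; rewrite (nth_map 0%N).
Qed.

Section Canon.
Local Open Scope nat_scope.
Variable key : tree -> nat.
Hypothesis key_perm : forall t u, perm_eq (leaves t) (leaves u) -> key t = key u.
Hypothesis key_mem : forall t, 0 < size (leaves t) -> key t \in leaves t.

(** The key is a parameter because two orders occur: by minimal leaf, and by [minleaf_last], which
    puts the child with the blossom last. The hypotheses on the key say that it depends only on the
    multiset of leaves and is one of them. *)
Fixpoint canonize (t : tree) : tree :=
  match t with
  | Leaf l => Leaf l
  | Node d ts =>
      let us := map canonize ts in
      let ks := ordr (fun i => key (nt us i)) (size ts) in
      Node (sel_dec ks d) (map (nt us) ks)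
  end.

Fixpoint ksorted (t : tree) : bool :=
  if t is Node _ ts then sorted (relpre key ltn) ts && all ksorted ts else true.

Lemma canon_reorders t : canonize t \in reorders t.
Proof.
elim/tree_nind: t => [l|d ts IH]; first by rewrite inE.
apply/reorders_nodeP; exists (ordr (fun i => key (nt (map canonize ts) i)) (size ts)), (map canonize ts).
split=> //; [exact: perm_ordr | by rewrite size_map |].
by move=> i ilt; rewrite (nth_map (Leaf 0)) ?IH.
Qed.

(** The key of a child is one of its leaves, and siblings have no leaf in common. *)
Lemma key_inj d ts us i j : regular (Node d ts) ->
  (forall i, i < size ts -> perm_eq (leaves (nt us i)) (leaves (nt ts i))) ->
  i < size ts -> j < size ts -> key (nt us i) = key (nt us j) -> i = j.
Proof.
move=> rt us_ts ilt jlt; rewrite !(key_perm (us_ts _ _)) // => E.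
have uts : uniq (flatten (map leaves ts)) by case/andP: rt.
have km k : k < size ts -> key (nt ts k) \in nth [::] (map leaves ts) k.
  move=> klt; rewrite (nth_map (Leaf 0)) // key_mem // leaves_gt0 //.
  by case/andP: (regular_node rt klt).
by apply: (uniq_flatten_nth uts (km i ilt)); rewrite E; apply: km.
Qed.

Lemma canon_leaves t : perm_eq (leaves (canonize t)) (leaves t).
Proof. exact: leaves_reorders (canon_reorders t). Qed.

Lemma ksorted_canon t : regular t -> ksorted (canonize t).
Proof.
elim/tree_nind: t => // d ts IH rt /=; apply/andP; split.
  rewrite sorted_map; apply: sorted_ordr => i j ilt jlt.
  apply: (key_inj rt) => // k klt; rewrite (nth_map (Leaf 0)) //; exact: canon_leaves.
rewrite (perm_all _ (perm_map_nth _ _)); last by rewrite size_map perm_ordr.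
rewrite all_map; apply/allP => _ /(nthP (Leaf 0))[i ilt <-] /=.
by apply: IH => //; apply: regular_node rt _.
Qed.

(** Reordering preserves the keys of the children, and distinct keys can be sorted in only one
    way. *)
Lemma canon_in_reorders t0 t : regular t0 -> t \in reorders t0 -> canonize t = canonize t0.
Proof.
move=> r0 tO; move: t0 t tO r0; apply: reorders_ind => // d ts us ks pks sz usO IH rt.
have szk : size ks = size ts by rewrite (perm_size pks) size_iota.
have mk i : (i \in ks) = (i < size ts) by rewrite (perm_mem pks) mem_iota.
have E : map canonize (map (nt us) ks) = map (nt (map canonize ts)) ks.
  rewrite -map_comp; apply/eq_in_map => i; rewrite mk => ilt /=.
  by rewrite (nth_map (Leaf 0)) // IH //; apply: regular_node rt _.
rewrite /= E size_map szk.
set vs := map canonize ts; set k1 := ordr _ _; set k2 := ordr _ _.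
have pk1 : perm_eq k1 (iota 0 (size ts)) by apply: perm_ordr.
have k1lt : all (gtn (size ks)) k1.
  by apply/allP => i; rewrite (perm_mem pk1) mem_iota szk.
have vsl i : i < size ts -> perm_eq (leaves (nt vs i)) (leaves (nt ts i)).
  by move=> ilt; rewrite (nth_map (Leaf 0)) ?canon_leaves.
have inj := key_inj rt vsl.
(* Sorting the reordered children amounts, through [ks], to sorting the original ones, and the
   strictly sorted list is unique. *)
have k12 : map (nth 0 ks) k1 = k2.
  apply: (@sorted_key_eq _ (fun i => key (nt vs i))).
  - apply: (perm_trans (y := ks)); first by rewrite perm_map_nth // szk.
    by rewrite (permPl pks) perm_sym perm_ordr.
  - rewrite sorted_map.
    have -> : sorted (relpre (nth 0 ks) (relpre (fun i => key (nt vs i)) ltn)) k1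
            = sorted (relpre (fun i => key (nt (map (nt vs) ks) i)) ltn) k1.
      apply: (@eq_in_sorted _ (gtn (size ks))) => // i j /= ilt jlt.
      by rewrite !(nth_map 0).
    apply: sorted_ordr => i j ilt jlt; rewrite !(nth_map 0) ?szk // => H.
    apply/eqP; rewrite -(nth_uniq 0 (s := ks)) ?szk //; last first.
      by rewrite (perm_uniq pks) iota_uniq.
    by apply/eqP/inj => //; rewrite -mk mem_nth ?szk.
  - exact: sorted_ordr.
rewrite sel_dec_comp // k12; congr Node; rewrite -k12 -map_comp.
by apply/eq_in_map => i /(allP k1lt) /= ilt; rewrite (nth_map 0).
Qed.

Lemma canon_id t : regular t -> ksorted t -> canonize t = t.
Proof.
elim/tree_nind: t => // d ts IH rt /= /andP[st /allP sts].
have E : map canonize ts = ts.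
  rewrite -[RHS]map_id; apply/eq_in_map => _ /(nthP (Leaf 0))[i ilt <-].
  by apply: IH => //; [apply: regular_node rt _ | apply/sts/mem_nth].
rewrite E.
have -> : ordr (fun i => key (nt ts i)) (size ts) = iota 0 (size ts).
  apply: (@sorted_key_eq _ (fun i => key (nt ts i))); first exact: perm_ordr.
    by apply: sorted_ordr => i j ilt jlt; apply: (key_inj rt).
  by rewrite -(@sorted_map _ _ (nt ts) (relpre key ltn)) map_nth_iota0 // take_size.
rewrite sel_dec_iota; last by case/andP: rt => /and3P[].
by rewrite map_nth_iota0 // take_size.
Qed.

(** The key of a child survives its own reordering, so the keys reveal the permutation applied at
    the root, and then the reordered children themselves. *)
Lemma uniq_reorders t : regular t -> uniq (reorders t).
Proof.
elim/tree_nind: t => // d ts IH rt /=; apply: allpairs_uniq.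
- exact: permutations_uniq.
- apply: uniq_seqs_in; rewrite all_map; apply/allP => _ /(nthP (Leaf 0))[i ilt <-] /=.
  by apply: IH => //; apply: regular_node rt _.
move=> [k1 u1] [k2 u2] /allpairsP[[a b] /= [ma mb [-> ->]]] /allpairsP[[a' b'] /= [ma' mb' [-> ->]]].
move: ma mb ma' mb' => {k1 u1 k2 u2}; move: a b a' b' => k1 u1 k2 u2.
rewrite !mem_permutations !(mem_seqs_in (Leaf 0)) !size_map.
move=> pk1 /andP[/eqP su1 /allP O1] pk2 /andP[/eqP su2 /allP O2] [_ E].
have L1 i : i < size ts -> perm_eq (leaves (nt u1 i)) (leaves (nt ts i)).
  by move=> ilt; have := O1 i; rewrite mem_iota (nth_map (Leaf 0)) // => /(_ ilt)/leaves_reorders.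
have L2 i : i < size ts -> perm_eq (leaves (nt u2 i)) (leaves (nt ts i)).
  by move=> ilt; have := O2 i; rewrite mem_iota (nth_map (Leaf 0)) // => /(_ ilt)/leaves_reorders.
have sk1 : size k1 = size ts by rewrite (perm_size pk1) size_iota.
have sk2 : size k2 = size ts by rewrite (perm_size pk2) size_iota.
have Ei i : i < size ts -> nt u1 (nth 0 k1 i) = nt u2 (nth 0 k2 i).
  by move=> ilt; have := congr1 (fun s => nt s i) E; rewrite !(nth_map 0) ?sk1 ?sk2.
have k1lt i : i < size ts -> nth 0 k1 i < size ts.
  by move=> ilt; have := mem_nth 0 (s := k1); rewrite sk1 => /(_ i ilt); rewrite (perm_mem pk1) mem_iota.
have k2lt i : i < size ts -> nth 0 k2 i < size ts.
  by move=> ilt; have := mem_nth 0 (s := k2); rewrite sk2 => /(_ i ilt); rewrite (perm_mem pk2) mem_iota.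
have k12 : k1 = k2.
  apply: (eq_from_nth (x0 := 0)) => [|i]; rewrite sk1 ?sk2 // => ilt.
  apply: (key_inj rt (fun i' _ => perm_refl (leaves (nt ts i'))) (k1lt _ ilt) (k2lt _ ilt)).
  by rewrite -(key_perm (L1 _ (k1lt _ ilt))) -(key_perm (L2 _ (k2lt _ ilt))) Ei.
rewrite -k12 in Ei *; congr pair.
apply: (eq_from_nth (x0 := Leaf 0)) => [|j]; rewrite su1 ?su2 // => jlt.
have jk : j \in k1 by rewrite (perm_mem pk1) mem_iota.
by have := Ei (index j k1); rewrite nth_index // -sk1 index_mem => /(_ jk).
Qed.

End Canon.

(** The k! permutations at a node with k children cancel its factor 1/k!. *)
Lemma sum_reorders t : \sum_(u <- reorders t) weight u = 1.
Proof.
elim/tree_nind: t => [l|d ts IH]; first by rewrite big_seq1.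
rewrite /= big_allpairs_dep.
transitivity (\sum_(ks <- permutations (iota 0 (size ts))) (size ts)`!%:R^-1 : rat).
  rewrite !big_seq; apply: eq_bigr => ks; rewrite mem_permutations => pks.
  transitivity (\sum_(us <- seqs_in (map reorders ts)) (size ts)`!%:R^-1 * \prod_(u <- us) weight u).
    rewrite !big_seq; apply: eq_bigr => us; rewrite (mem_seqs_in (Leaf 0%N)) size_map.
    move=> /andP[/eqP sz _]; rewrite weightE size_map (perm_size pks) size_iota.
    by congr (_ * _); apply: perm_big; rewrite perm_map_nth ?sz.
  rewrite -mulr_sumr sum_seqs_in big_map (big_nth (Leaf 0%N)) big_nat big1 ?mulr1 //.
rewrite big_const_seq count_predT iter_addr_0 size_permutations ?iota_uniq // size_iota.
by rewrite -[LHS]mulr_natl mulfV // pnatr_eq0 -lt0n fact_gt0.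
Qed.

(* Each class of reorderings contains exactly one sorted tree and has total
   weight 1. The component in X (a marking) is not affected by reordering. *)
Lemma wsum_sorted (X : choiceType) (key : tree -> nat) (A : set (tree * X)) :
  (forall t u, perm_eq (leaves t) (leaves u) -> key t = key u) ->
  (forall t, (0 < size (leaves t))%N -> key t \in leaves t) ->
  finite_set A -> (forall p, A p -> regular p.1) ->
  (forall t u x, A (t, x) -> u \in reorders t -> A (u, x)) ->
  wsum A (fun p => weight p.1) =
  #|` fset_set [set p | A p /\ ksorted key p.1]%classic|%:R.
Proof.
move=> kp km finA Areg AO; rewrite -wsum1.
have finS : finite_set [set p | A p /\ ksorted key p.1]%classic.
  by apply: sub_finite_set finA => p [].
rewrite (@wsum_sigma _ _ _ (fset_set [set p | A p /\ ksorted key p.1]%classic)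
  (fun p => [set t | t \in reorders p.1]%classic) _ (fun p t => (t, p.2))).
- rewrite /wsum [in RHS]big_seq big_seq; apply: eq_bigr => -[t x] /mem_fset_set [/= Atx _].
  by rewrite -[RHS](sum_reorders t); apply: wsum_seq => //; apply: (uniq_reorders kp km (Areg _ Atx)).
- exact: fset_uniq.
- by move=> p _; apply: finite_seq.
- move=> [t x]; split=> [Atx|[p [u [/mem_fset_set[Ap _] uO [-> ->]]]]].
    exists (canonize key t, x), t; split=> //.
      apply: mem_fset_setT => //; split=> /=; first exact: AO Atx (canon_reorders _ _).
      exact: (ksorted_canon kp km (Areg _ Atx)).
    apply: reorders_sym; first by case/andP: (Areg _ Atx).
    exact: canon_reorders.
  by apply: AO uO; case: p Ap.
- move=> [t x] [t' x'] u u' /mem_fset_set[/= At st] /mem_fset_set[/= At' st'] uO uO' [E <-].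
  have Ht : canonize key t = t := canon_id kp km (Areg _ At) st.
  have Ht' : canonize key t' = t' := canon_id kp km (Areg _ At') st'.
  have Eu : canonize key u = canonize key t := canon_in_reorders kp km (Areg _ At) uO.
  have Eu' : canonize key u' = canonize key t' := canon_in_reorders kp km (Areg _ At') uO'.
  by rewrite -Ht -Ht' -Eu -Eu' E.
Qed.

Lemma foldr_minnP a (s : seq nat) :
  foldr minn a s \in a :: s /\ (forall x, x \in a :: s -> (foldr minn a s <= x)%N).
Proof.
elim: s => [|b s [IH1 IH2]] /=; first by split=> [|x]; rewrite inE // => /eqP->.
split=> [|x].
  by rewrite /minn; case: ifP => _; move: IH1; rewrite !inE ?eqxx ?orbT // => /orP[]->; rewrite ?orbT.
rewrite !inE orbCA geq_min => /orP[/eqP->|xs]; first by rewrite leqnn.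
by rewrite (IH2 x) ?orbT // inE.
Qed.

Lemma mem_minleaf t : (0 < size (leaves t))%N -> minleaf t \in leaves t.
Proof.
rewrite /minleaf; case: (leaves t) => // a s _.
by have [+ _] := foldr_minnP a (a :: s); rewrite inE => /orP[/eqP->|//]; rewrite mem_head.
Qed.

Lemma minleaf_le t l : l \in leaves t -> (minleaf t <= l)%N.
Proof.
rewrite /minleaf; case: (leaves t) => // a s ls.
by have [_ ->] := foldr_minnP a (a :: s); rewrite // inE ls orbT.
Qed.

Lemma perm_minleaf t u : perm_eq (leaves t) (leaves u) -> minleaf t = minleaf u.
Proof.
move=> tu; have [t0|t0] := posnP (size (leaves t)).
  have := perm_size tu; rewrite t0 => /esym/size0nil u0; move/size0nil: t0 => t0.
  by rewrite /minleaf t0 u0.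
have u0 : (0 < size (leaves u))%N by rewrite -(perm_size tu).
apply/eqP; rewrite eqn_leq !minleaf_le //; first by rewrite -(perm_mem tu) mem_minleaf.
by rewrite (perm_mem tu) mem_minleaf.
Qed.

HB.instance Definition _ := gen_eqMixin dec.
HB.instance Definition _ := gen_choiceMixin dec.

Lemma finite_inj (X Y : choiceType) (A : set X) (B : set Y) (f : X -> Y) :
  finite_set B -> (forall x, A x -> B (f x)) ->
  (forall x x', A x -> A x' -> f x = f x' -> x = x') -> finite_set A.
Proof.
move=> finB AB inj.
pose h y : option X := if pselect (exists x, A x /\ f x = y) is left e
  then Some (projT1 (cid e)) else None.
apply: (@finite_set_in_seq _ (pmap h (fset_set B))) => x Ax.
rewrite mem_pmap; apply/mapP; exists (f x); first exact: mem_fset_setT (AB _ Ax).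
rewrite /h; case: pselect => [e|[]]; last by exists x.
by case: cid => x' [Ax' E] /=; congr Some; apply: inj.
Qed.

(* None is the type of leaves and of non-linear nodes. *)
Definition no_clash (x y : option bool) : bool := (x == None) || (x != y).

Lemma nclC x y : no_clash x y = no_clash y x.
Proof. by case: x y => [[]|] [[]|]. Qed.

(** * Relabeling the leaves *)

Fixpoint map_leaves (f : nat -> nat) (t : tree) : tree :=
  match t with
  | Leaf l => Leaf (f l)
  | Node d ts => Node d (map (map_leaves f) ts)
  end.

Lemma leaves_map_leaves f t : leaves (map_leaves f t) = map f (leaves t).
Proof.
elim/tree_nind: t => // d ts IH /=; rewrite map_flatten -!map_comp; congr flatten.
by apply/eq_in_map => _ /(nthP (Leaf 0%N))[i ilt <-] /=; apply: IH.
Qed.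

Lemma nleaves_map_leaves f t : nleaves (map_leaves f t) = nleaves t.
Proof. by rewrite /nleaves leaves_map_leaves size_map. Qed.

Lemma root_type_map_leaves f t : root_type (map_leaves f t) = root_type t.
Proof. by case: t. Qed.

Lemma weight_map_leaves f t : weight (map_leaves f t) = weight t.
Proof.
elim/tree_nind: t => // d ts IH; rewrite [map_leaves _ _]/= !weightE size_map big_map.
congr (_ * _); rewrite !(big_nth (Leaf 0%N)) !big_nat; apply: eq_bigr => i /andP[_].
exact: IH.
Qed.

Lemma arity_ok_map_leaves f t : arity_ok (map_leaves f t) = arity_ok t.
Proof.
elim/tree_nind: t => // d ts IH /=; rewrite size_map all_map; congr [&& _, _ & _].
by apply: eq_in_all => _ /(nthP (Leaf 0%N))[i ilt <-] /=; apply: IH.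
Qed.

Lemma map_leaves_comp f g t : map_leaves f (map_leaves g t) = map_leaves (f \o g) t.
Proof.
elim/tree_nind: t => // d ts IH /=; rewrite -map_comp; congr Node.
by apply/eq_in_map => _ /(nthP (Leaf 0%N))[i ilt <-] /=; apply: IH.
Qed.

Lemma mem_leaves_nth d ts i l : (i < size ts)%N -> l \in leaves (nt ts i) ->
  l \in leaves (Node d ts).
Proof.
by move=> ilt lt /=; apply/flatten_mapP; exists (nt ts i) => //; apply: mem_nth.
Qed.

Lemma eq_map_leaves f g t : {in leaves t, f =1 g} -> map_leaves f t = map_leaves g t.
Proof.
elim/tree_nind: t => [l|d ts IH] fg /=; first by rewrite fg // mem_head.
congr Node; apply/eq_in_map => _ /(nthP (Leaf 0%N))[i ilt <-].
by apply: IH => // l lt; apply: fg; apply: mem_leaves_nth lt.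
Qed.

Lemma map_leaves_id t : map_leaves id t = t.
Proof.
elim/tree_nind: t => // d ts IH /=; congr Node; rewrite -[RHS]map_id.
by apply/eq_in_map => _ /(nthP (Leaf 0%N))[i ilt <-]; apply: IH.
Qed.

Lemma reorders_map_leaves f t0 t : t \in reorders t0 -> map_leaves f t \in reorders (map_leaves f t0).
Proof.
move: t0 t; apply: reorders_ind => [l|d ts us ks pks sz _ IH]; first by rewrite inE.
apply/reorders_nodeP; exists ks, (map (map_leaves f) us); rewrite !size_map sz; split=> //.
  by move=> i ilt; rewrite !(nth_map (Leaf 0%N)) ?sz // IH.
rewrite /= -map_comp; congr Node; apply/eq_in_map => i.
by rewrite (perm_mem pks) mem_iota /= => ilt; rewrite (nth_map (Leaf 0%N)) ?sz.
Qed.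

(** The inverse of reading the leaves from left to right: a plane tree is recovered from any
    relabeling of it together with its list of leaves. *)
Fixpoint relab (t : tree) (ls : seq nat) : tree :=
  match t with
  | Leaf _ => Leaf (head 0%N ls)
  | Node d ts => Node d [seq p.1 p.2 | p <- zip (map relab ts) (reshape (map nleaves ts) ls)]
  end.

Lemma nleaves_node d ts : nleaves (Node d ts) = sumn (map nleaves ts).
Proof. by rewrite /nleaves /= size_flatten /shape -map_comp. Qed.

(** The four facts share one induction, since each of them splits the list of labels in the same
    way: the first [nleaves t] labels go to the first child. *)
Lemma relabP t : (forall ls, size ls = nleaves t -> leaves (relab t ls) = ls) /\
  (forall f ls, size ls = nleaves t -> map_leaves f (relab t ls) = relab t (map f ls)) /\
  relab t (leaves t) = t /\ (forall f ls, relab (map_leaves f t) ls = relab t ls).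
Proof.
elim/tree_nind: t => [l|d ts IH].
  by split=> [[|a []] //|]; split=> // f [|a []].
elim: ts IH => [|t ts IHts] IH.
  by split=> [[|a ls]|]//; split=> // f [].
have [L1 [L2 [L3 L4]]] := IH 0%N isT.
have {IHts IH}[T1 [T2 [T3 T4]]] := IHts (fun i => IH i.+1).
have nE : nleaves (Node d (t :: ts)) = (nleaves t + nleaves (Node d ts))%N.
  by rewrite !nleaves_node.
rewrite nE.
have szd (T : Type) (ls : seq T) : size ls = (nleaves t + nleaves (Node d ts))%N ->
    size (drop (nleaves t) ls) = nleaves (Node d ts) by rewrite size_drop => ->; rewrite addKn.
have szt (T : Type) (ls : seq T) : size ls = (nleaves t + nleaves (Node d ts))%N ->
    size (take (nleaves t) ls) = nleaves t by move=> E; rewrite size_takel // E leq_addr.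
split; [|split; [|split]].
- move=> ls sz; have {T1} := T1 _ (szd _ _ sz); have {L1} := L1 _ (szt _ _ sz).
  by rewrite /= => -> ->; rewrite cat_take_drop.
- move=> f ls sz; have {T2} := T2 f _ (szd _ _ sz); have {L2} := L2 f _ (szt _ _ sz).
  by rewrite /= -map_drop -map_take => -> [->].
- move: T3; rewrite /= drop_size_cat // take_size_cat // => -[->].
  by rewrite L3.
- move=> f ls; have := T4 f (drop (nleaves t) ls).
  by rewrite /= !nleaves_map_leaves => -[->]; rewrite L4.
Qed.

Lemma leaves_relab t ls : size ls = nleaves t -> leaves (relab t ls) = ls.
Proof. by have [H _] := relabP t; apply: H. Qed.

Lemma map_leaves_relab t f ls : size ls = nleaves t -> map_leaves f (relab t ls) = relab t (map f ls).
Proof. by have [_ [H _]] := relabP t; apply: H. Qed.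

Lemma relab_leaves t : relab t (leaves t) = t.
Proof. by have [_ [_ [H _]]] := relabP t. Qed.

Lemma relab_map_leaves t f ls : relab (map_leaves f t) ls = relab t ls.
Proof. by have [_ [_ [_ H]]] := relabP t; apply: H. Qed.

(** * Trees with decorations in P, regardless of labels and orders *)

Section Good.
Variable P : forall n, {set lgraph n}.

Definition dgood k d := if d is Gr n H then (n == k) && (H \in P n) else true.

(** What remains of membership in [P_trees] after dropping the order of children and the labeling.
    It is stable under relabeling of leaves and reordering, and [P_treesP] adds the two dropped
    conditions back. *)
Fixpoint good (t : tree) : bool :=
  if t is Node d ts then
    [&& (1 < size ts)%N, dgood (size ts) d, all (fun u => no_clash (dec_type d) (root_type u)) ts
      & all good ts]
  else true.

Lemma good_node d ts : good (Node d ts) <->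
  [/\ (1 < size ts)%N, dgood (size ts) d &
   forall i, (i < size ts)%N -> no_clash (dec_type d) (root_type (nt ts i)) /\ good (nt ts i)].
Proof.
split=> [/and4P[sz dg /allP nts /allP gts]|[sz dg H]]; last first.
  apply/and4P; split=> //; apply/allP => _ /(nthP (Leaf 0%N))[i ilt <-];
  by case: (H i ilt).
by split=> // i ilt; split; [apply/nts/mem_nth | apply/gts/mem_nth].
Qed.

Lemma dgood_ok k d : dgood k d -> dec_ok k d.
Proof. by case: d => // n H /andP[]. Qed.

Lemma good_arity_ok t : good t -> arity_ok t.
Proof.
elim/tree_nind: t => // d ts IH /good_node[sz /dgood_ok dg H] /=.
rewrite sz dg /=; apply/allP => _ /(nthP (Leaf 0%N))[i ilt <-].
by apply: IH => //; case: (H i ilt).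
Qed.

Lemma good_map_leaves f t : good (map_leaves f t) = good t.
Proof.
elim/tree_nind: t => // d ts IH /=; rewrite size_map !all_map; congr [&& _, _, _ & _].
  by apply: eq_all => u /=; rewrite root_type_map_leaves.
by apply: eq_in_all => _ /(nthP (Leaf 0%N))[i ilt <-] /=; apply: IH.
Qed.

Lemma size_good d ts : good (Node d ts) -> (size ts <= nleaves (Node d ts))%N.
Proof.
move=> /good_arity_ok /and3P[_ _]; rewrite nleaves_node.
elim: ts => //= t ts IH /andP[/leaves_gt0 wt /IH]; rewrite /nleaves in wt *; lia.
Qed.

Lemma nleaves_child d ts i : good (Node d ts) -> (i < size ts)%N ->
  (nleaves (nt ts i) < nleaves (Node d ts))%N.
Proof.
move=> gt; have /and3P[+ _ /allP wts] := good_arity_ok gt; rewrite nleaves_node.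
have {gt wts} : forall t, t \in ts -> (0 < nleaves t)%N by move=> t /wts/leaves_gt0.
case: ts i => [|t [|u ts]] // i pos _ ilt.
have := pos t; have := pos u; rewrite !inE !eqxx orbT => /(_ isT) pu /(_ isT) pt.
have H vs j : (nleaves (nt vs j) <= sumn (map nleaves vs) + (size vs <= j)%N)%N.
  elim: vs j => [|v vs IH] [|j] //=; rewrite ?nth_nil //; last first.
    by have := IH j; lia.
  lia.
case: i ilt => [|[|i]] /= ilt; [lia | lia |].
have E : (size ts <= i)%N = false by apply/negbTE; rewrite -ltnNge.
by have := H ts i; rewrite E; lia.
Qed.

(** A tree with n + 1 leaves has at most n + 1 children, each with at most n leaves, and finitely
    many decorations. The bound K makes the labels finite in number, be they labels from 1 to n or
    marks. *)
Lemma good_bounded K n : exists L : seq tree, forall t, good t ->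
  all (leq^~ K) (leaves t) -> (nleaves t <= n)%N -> t \in L.
Proof.
elim: n => [|n [L IH]].
  by exists [::] => t /good_arity_ok/leaves_gt0; rewrite /nleaves; case: leaves.
pose D := [:: Lin true; Lin false] ++
  flatten [seq [seq Gr H | H <- enum (P k)] | k <- iota 0 n.+2].
exists ([seq Leaf l | l <- iota 0 K.+1] ++
  [seq Node d ts | d <- D, ts <- flatten [seq seqs_in (nseq k L) | k <- iota 0 n.+2]]).
move=> [l|d ts] gt lt nt1; rewrite mem_cat; apply/orP; [left|right].
  by apply/mapP; exists l => //; rewrite mem_iota; move: lt => /= /andP[]; lia.
have szn := leq_trans (size_good gt) nt1.
apply/allpairsP; exists (d, ts); split; [rewrite [(_, _).1]/=|rewrite [(_, _).2]/=|by []].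
  have /good_node[_ dg _] := gt.
  have : (if d is Gr n' H then d \in flatten [seq [seq Gr H | H <- enum (P k)] | k <- iota 0 n.+2]
      else d \in [:: Lin true; Lin false]).
    case: d dg {gt lt nt1} => [[]|k H /andP[/eqP kE HP]]; rewrite ?inE ?eqxx ?orbT //.
    apply/flatten_mapP; exists k; first by rewrite mem_iota kE.
    by apply: map_f; rewrite mem_enum.
  by case: d {dg gt lt nt1} => [b|k H] dD; rewrite /D mem_cat dD ?orbT.
apply/flatten_mapP; exists (size ts); first by rewrite mem_iota.
rewrite (mem_seqs_in (Leaf 0%N)) size_nseq eqxx; apply/allP => i; rewrite mem_iota /= => ilt.
rewrite nth_nseq ilt; apply: IH.
- by case/good_node: gt => _ _ /(_ i ilt)[].
- by apply/allP => l li; apply: (allP lt); apply: mem_leaves_nth li.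
- by rewrite -ltnS (leq_trans (nleaves_child gt ilt)).
Qed.

Lemma locfin_good K (C : set tree) :
  (forall t, C t -> good t /\ all (leq^~ K) (leaves t)) -> locfin nleaves C.
Proof.
move=> CE n; have [L LP] := good_bounded K n.
by apply: (@finite_set_in_seq _ L) => t [/CE[gt lt] tn]; apply: LP; rewrite // tn.
Qed.

Hypothesis P_stable : forall (n : nat) (s : 'S_n) (H : lgraph n),
  H \in P n -> relabel s H \in P n.
Hypothesis P_prime : forall (n : nat) (H : lgraph n), H \in P n -> prime_graph H.

Lemma Gr_mem n m (H : lgraph n) (K : lgraph m) : Gr H = Gr K -> (H \in P n) = (K \in P m).
Proof. exact: (f_equal (fun d => if d is Gr n H then H \in P n else true)). Qed.

(** Listing all vertices in the order [ks] is relabeling by a permutation; this is where the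
    stability of P enters. *)
Lemma dgood_sel k ks d : perm_eq ks (iota 0 k) -> dgood k d -> dgood (size ks) (sel_dec ks d).
Proof.
case: d => // n H pks /= /andP[/eqP nk HP]; rewrite eqxx /=; subst k.
have szk : size ks = n by rewrite (perm_size pks) size_iota.
have ltk (i : 'I_n) : (nth 0%N ks i < n)%N.
  by have := mem_nth 0%N (s := ks) (n := i); rewrite szk (perm_mem pks) mem_iota => /(_ (ltn_ord i)).
have injk : injective (fun i : 'I_n => Ordinal (ltk i)).
  move=> i j /(congr1 val) /= /eqP; rewrite nth_uniq ?szk ?(perm_uniq pks) ?iota_uniq //.
  by move=> /eqP /val_inj.
have GE : Gr (induced_graph H ks) = Gr (relabel (perm injk) H).
  apply: Gr_ext => // a b ak bk; rewrite adjn_induced ak bk /=.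
  rewrite szk in ak bk.
  rewrite -[a in RHS]/(val (Ordinal ak)) -[b in RHS]/(val (Ordinal bk)) adjnE adj_graph_of.
  rewrite !permE -!adjnE /= [adjn H _ _ in X in _ || X]adjn_sym orbb.
  case: eqP => //= -[->]; exact: adjn_irr.
by rewrite (Gr_mem GE) P_stable.
Qed.

Lemma good_reorders t0 t : t \in reorders t0 -> good t0 -> good t.
Proof.
move: t0 t; apply: reorders_ind => // d ts us ks pks sz usO IH /good_node[sz2 dg H].
have szk : size ks = size ts by rewrite (perm_size pks) size_iota.
apply/good_node; rewrite size_map; split; [by rewrite szk | exact: dgood_sel pks dg |].
move=> i ilt; rewrite dec_type_sel (nth_map 0%N) //.
have jlt : (nth 0%N ks i < size ts)%N by have := mem_nth 0%N ilt; rewrite (perm_mem pks) mem_iota.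
have [nc gi] := H _ jlt.
by rewrite (root_type_reorders (usO _ jlt)); split=> //; apply: IH.
Qed.


Lemma good_canonicalP t :
  [/\ wf_nodes t, md_nodes t & decs_in P t] <-> good t && ksorted minleaf t.
Proof.
elim/tree_nind: t => // d ts IH.
have sE : sorted (relpre minleaf ltn) ts = sorted (fun u v => (minleaf u < minleaf v)%N) ts by [].
have mdE : foldr (fun u => and (md_nodes u)) True ts <->
    forall i, (i < size ts)%N -> md_nodes (nt ts i).
  elim: ts {IH sE} => [|t ts IHts] //=; split=> [[mt /IHts H] [|i] //|H]; first exact: H.
  by split; [apply: (H 0%N) | apply/IHts => i; apply: (H i.+1)].
split=> [[/= /and4P[sz ar st /allP wts] [dm /mdE mts] /andP[dP /allP pts]]|].
  have H i : (i < size ts)%N -> good (nt ts i) && ksorted minleaf (nt ts i).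
    by move=> ilt; apply/IH => //; split; [apply/wts/mem_nth | apply: mts | apply/pts/mem_nth].
  apply/andP; split; last first.
    by rewrite sE st; apply/allP => _ /(nthP (Leaf 0%N))[i ilt <-]; case/andP: (H i ilt).
  apply/good_node; split=> //; first by case: d ar dP dm => //= n K /andP[_ ->] ->.
  move=> i ilt; split; last by case/andP: (H i ilt).
  case: d dm {ar dP} => // b /allP/(_ _ (mem_nth (Leaf 0%N) ilt)).
  by case: (nt ts i) => // -[c|] //=; case: b c => [] [].
case/andP=> /good_node[sz dg H] /andP[st /allP sts].
have {}IH i : (i < size ts)%N -> [/\ wf_nodes (nt ts i), md_nodes (nt ts i) & decs_in P (nt ts i)].
  by move=> ilt; apply/IH => //; case: (H i ilt) => _ ->; apply/sts/mem_nth.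
split.
- rewrite /= sz st /=; apply/andP; split.
    (* Primality provides the bound 2 < n required by [dec_arity]. *)
    case: d dg {H} => //= n K /andP[-> /P_prime[n2 _]]; rewrite andbT //.
  by apply/allP => _ /(nthP (Leaf 0%N))[i ilt <-]; case: (IH i ilt).
- split; last by apply/mdE => i ilt; case: (IH i ilt).
  case: d dg H => [b _ H|n K /andP[_ /P_prime]//].
  apply/allP => _ /(nthP (Leaf 0%N))[i ilt <-]; have [+ _] := H i ilt.
  by case: (nt ts i) => // -[c|] //=; case: b c => [] [].
- rewrite /=; apply/andP; split; first by case: d dg {H} => // n K /andP[].
  by apply/allP => _ /(nthP (Leaf 0%N))[i ilt <-]; case: (IH i ilt).
Qed.

Lemma P_treesP t : P_trees P t <->
  [/\ good t, ksorted minleaf t & perm_eq (leaves t) (iota 1 (nleaves t))].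
Proof.
split=> [[[/andP[wt pt] mt] dt]|[gt st pt]].
  by have /andP[] : good t && ksorted minleaf t by apply/good_canonicalP.
have /good_canonicalP[wt mt dt] : good t && ksorted minleaf t by rewrite gt.
by split=> //; split=> //; apply/andP.
Qed.

Lemma perm_iota_regular t n : good t -> perm_eq (leaves t) (iota 1 n) -> regular t.
Proof. by move=> gt pt; rewrite /regular (good_arity_ok gt) (perm_uniq pt) iota_uniq. Qed.

(** * Erasing labels *)

Section Erase.
Variables (X : choiceType) (mk : X -> nat -> nat) (valid : seq nat -> X -> Prop).
Variables (Q : set tree) (K : nat).
Hypothesis QK : forall s, Q s -> all (leq^~ K) (leaves s).
Hypothesis mk_ex : forall n s ls, Q s -> nleaves s = n -> perm_eq ls (iota 1 n) ->
  exists2 x, valid ls x & map (mk x) ls = leaves s.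
Hypothesis mk_uniq : forall n ls x x', perm_eq ls (iota 1 n) -> valid ls x -> valid ls x' ->
  map (mk x) ls = map (mk x') ls -> x = x'.

(** An element x of X is a structure put on a labeled tree (nothing, a distinguished leaf, or a
    marking), and [mk x l] is the mark it gives to the leaf l. By [mk_ex] and [mk_uniq], once the
    leaves are labeled, x amounts to a choice of marks on them. *)
Definition plane_cls n : set (tree * X) :=
  [set p | [/\ good p.1, perm_eq (leaves p.1) (iota 1 n), valid (leaves p.1) p.2
           & Q (map_leaves (mk p.2) p.1)]]%classic.

Definition shape_cls : set tree := [set s | good s /\ Q s]%classic.

Lemma locfin_shape_cls : locfin nleaves shape_cls.
Proof. by apply: (@locfin_good K) => t [gt /QK]. Qed.

Let B n := [set q : tree * seq nat | (shape_cls q.1 /\ nleaves q.1 = n)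
  /\ perm_eq q.2 (iota 1 n)]%classic.
Let g (p : tree * X) := (map_leaves (mk p.2) p.1, leaves p.1).

Let g_inj n p p' : plane_cls n p -> plane_cls n p' -> g p = g p' -> p = p'.
Proof.
case: p p' => [t x] [t' x'] [/= _ pt vx Qt] [/= _ pt' vx' Qt'] [E El].
(* The shape together with the list of labels determines the labeled tree, by [relab]. *)
have tt' : t = t' by rewrite -(relab_leaves t) -(relab_map_leaves t (mk x)) E El relab_map_leaves relab_leaves.
subst t'; congr pair; apply: (mk_uniq pt) => //.
by rewrite -!leaves_map_leaves E.
Qed.

Let finB n : finite_set (B n).
Proof.
apply: (@sub_finite_set _ _ ([set s | shape_cls s /\ nleaves s = n] `*`
  [set` permutations (iota 1 n)])%classic).
  by move=> [s ls] [H /= pls]; split=> //=; rewrite mem_permutations.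
by apply: finite_setX; [exact: locfin_shape_cls | exact: finite_seq].
Qed.

Let g_B n p : plane_cls n p -> B n (g p).
Proof.
case: p => t x [/= gt pt vx Qt]; split=> //=; split; first by split; rewrite ?good_map_leaves.
by rewrite nleaves_map_leaves /nleaves (perm_size pt) size_iota.
Qed.

Lemma finite_plane_cls n : finite_set (plane_cls n).
Proof. exact: finite_inj (finB n) (@g_B n) (@g_inj n). Qed.

(** Every list of the labels from 1 to n can be written on the leaves of every shape with n leaves,
    without changing the weight. *)
Lemma wsum_plane_cls n : wsum (plane_cls n) (fun p => weight p.1) =
  n`!%:R * coefs (gf weight nleaves shape_cls) n.
Proof.
transitivity (wsum (B n) (fun q => weight q.1)).
  rewrite (@wsum_bij _ _ (plane_cls n) _ g) //.
  - by apply: eq_wsum => -[t x] _ /=; rewrite weight_map_leaves.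
  - exact: finite_plane_cls.
  - move=> [s ls]; split=> [[/= [[gs Qs] sn] pls]|[p pp ->]]; last exact: g_B.
    have [x vx El] := mk_ex Qs sn pls.
    have szl : size ls = nleaves s by rewrite (perm_size pls) size_iota.
    have tE : map_leaves (mk x) (relab s ls) = s by rewrite map_leaves_relab // El relab_leaves.
    exists (relab s ls, x); last by rewrite /g /= leaves_relab // tE.
    by split=> /=; rewrite ?leaves_relab ?tE // -(good_map_leaves (mk x)) tE.
  - exact: g_inj.
rewrite (@wsum_prod _ _ [set s | shape_cls s /\ nleaves s = n]%classic
  [set` permutations (iota 1 n)]%classic).
- rewrite [coefs _ _]/= /wsum mulr_sumr; apply: eq_bigr => s _ /=.
  rewrite (perm_big (permutations (iota 1 n))); last first.
    apply: uniq_perm; [exact: fset_uniq | exact: permutations_uniq |].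
    by move=> ls; rewrite in_fset_setE; [apply/asboolP/idP | exact: finite_seq].
  rewrite big_const_seq count_predT iter_addr_0 size_permutations ?iota_uniq // size_iota.
  by rewrite mulr_natl.
- exact: locfin_shape_cls.
- exact: finite_seq.
- by move=> [s ls]; split=> -[] H /=; rewrite mem_permutations.
Qed.

Hypothesis Q_reorders : forall s s', s' \in reorders s -> good s -> Q s -> Q s'.
Hypothesis valid_perm : forall ls ls' x, perm_eq ls' ls -> valid ls x -> valid ls' x.

(** Among plane trees, those sorted by [minleaf] are exactly the trees of [P_trees]; as they
    represent reordering classes of weight 1, the weighted sum is a cardinality. *)
Lemma card_canonical n :
  #|` fset_set [set p : tree * X | [/\ P_trees P p.1, nleaves p.1 = n, valid (leaves p.1) p.2
           & Q (map_leaves (mk p.2) p.1)]]%classic|%:R =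
  n`!%:R * coefs (gf weight nleaves shape_cls) n.
Proof.
rewrite -wsum_plane_cls (@wsum_sorted _ minleaf) //.
- congr (#|` fset_set _|%:R); apply/seteqP; split=> -[t x] /=.
    by move=> [/P_treesP[gt st pt] tn vx Qt]; split=> //; split=> //=; rewrite -tn.
  move=> [[/= gt pt vx Qt] st].
  have tn : nleaves t = n by rewrite /nleaves (perm_size pt) size_iota.
  by split=> //; apply/P_treesP; rewrite tn.
- exact: perm_minleaf.
- exact: mem_minleaf.
- exact: finite_plane_cls.
- by move=> [t x] [/= gt pt _ _]; apply: perm_iota_regular pt.
- move=> t u x [/= gt pt vx Qt] uO; have pu := leaves_reorders uO; split=> /=.
  + exact: good_reorders uO gt.
  + exact: perm_trans pt.
  + exact: valid_perm vx.
  + by apply: Q_reorders (reorders_map_leaves _ uO) _ Qt; rewrite good_map_leaves.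
Qed.

Lemma egf_erase : egf [set p : tree * X | [/\ P_trees P p.1, valid (leaves p.1) p.2
    & Q (map_leaves (mk p.2) p.1)]]%classic (fun p => nleaves p.1) = gf weight nleaves shape_cls.
Proof.
apply: fps_eqP => n; rewrite -[RHS](mulKf (x := n`!%:R)) ?pnatr_eq0 -?lt0n ?fact_gt0 //.
rewrite -card_canonical mulrC; congr (_ / _); congr (#|` fset_set _|%:R).
by apply/seteqP; split=> -[t x] /= => [[[? ? ?] ?]|[]].
Qed.

End Erase.

End Good.

(** * Unmarked trees and trees with a single mark *)

(* In a tree without labels, a leaf carries 0 if it is unmarked. *)
Definition marks (t : tree) : seq nat := filter (predC1 0%N) (leaves t).

Definition unmarked (t : tree) : bool := marks t == [::].

(** The word on which all conditions on root and blossom depend: its first letter is the type of the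
    root, its last one the type of the parent of the leaf l. *)
Fixpoint path_types (l : nat) (t : tree) : seq (option bool) :=
  if t is Node d ts then
    dec_type d :: nth [::] (map (path_types l) ts) (find (fun u => l \in leaves u) ts)
  else [::].

Lemma root_type_path_types l t : root_type t = head None (path_types l t).
Proof. by case: t. Qed.

Lemma path_types_map_leaves f l t : (forall x, x \in leaves t -> f x = f l -> x = l) ->
  path_types (f l) (map_leaves f t) = path_types l t.
Proof.
elim/tree_nind: t => // d ts IH fl /=; congr cons.
have fli i : (i < size ts)%N -> forall x, x \in leaves (nt ts i) -> f x = f l -> x = l.
  by move=> ilt x xl; apply: fl; apply: mem_leaves_nth xl.
rewrite find_map -map_comp.
have -> : find (preim (map_leaves f) (fun u => f l \in leaves u)) ts = find (fun u => l \in leaves u) ts.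
  apply: eq_in_find => _ /(nthP (Leaf 0%N))[i ilt <-] /=; rewrite leaves_map_leaves.
  by apply/mapP/idP => [[x xl /esym/(fli i ilt x xl) <-]|ll]; last exists l.
set k := find _ _; have [klt|klt] := ltnP k (size ts).
  by rewrite !(nth_map (Leaf 0%N)) //= IH //; apply: fli.
by rewrite !nth_default ?size_map.
Qed.

Lemma find_child l ts i : (i < size ts)%N -> l \in leaves (nt ts i) ->
  (forall j, (j < size ts)%N -> l \in leaves (nt ts j) -> j = i) ->
  find (fun u => l \in leaves u) ts = i.
Proof.
move=> ilt li lu; have hl : has (fun u => l \in leaves u) ts.
  by apply/hasP; exists (nt ts i); first exact: mem_nth.
by apply: lu; [rewrite -has_find | exact: (nth_find (Leaf 0%N) hl)].
Qed.

Lemma path_types_node l d ts i : (i < size ts)%N -> l \in leaves (nt ts i) ->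
  (forall j, (j < size ts)%N -> l \in leaves (nt ts j) -> j = i) ->
  path_types l (Node d ts) = dec_type d :: path_types l (nt ts i).
Proof. by move=> ilt li lu; rewrite /= (find_child ilt li lu) (nth_map (Leaf 0%N)). Qed.

Definition once l t := count_mem l (leaves t) == 1%N.

Lemma onceP l d ts : once l (Node d ts) -> exists i, [/\ (i < size ts)%N, once l (nt ts i)
  & forall j, (j < size ts)%N -> l \in leaves (nt ts j) -> j = i].
Proof.
rewrite /once /=; elim: ts => //= t ts IH; rewrite count_cat.
case E: (count_mem l (leaves t)) => [|[|m]] /=; last by rewrite addSn.
- rewrite add0n => /IH[i [ilt oi iu]]; exists i.+1; split=> // -[|j] //= jlt.
    by rewrite -has_pred1 has_count E.
  by move=> /(iu _ jlt) ->.
- rewrite add1n eqSS => /eqP E0; exists 0%N; split=> //=; first by rewrite E.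
  move=> [|j] //= jlt lj; have : l \in flatten (map leaves ts).
    by apply/flatten_mapP; exists (nt ts j) => //; apply: mem_nth.
  by rewrite -has_pred1 has_count E0.
Qed.

Lemma once_mem l t : once l t -> l \in leaves t.
Proof. by rewrite -has_pred1 has_count => /eqP->. Qed.

Lemma once_uniq l t : uniq (leaves t) -> l \in leaves t -> once l t.
Proof. by move=> ut lt; rewrite /once count_uniq_mem // lt. Qed.

(** With a second occurrence of l, the branch chosen by [find] would depend on the order of the
    children. *)
Lemma path_types_reorders l t0 t : t \in reorders t0 -> once l t0 -> path_types l t = path_types l t0.
Proof.
move: t0 t; apply: reorders_ind => // d ts us ks pks sz usO IH ol.
have [i [ilt oi iu]] := onceP ol.
have mk j : (j \in ks) = (j < size ts)%N by rewrite (perm_mem pks) mem_iota.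
have ik : i \in ks by rewrite mk.
have nk j : (j < size ks)%N -> (nth 0%N ks j < size ts)%N by move=> jlt; rewrite -mk mem_nth.
have ixlt : (index i ks < size ks)%N by rewrite index_mem.
have mu j : (j < size ts)%N -> (l \in leaves (nt us j)) = (l \in leaves (nt ts j)).
  by move=> jlt; rewrite (perm_mem (leaves_reorders (usO j jlt))).
rewrite (@path_types_node l d ts i) //; last exact: once_mem.
rewrite (@path_types_node _ _ _ (index i ks)) ?size_map //.
- by rewrite dec_type_sel (nth_map 0%N) // nth_index // IH.
- by rewrite (nth_map 0%N) // nth_index // mu // once_mem.
- move=> j jlt; rewrite (nth_map 0%N) // mu ?nk // => lj.
  rewrite -(iu _ (nk _ jlt) lj) index_uniq // (perm_uniq pks) iota_uniq //.
Qed.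

Lemma marks_reorders t0 t : t \in reorders t0 -> perm_eq (marks t) (marks t0).
Proof. by move=> /leaves_reorders; apply: perm_filter. Qed.

Lemma marks1_split (x : nat) ls : filter (predC1 0%N) ls = [:: x] ->
  exists a b, ls = nseq a 0%N ++ x :: nseq b 0%N.
Proof.
elim: ls => //= y ls IH; case: eqP => [->|_] /=.
  by move=> /IH[a [b ->]]; exists a.+1, b.
move=> [->] H; exists 0%N, (size ls); congr cons.
by apply/all_pred1P; move/eqP: H; rewrite -[_ == _]negbK -has_filter -all_predC;
  apply: sub_all => z /=; rewrite negbK.
Qed.

Lemma marks1_once t : marks t = [:: 1%N] -> once 1 t.
Proof.
move=> E; rewrite /once; have : count_mem 1%N (marks t) = 1%N by rewrite E.
by rewrite /marks count_filter => <-; apply/eqP/eq_count => x /=; case: eqP => // ->.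
Qed.

Lemma marks_le K t : all (leq^~ K) (marks t) -> all (leq^~ K) (leaves t).
Proof.
move=> /allP H; apply/allP => x xl; have [->//|x0] := eqVneq x 0%N.
by apply: H; rewrite mem_filter /= x0.
Qed.

Section Series.
Variable P : forall n, {set lgraph n}.
Hypothesis P_stable : forall (n : nat) (s : 'S_n) (H : lgraph n),
  H \in P n -> relabel s H \in P n.
Hypothesis P_prime : forall (n : nat) (H : lgraph n), H \in P n -> prime_graph H.

Definition unmarked_cls (a : option bool) : set tree :=
  [set s | [/\ good P s, unmarked s & no_clash a (root_type s)]]%classic.

(** The leaf with mark 1 stands for the blossom, except that it counts in the size. *)
Definition single_cls (W : seq (option bool) -> Prop) : set tree :=
  [set s | [/\ good P s, marks s = [:: 1%N] & W (path_types 1 s)]]%classic.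

Definition unmarked_gf a := gf weight nleaves (unmarked_cls a).
Definition single_gf W := gf weight nleaves (single_cls W).

Lemma finite_P_trees n : finite_set [set t | P_trees P t /\ nleaves t = n]%classic.
Proof.
have [L LP] := good_bounded P n n.
apply: (@finite_set_in_seq _ L) => t [/(P_treesP P_prime)[gt _ pt] tn].
apply: LP; rewrite ?tn //; apply/allP => x; rewrite (perm_mem pt) mem_iota tn; lia.
Qed.

Lemma egf_unmarked a : egf [set t | P_trees P t /\ no_clash a (root_type t)]%classic nleaves = unmarked_gf a.
Proof.
have QE (s : tree) : unmarked s <-> leaves s = nseq (nleaves s) 0%N.
  rewrite /unmarked /marks; split=> [/eqP/eqP|->]; last first.
    by apply/eqP; elim: (nleaves s).
  rewrite -[_ == _]negbK -has_filter -all_predC => H; apply/all_pred1P.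
  by apply: sub_all H => z /=; rewrite negbK.
(* The structure is trivial: every label is erased to 0. *)
have E := @egf_erase P P_stable P_prime unit (fun _ _ => 0%N) (fun _ _ => True)
  [set s | unmarked s /\ no_clash a (root_type s)]%classic 0%N.
have -> : unmarked_gf a = gf weight nleaves (shape_cls P [set s | unmarked s /\ no_clash a (root_type s)]%classic).
  by apply: eq_gf => s; split=> [[gs us ns]|[gs [us ns]]].
rewrite -E {E}.
- apply: fps_eqP => n /=; congr (_ / _); rewrite -!wsum1.
  rewrite (@wsum_bij _ _ [set t | P_trees P t /\ nleaves t = n /\ no_clash a (root_type t)]%classic
    _ (fun t => (t, tt))) //.
  + by apply: wsum_cond => t; split=> [[[Pt nt] tn]|[Pt [tn nt]]].
  + by apply: sub_finite_set (finite_P_trees n) => t [Pt []].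
  + move=> [t []] /=; split=> [[[Pt _ [_ nt]] tn]|[u [Pu [un nu]] [->]]].
      by exists t => //; split=> //; split=> //; rewrite root_type_map_leaves in nt.
    split=> //; split=> //; split; last by rewrite root_type_map_leaves.
    by apply/QE; rewrite leaves_map_leaves nleaves_map_leaves /nleaves; elim: (leaves u) => //= x ls ->.
  + by move=> t t' _ _ [].
- by move=> s [/QE -> _]; apply/allP => x /nseqP[->].
- move=> n s ls [/QE sE _] sn pls; exists tt => //; rewrite sE sn.
  have -> : n = size ls by rewrite (perm_size pls) size_iota.
  by elim: ls {pls} => //= x ls ->.
- by move=> n ls [] [].
- move=> s s' sO _ [us ns]; split; last by rewrite (root_type_reorders sO).
  by move: us; rewrite /unmarked -!size_eq0 (perm_size (marks_reorders sO)).
- by [].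
Qed.

Lemma is_lin_no_clash b t : ~~ is_lin b (root_dec t) = no_clash (Some b) (root_type t).
Proof. by case: t => // -[c|n H] ts //=; case: b c => [] []. Qed.

Lemma T_allE : T_all P = unmarked_gf None.
Proof.
rewrite -egf_unmarked; congr egf; apply/seteqP; split=> t; [exact: (fun Pt => conj Pt isT) | by case].
Qed.

Lemma T_not_oplusE : T_not_oplus P = unmarked_gf (Some true).
Proof.
by rewrite -egf_unmarked; congr egf; apply/seteqP; split=> t /=; rewrite is_lin_no_clash.
Qed.

(** The structure is now a distinguished leaf l, which receives the mark 1 while all others receive
    0. *)
Let mk (l i : nat) : nat := i == l.
Let valid (ls : seq nat) (l : nat) := l \in ls.

Lemma marks_mark l t : uniq (leaves t) -> l \in leaves t -> marks (map_leaves (mk l) t) = [:: 1%N].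
Proof.
rewrite /marks leaves_map_leaves; elim: (leaves t) => //= x ls IH /andP[xls uls].
rewrite inE /mk; have [xl|xl] /= := eqVneq x l; last exact: IH.
move=> _; congr cons; rewrite xl in xls; elim: ls xls {IH uls} => //= y ls IH.
by rewrite inE negb_or => /andP[/negbTE ly /IH]; rewrite [y == l]eq_sym ly.
Qed.

Lemma path_types_mark l t : path_types 1 (map_leaves (mk l) t) = path_types l t.
Proof.
rewrite -{1}[1%N]/(nat_of_bool true) -(eqxx l) path_types_map_leaves // => x _.
by rewrite /mk eqxx; case: eqP.
Qed.

Section SingleErase.
Variable W : seq (option bool) -> Prop.
Let Q : set tree := [set s | marks s = [:: 1%N] /\ W (path_types 1 s)]%classic.

Let QK s : Q s -> all (leq^~ 1%N) (leaves s).
Proof. by case=> E _; apply: marks_le; rewrite E. Qed.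

Let mk_ex n s ls : Q s -> nleaves s = n -> perm_eq ls (iota 1 n) ->
  exists2 x, valid ls x & map (mk x) ls = leaves s.
Proof.
move=> [sE _] sn pls; have [a [b E]] := marks1_split sE.
have szl : size ls = (a + b.+1)%N.
  by rewrite (perm_size pls) size_iota -sn /nleaves E size_cat /= !size_nseq.
have uls : uniq ls by rewrite (perm_uniq pls) iota_uniq.
exists (nth 0%N ls a); first by rewrite /valid mem_nth // szl; lia.
rewrite E; apply: (@eq_from_nth _ 0%N) => [|i].
  by rewrite size_map size_cat /= !size_nseq szl.
rewrite size_map szl => ilt; rewrite (nth_map 0%N) ?szl // /mk nth_uniq ?szl //; last by lia.
rewrite nth_cat size_nseq nth_nseq; case: ltngtP => [//|ai|->]; last by rewrite subnn.
by case E': (i - a)%N => [|k] /=; [lia | rewrite nth_nseq if_same].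
Qed.

Let mk_uniq n ls x x' : perm_eq ls (iota 1 n) -> valid ls x -> valid ls x' ->
  map (mk x) ls = map (mk x') ls -> x = x'.
Proof.
move=> _ vx vx' /eq_in_map/(_ x vx); rewrite /mk eqxx; by case: eqP.
Qed.

Let Q_reorders s s' : s' \in reorders s -> good P s -> Q s -> Q s'.
Proof.
move=> sO _ [sE Ws]; have sE' : marks s' = [:: 1%N].
  by have := marks_reorders sO; rewrite sE => /perm_small_eq; apply.
by split=> //; rewrite (path_types_reorders sO) //; apply: marks1_once.
Qed.

Lemma single_gfE : single_gf W = gf weight nleaves (shape_cls P Q).
Proof. by apply: eq_gf => s; split=> [[gs us ns]|[gs [us ns]]]. Qed.

Lemma single_card n : #|` fset_set [set p : tree * nat | [/\ P_trees P p.1, nleaves p.1 = n,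
    p.2 \in leaves p.1 & W (path_types p.2 p.1)]]%classic|%:R = n`!%:R * coefs (single_gf W) n.
Proof.
rewrite single_gfE -(@card_canonical P P_stable P_prime _ mk valid Q 1%N QK mk_ex mk_uniq Q_reorders).
  congr (#|` fset_set _|%:R); apply/seteqP; split=> -[t l] /= [Pt tn lt].
    move=> Wt; split=> //; split; last by rewrite path_types_mark.
    by apply: marks_mark => //; have /(P_treesP P_prime)[_ _ /perm_uniq ->] := Pt; apply: iota_uniq.
  by move=> [_]; rewrite path_types_mark.
by move=> ls ls' x pls; rewrite /valid (perm_mem pls).
Qed.

(** Transposing the labels l and n + 1 is a bijection that preserves weights. It is available on
    plane trees because no order ties the labels to the positions of children. *)
Lemma single_plane n l : (0 < l <= n.+1)%N ->
    wsum [set t | [/\ good P t, perm_eq (leaves t) (iota 1 n.+1) & W (path_types l t)]]%classic weight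
  = wsum [set t | [/\ good P t, perm_eq (leaves t) (iota 1 n.+1) & W (path_types n.+1 t)]]%classic weight.
Proof.
move=> /andP[l0 ln].
pose f (i : nat) := if i == l then n.+1 else if i == n.+1 then l else i.
have fK i : f (f i) = i.
  by rewrite /f; do !case: eqP => //; lia.
have finA k : finite_set [set t | [/\ good P t, perm_eq (leaves t) (iota 1 n.+1) & W (path_types k t)]]%classic.
  have [L LP] := good_bounded P n.+1 n.+1.
  apply: (@finite_set_in_seq _ L) => t [gt pt _]; apply: LP => //.
    by apply/allP => x; rewrite (perm_mem pt) mem_iota; lia.
  by rewrite /nleaves (perm_size pt) size_iota.
have pf : perm_eq (map f (iota 1 n.+1)) (iota 1 n.+1).
  apply: uniq_perm; [|exact: iota_uniq|].
    by rewrite map_inj_in_uniq ?iota_uniq // => i j _ _; apply: can_inj fK _ _.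
  move=> i; rewrite -{1}[i]fK mem_map; last exact: can_inj fK.
  by rewrite !mem_iota /f; do !case: eqP => //; lia.
have wE k t : path_types (f k) (map_leaves f t) = path_types k t.
  by apply: path_types_map_leaves => x _ /(can_inj fK).
rewrite [RHS](@wsum_bij _ _ _ _ (map_leaves f) weight (finA l)).
- by apply: eq_wsum => t _ /=; rewrite weight_map_leaves.
- have fl : f l = n.+1 by rewrite /f eqxx.
  have fn : f n.+1 = l by rewrite -fl fK.
  move=> t; split=> [[gt pt Wt]|[u [gu pu Wu] ->]].
    exists (map_leaves f t).
      split; rewrite ?good_map_leaves // ?leaves_map_leaves; last by rewrite -fn wE.
      by apply: perm_trans pf; apply: perm_map.
    by rewrite map_leaves_comp -[LHS]map_leaves_id; apply: eq_map_leaves => x _ /=; rewrite fK.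
  split; rewrite ?good_map_leaves // ?leaves_map_leaves; last by rewrite -fl wE.
  by apply: perm_trans pf; apply: perm_map.
- move=> t u _ _ /(congr1 (map_leaves f)); rewrite !map_leaves_comp => E.
  rewrite -[t]map_leaves_id -[u]map_leaves_id -!(eq_map_leaves (f := f \o f) (g := id)) // => x _ /=; exact: fK.
Qed.

(** The n + 1 possible labels of the distinguished leaf contribute equally, so fixing the label
    divides (n + 1)! by n + 1. The remaining n! is the one belonging to blossomed trees of size
    n. *)
Lemma single_last n : wsum [set t | [/\ good P t, perm_eq (leaves t) (iota 1 n.+1) &
    W (path_types n.+1 t)]]%classic weight = n`!%:R * coefs (single_gf W) n.+1.
Proof.
apply: (@mulfI _ n.+1%:R); first by rewrite pnatr_eq0.
rewrite mulrA -natrM -factS single_gfE -(@wsum_plane_cls P _ mk valid Q 1%N QK mk_ex mk_uniq).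
rewrite (@wsum_sigma _ _ _ (iota 1 n.+1) (fun l => [set t | [/\ good P t,
  perm_eq (leaves t) (iota 1 n.+1) & W (path_types l t)]]%classic) _ (fun l t => (t, l))).
- rewrite big_seq (eq_bigr (fun=> wsum [set t | [/\ good P t, perm_eq (leaves t) (iota 1 n.+1) &
    W (path_types n.+1 t)]]%classic weight)); last first.
    by move=> l; rewrite mem_iota => ll; rewrite -(@single_plane n l) //; lia.
  by rewrite -big_seq big_const_seq count_predT size_iota iter_addr_0 mulr_natl.
- exact: iota_uniq.
- move=> l _; have [L LP] := good_bounded P n.+1 n.+1.
  apply: (@finite_set_in_seq _ L) => t [gt pt _]; apply: LP => //.
    by apply/allP => x; rewrite (perm_mem pt) mem_iota; lia.
  by rewrite /nleaves (perm_size pt) size_iota.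
- move=> [t l]; split=> [[/= gt pt vl [_ Wt]]|[l' [t' [ll [gt pt Wt] [-> ->]]]]].
    by exists l, t; split=> //; [rewrite -(perm_mem pt) | rewrite path_types_mark in Wt].
  split=> //=; first by rewrite /valid (perm_mem pt).
  split; last by rewrite path_types_mark.
  by apply: marks_mark; [rewrite (perm_uniq pt) iota_uniq | rewrite (perm_mem pt)].
- by move=> l l' t t' _ _ _ _ [-> ->].
Qed.

Lemma single_gf0 : coefs (single_gf W) 0 = 0.
Proof.
rewrite single_gfE /= (@wsum_seq _ [::]) ?big_nil // => s; split=> // -[[/good_arity_ok/leaves_gt0 + _]].
by rewrite /nleaves => /[swap] ->.
Qed.

Lemma zM_single (F : fps) : (forall n, coefs F n = coefs (single_gf W) n.+1) -> fps_z * F = single_gf W.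
Proof. by move=> FE; apply: fps_eqP => -[|n]; rewrite coefs_zM ?single_gf0 ?FE. Qed.

End SingleErase.

(** The operator z d/dz points a leaf, and a tree with n + 1 leaves has n + 1 choices for the
    mark. *)
Lemma deriv_single a : fps_z * fps_deriv (unmarked_gf a) = single_gf (fun wd => no_clash a (head None wd)).
Proof.
apply: zM_single => n; change (coefs (unmarked_gf a) n.+1 *+ n.+1 = coefs (single_gf (fun wd => no_clash a (head None wd))) n.+1).
apply: (mulfI (x := n.+1`!%:R)); first by rewrite pnatr_eq0 -lt0n fact_gt0.
rewrite -single_card -egf_unmarked mulrnAr [coefs _ _]/= mulrCA mulfV ?mulr1; last first.
  by rewrite pnatr_eq0 -lt0n fact_gt0.
rewrite -!wsum1 (@wsum_prod _ _ [set t | (P_trees P t /\ no_clash a (root_type t)) /\ nleaves t = n.+1]%classic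
  [set` iota 1 n.+1]%classic).
- rewrite (eq_bigr (fun=> n.+1%:R)) => [|t _].
    by rewrite /wsum -sumrMnl.
  rewrite (@wsum_seq _ (iota 1 n.+1)) ?iota_uniq //.
  by rewrite big_const_seq count_predT size_iota iter_addr_0.
- by apply: sub_finite_set (finite_P_trees n.+1) => t [[]].
- exact: finite_seq.
- move=> [t l]; split=> [[/= Pt tn lt nt]|[[[/= Pt nt] tn] ll]].
    split; first by rewrite (root_type_path_types l).
    by have /(P_treesP P_prime)[_ _ /perm_mem E] := Pt; rewrite tn in E; change (l \in iota 1 n.+1); rewrite -E.
  split=> //; last by rewrite -root_type_path_types.
  by have /(P_treesP P_prime)[_ _ /perm_mem ->] := Pt; rewrite tn.
Qed.

End Series.

(** * Blossomed trees *)

Fixpoint bpath_types (b : btree) : seq (option bool) :=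
  if b is BNode d _ b' then dec_type d :: bpath_types b' else [::].

(** Turns the blossom back into a leaf, so that the theory of reorderings applies to blossomed
    trees; the stored order puts this leaf in the last child of each node on its path. *)
Fixpoint unblossom (L : nat) (b : btree) : tree :=
  match b with
  | Blossom => Leaf L
  | BNode d ts b' => Node d (rcons ts (unblossom L b'))
  end.

Lemma unblossom_inj L : injective (unblossom L).
Proof.
elim=> [|d ts b IH] [|d' ts' b'] //= [-> /rcons_inj[-> /IH ->]] //.
Qed.

(** For 1 <= l <= L, a cyclic permutation of the labels from 1 to L, which agrees with
    [reduce_labels] on the labels other than l and sends l to L. *)
Definition shift (l L i : nat) := if i == l then L else if (l < i)%N then i.-1 else i.

(* Sorting by this key moves the child containing the leaf L to the end, as in
   blossomed trees; L is the largest label in the applications. *)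
Definition minleaf_last (L : nat) (t : tree) := if L \in leaves t then L else minleaf t.

Lemma minleaf_last_perm L t u : perm_eq (leaves t) (leaves u) ->
  minleaf_last L t = minleaf_last L u.
Proof. by move=> tu; rewrite /minleaf_last (perm_mem tu) (perm_minleaf tu). Qed.

Lemma minleaf_last_mem L t : (0 < size (leaves t))%N -> minleaf_last L t \in leaves t.
Proof. by move=> t0; rewrite /minleaf_last; case: ifP => // _; apply: mem_minleaf. Qed.

Lemma reduce_labels_map_leaves l t : l \notin leaves t -> forall L, reduce_labels l t = map_leaves (shift l L) t.
Proof.
move=> + L; elim/tree_nind: t => [i|d ts IH] /= lt.
  by rewrite /shift; rewrite inE eq_sym in lt; rewrite (negbTE lt).
congr Node; apply/eq_in_map => _ /(nthP (Leaf 0%N))[i ilt <-]; apply: IH => //.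
by apply: contra lt => /(mem_leaves_nth d ilt).
Qed.

Lemma map_del_nth (T U : Type) (f : T -> U) k s : map f (del_nth k s) = del_nth k (map f s).
Proof. by rewrite /del_nth map_cat map_take map_drop. Qed.

Lemma mem_del_iota k n j : (k < n)%N -> (j \in del_nth k (iota 0 n)) = (j < n)%N && (j != k).
Proof.
move=> kn; rewrite /del_nth take_iota drop_iota mem_cat !mem_iota.
by rewrite (minn_idPl (ltnW kn)); lia.
Qed.

Lemma subseq_del_nth (T : eqType) k (s : seq T) : subseq (del_nth k s) s.
Proof.
rewrite /del_nth -[X in subseq _ X](cat_take_drop k) cat_subseq //.
by rewrite -add1n -drop_drop drop_subseq.
Qed.

Lemma perm_del_iota k n : (k < n)%N -> perm_eq (rcons (del_nth k (iota 0 n)) k) (iota 0 n).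
Proof.
move=> kn; rewrite perm_rcons; apply: uniq_perm; last 1 first.
- by move=> j; rewrite inE mem_del_iota // mem_iota; lia.
- rewrite cons_uniq mem_del_iota // eqxx andbF /=.
  exact: subseq_uniq (subseq_del_nth _ _) (iota_uniq _ _).
- exact: iota_uniq.
Qed.

Lemma map_nth_del k ts : map (nt ts) (del_nth k (iota 0 (size ts))) = del_nth k ts.
Proof. by rewrite map_del_nth map_nth_iota0 // take_size. Qed.

(** Along the path, blossoming only moves one child to the end and carries its vertex along; on the
    labels it acts as [shift]. *)
Lemma unblossom_blossoming l L t : arity_ok t -> once l t ->
  unblossom L (blossoming l t) \in reorders (map_leaves (shift l L) t).
Proof.
elim/tree_nind: t => [i _|d ts IH wt ol].
  by rewrite /once /= addn0 /shift inE; case: (i == l).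
have [i [ilt oi iu]] := onceP ol; rewrite /= (find_child ilt (once_mem oi) iu).
rewrite (nth_map (Leaf 0%N)) //.
(* [ks] keeps the other ranks in order and puts that of the child containing l last, which is the
   relabeling performed by [star_dec]. *)
set n := size ts in ilt *; set ks := rcons (del_nth i (iota 0 n)) i.
pose us := mkseq (fun j => if j == i then unblossom L (blossoming l (nt ts i))
  else map_leaves (shift l L) (nt ts j)) n.
apply/reorders_nodeP; exists ks, us; rewrite size_map size_mkseq; split=> //.
- exact: perm_del_iota.
- move=> j jlt; rewrite nth_mkseq // (nth_map (Leaf 0%N)) //; case: eqP => [->|_].
    by apply: IH => //; apply: arity_ok_node wt _.
  by apply: reorders_refl; rewrite arity_ok_map_leaves; apply: arity_ok_node wt _.
- have -> : star_dec i d = sel_dec ks d.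
    by case: d {IH ol} wt => // m H /and3P[_ /= /eqP mE _]; rewrite /ks /n -mE.
  congr Node; rewrite map_rcons -map_nth_del -/n -map_comp; congr rcons; last first.
    by rewrite nth_mkseq // eqxx.
  apply/eq_in_map => j; rewrite mem_del_iota // => /andP[jlt ji] /=.
  rewrite nth_mkseq // (negbTE ji); apply: reduce_labels_map_leaves.
  by apply: contra ji => /(iu _ jlt) ->.
Qed.

Lemma minleaf_map_leaves f t : (0 < size (leaves t))%N ->
  (forall x y, x \in leaves t -> y \in leaves t -> (x <= y)%N -> (f x <= f y)%N) ->
  minleaf (map_leaves f t) = f (minleaf t).
Proof.
move=> t0 mf; have mt := mem_minleaf t0; apply/eqP; rewrite eqn_leq minleaf_le /=; last first.
  by rewrite leaves_map_leaves map_f.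
have : minleaf (map_leaves f t) \in leaves (map_leaves f t) by rewrite mem_minleaf // leaves_map_leaves size_map.
by rewrite leaves_map_leaves => /mapP[x xt ->]; apply: mf => //; apply: minleaf_le.
Qed.

Section Shift.
Variables l L : nat.

(** Under this condition the child that receives L has a larger key than all its siblings. *)
Definition below t := forall x, x \in leaves t -> x != l -> (shift l L x < L)%N.

Lemma below_node d ts i : below (Node d ts) -> (i < size ts)%N -> below (nt ts i).
Proof. by move=> bt ilt x xt; apply: bt; apply: mem_leaves_nth xt. Qed.

Lemma minleaf_last_shift t : arity_ok t -> below t -> l \notin leaves t ->
  minleaf_last L (map_leaves (shift l L) t) = shift l L (minleaf t).
Proof.
move=> wt bt lt; rewrite /minleaf_last ifF; last first.
  apply/negP; rewrite leaves_map_leaves => /mapP[x xt xL].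
  have [xl|xl] := eqVneq x l; first by rewrite -xl xt in lt.
  by have := bt _ xt xl; rewrite -xL ltnn.
apply: minleaf_map_leaves; first exact: leaves_gt0.
move=> x y xt yt; have xl : x != l by apply: contraNneq lt => <-.
have yl : y != l by apply: contraNneq lt => <-.
by rewrite /shift (negbTE xl) (negbTE yl); case: (ltnP l x); case: (ltnP l y); lia.
Qed.

Lemma shift_lt x y : x != l -> y != l -> (x < y)%N -> (shift l L x < shift l L y)%N.
Proof. by move=> xl yl; rewrite /shift (negbTE xl) (negbTE yl); case: (ltnP l x); case: (ltnP l y); lia. Qed.

Lemma sorted_shift ts : all arity_ok ts -> (forall t, t \in ts -> below t /\ l \notin leaves t) ->
  sorted (relpre minleaf ltn) ts ->
  sorted (relpre (minleaf_last L) ltn) (map (map_leaves (shift l L)) ts).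
Proof.
move=> /allP wts bts; rewrite sorted_map.
apply: (@sub_in_sorted _ (mem ts)); last exact/allP.
move=> t u tts uts /= tu; have [bt lt] := bts _ tts; have [bu lu] := bts _ uts.
rewrite /= !minleaf_last_shift ?wts //; apply: shift_lt => //.
  by apply: contraNneq lt => <-; rewrite mem_minleaf ?leaves_gt0 ?wts.
by apply: contraNneq lu => <-; rewrite mem_minleaf ?leaves_gt0 ?wts.
Qed.

Lemma ksorted_shift t : arity_ok t -> below t -> l \notin leaves t -> ksorted minleaf t ->
  ksorted (minleaf_last L) (map_leaves (shift l L) t).
Proof.
elim/tree_nind: t => // d ts IH wt bt lt /= /andP[st /allP sts].
have H i : (i < size ts)%N -> below (nt ts i) /\ l \notin leaves (nt ts i).
  move=> ilt; split; first exact: below_node bt ilt.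
  by apply: contra lt => /(mem_leaves_nth d ilt).
apply/andP; split.
  apply: sorted_shift => //; first by case/and3P: wt.
  by move=> _ /(nthP (Leaf 0%N))[i ilt <-]; apply: H.
rewrite all_map; apply/allP => _ /(nthP (Leaf 0%N))[i ilt <-] /=; have [bi li] := H i ilt.
by apply: IH => //; [apply: arity_ok_node wt _ | apply/sts/mem_nth].
Qed.

(** Away from l the shift is increasing, so the other children stay sorted, and the child with the
    blossom, whose key is L, rightly comes last. *)
Lemma ksorted_unblossom t : arity_ok t -> once l t -> below t -> ksorted minleaf t ->
  ksorted (minleaf_last L) (unblossom L (blossoming l t)).
Proof.
elim/tree_nind: t => // d ts IH wt ol bt /= /andP[st /allP sts].
have [i [ilt oi iu]] := onceP ol; rewrite (find_child ilt (once_mem oi) iu).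
rewrite (nth_map (Leaf 0%N)) //=.
have subd : {subset del_nth i ts <= ts} by apply: mem_subseq; apply: subseq_del_nth.
have H u : u \in del_nth i ts -> below u /\ l \notin leaves u.
  rewrite -map_nth_del => /mapP[j]; rewrite mem_del_iota // => /andP[jlt ji] ->.
  split; first exact: below_node bt jlt.
  by apply: contra ji => /(iu _ jlt) ->.
have -> : map (reduce_labels l) (del_nth i ts) = map (map_leaves (shift l L)) (del_nth i ts).
  by apply/eq_in_map => u /H[_ lu]; apply: reduce_labels_map_leaves.
have /allP wts : all arity_ok ts by case/and3P: wt.
rewrite all_rcons; apply/and3P; split.
- have tr (K : tree -> nat) : transitive (relpre K ltn) by move=> y x z; apply: ltn_trans.
  rewrite sorted_pairwise // pairwise_rcons -sorted_pairwise //; apply/andP; split.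
    rewrite all_map; apply/allP => u ud /=; have [bu lu] := H _ ud.
    have wu : arity_ok u by apply/wts/subd.
    rewrite minleaf_last_shift // [X in (_ < X)%N]/minleaf_last ifT.
      by apply: bu; rewrite ?mem_minleaf ?leaves_gt0 //; apply: contraNneq lu => <-;
        rewrite mem_minleaf ?leaves_gt0.
    have := leaves_reorders (unblossom_blossoming L (arity_ok_node wt ilt) oi) => /perm_mem ->.
    rewrite leaves_map_leaves; apply/mapP; exists l; first exact: once_mem.
    by rewrite /shift eqxx.
  apply: sorted_shift => //; first by apply/allP => u /subd/wts.
  by apply: subseq_sorted (subseq_del_nth _ _) st.
- by apply: IH => //; [apply: arity_ok_node wt _ | apply: below_node bt ilt | apply/sts/mem_nth].
- rewrite all_map; apply/allP => u ud /=; have [bu lu] := H _ ud.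
  by apply: ksorted_shift => //; [apply/wts/subd | apply/sts/subd].
Qed.

End Shift.

Lemma bpath_types_blossoming l t : bpath_types (blossoming l t) = path_types l t.
Proof.
elim/tree_nind: t => // d ts IH /=; congr cons; first by case: d.
set k := find _ _; have [klt|klt] := ltnP k (size ts).
  by rewrite !(nth_map (Leaf 0%N)) //= IH.
by rewrite !nth_default ?size_map.
Qed.

Lemma nleaves_unblossom L b : nleaves (unblossom L b) = (bsize b).+1.
Proof.
elim: b => // d ts b IH; rewrite [unblossom _ _]/= nleaves_node map_rcons sumn_rcons IH /=.
by rewrite addnS.
Qed.

Lemma bsize_blossoming l t : arity_ok t -> once l t -> (bsize (blossoming l t)).+1 = nleaves t.
Proof.
move=> wt ol; rewrite -(nleaves_unblossom 0) /nleaves.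
by rewrite (perm_size (leaves_reorders (unblossom_blossoming 0 wt ol))) leaves_map_leaves size_map.
Qed.

Section BSeries.
Variable P : forall n, {set lgraph n}.
Hypothesis P_stable : forall (n : nat) (s : 'S_n) (H : lgraph n),
  H \in P n -> relabel s H \in P n.
Hypothesis P_prime : forall (n : nat) (H : lgraph n), H \in P n -> prime_graph H.

Lemma P_trees_regular t : P_trees P t -> regular t.
Proof. by move=> /(P_treesP P_prime)[gt _ pt]; exact: perm_iota_regular gt pt. Qed.

(** Each blossomed tree of size n is the blossoming, at its largest label L = n + 1, of exactly one
    tree of [P_trees]. These trees are the sorted plane trees with a condition on the path to L,
    counted by [single_last]. *)
Lemma card_btrees (W : seq (option bool) -> Prop) n :
  #|` fset_set [set b | (P_btrees P b /\ W (bpath_types b)) /\ bsize b = n]%classic|%:R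
  = n`!%:R * coefs (single_gf P W) n.+1.
Proof.
rewrite -single_last //; have [L LE] : exists L, L = n.+1 by exists n.+1.
rewrite -LE.
pose A : set (tree * unit) := [set p | [/\ good P p.1, perm_eq (leaves p.1) (iota 1 L)
  & W (path_types L p.1)]]%classic.
have finA : finite_set [set t | [/\ good P t, perm_eq (leaves t) (iota 1 L)
  & W (path_types L t)]]%classic.
  have [K KP] := good_bounded P L L.
  apply: (@finite_set_in_seq _ K) => t [gt pt _]; apply: KP => //.
    by apply/allP => x; rewrite (perm_mem pt) mem_iota; lia.
  by rewrite /nleaves (perm_size pt) size_iota.
have finA' : finite_set A.
  apply: (finite_inj (f := fst) finA) => [[t []] [] //|].
  by move=> [t []] [u []] _ _ /= ->.
transitivity (wsum A (fun p => weight p.1)); last first.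
  rewrite (@wsum_bij _ _ _ A (fun t => (t, tt)) _ finA) //.
  - by move=> [t []]; split=> [At|[u Au [->]]] //; exists t.
  - by move=> t u _ _ [].
rewrite (@wsum_sorted _ minleaf) //; last 4 first.
- exact: perm_minleaf.
- exact: mem_minleaf.
- by move=> [t []] [/= gt pt _]; exact: perm_iota_regular gt pt.
- move=> t u [] [/= gt pt Wt] uO; split=> /=.
  + exact: (good_reorders P_stable uO gt).
  + exact: perm_trans (leaves_reorders uO) pt.
  + rewrite (path_types_reorders uO) // once_uniq ?(perm_uniq pt) ?iota_uniq //.
    by rewrite (perm_mem pt) mem_iota; lia.
rewrite -!wsum1.
have SE (p : tree * unit) : A p /\ ksorted minleaf p.1 <->
    [/\ P_trees P p.1, nleaves p.1 = L & W (path_types L p.1)].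
  case: p => t [] /=; split=> [[[/= gt pt Wt] st]|[/(P_treesP P_prime)[gt st pt] tL Wt]].
    have tL : nleaves t = L by rewrite /nleaves (perm_size pt) size_iota.
    by split=> //; apply/P_treesP; rewrite ?tL.
  by rewrite tL in pt; split.
have oL t : P_trees P t -> nleaves t = L -> once L t.
  move=> Pt tL; apply: once_uniq; first by case/andP: (P_trees_regular Pt).
  by have /(P_treesP P_prime)[_ _ /perm_mem ->] := Pt; rewrite tL mem_iota; lia.
have sLL t : P_trees P t -> nleaves t = L -> map_leaves (shift L L) t = t.
  move=> /(P_treesP P_prime)[_ _ pt] tL; rewrite -[RHS]map_leaves_id; apply: eq_map_leaves => x.
  rewrite (perm_mem pt) tL mem_iota /shift => xL; case: eqP => // xL'; rewrite ifF //.
  by lia.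
have bL l t : P_trees P t -> nleaves t = L -> l \in leaves t -> below l L t.
  move=> /(P_treesP P_prime)[_ _ pt] tL; rewrite (perm_mem pt) tL mem_iota => ll x.
  by rewrite (perm_mem pt) tL mem_iota => xL xl; rewrite /shift (negbTE xl) in ll xL *; case: (ltnP l x); lia.
have reO l t : P_trees P t -> l \in leaves t ->
    unblossom L (blossoming l t) \in reorders (map_leaves (shift l L) t).
  move=> Pt lt; have /andP[wt ut] := P_trees_regular Pt.
  by apply: unblossom_blossoming => //; apply: once_uniq.
have kP := minleaf_last_perm; have kM := minleaf_last_mem.
rewrite [LHS](@wsum_bij _ _ [set p | A p /\ ksorted minleaf p.1]%classic _
  (fun p => blossoming L p.1)) //.
- by apply: sub_finite_set finA' => p [].
- move=> b; split=> [[[[t0 [l [Pt0 lt0 ->]]] Wb] bn]|[[t []] /SE[/= Pt tL Wt] ->]]; last first.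
    split; last first.
      apply: succn_inj; rewrite bsize_blossoming ?tL ?oL //.
      by case/andP: (P_trees_regular Pt).
    by rewrite bpath_types_blossoming; split=> //; exists t, L; rewrite once_mem ?oL.
  have /andP[wt0 ut0] := P_trees_regular Pt0; have ol : once l t0 by apply: once_uniq.
  have t0L : nleaves t0 = L by rewrite -(bsize_blossoming wt0 ol) bn.
  have /(P_treesP P_prime)[gt0 st0 pt0] := Pt0; rewrite t0L in pt0.
  have lL : (0 < l <= L)%N by move: lt0; rewrite (perm_mem pt0) mem_iota; lia.
  (* The preimage of a blossomed tree: the label of its blossom is moved up to L, and the children,
     no longer ordered by minimal leaf, are sorted again. *)
  set t1 := map_leaves (shift l L) t0; set t := canonize minleaf t1.
  have pt1 : perm_eq (leaves t1) (iota 1 L).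
    rewrite leaves_map_leaves; apply: perm_trans (perm_map _ pt0) _.
    have us : uniq (map (shift l L) (iota 1 L)).
      rewrite map_inj_in_uniq ?iota_uniq // => x y; rewrite !mem_iota /shift in lL *.
      by do !case: eqP => //; case: (ltnP l x); case: (ltnP l y); lia.
    have ss : {subset map (shift l L) (iota 1 L) <= iota 1 L}.
      move=> _ /mapP[x + ->]; rewrite !mem_iota /shift in lL *.
      by case: eqP => //; case: (ltnP l x); lia.
    apply: uniq_perm => //; first exact: iota_uniq.
    by have [] := uniq_min_size us ss; rewrite ?size_map.
  have r1 : regular t1 by rewrite /regular arity_ok_map_leaves wt0 (perm_uniq pt1) iota_uniq.
  have tO : t \in reorders t1 by apply: canon_reorders.
  have pt : perm_eq (leaves t) (iota 1 L) := perm_trans (leaves_reorders tO) pt1.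
  have tL : nleaves t = L by rewrite /nleaves (perm_size pt) size_iota.
  have Pt : P_trees P t.
    apply/P_treesP => //; rewrite tL; split=> //.
      by apply: (good_reorders P_stable tO); rewrite good_map_leaves.
    by apply: (ksorted_canon perm_minleaf mem_minleaf r1).
  have Lt : L \in leaves t by rewrite once_mem ?oL.
  (* With the blossom restored as L, both sides are sorted for [minleaf_last] and are reorderings of
     [t1] up to [canonize], hence equal. *)
  have bE : blossoming l t0 = blossoming L t.
    apply: (@unblossom_inj L).
    have O1 : unblossom L (blossoming l t0) \in reorders t1 := reO _ _ Pt0 lt0.
    have O2 : unblossom L (blossoming L t) \in reorders t by rewrite -{2}(sLL t) //; apply: reO.
    have rt : regular t := P_trees_regular Pt; have [wt _] := andP rt.
    rewrite -(canon_id (@kP L) (@kM L) (regular_reorders O1 r1)); last first.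
      by apply: ksorted_unblossom => //; apply: bL.
    rewrite -[RHS](canon_id (@kP L) (@kM L) (regular_reorders O2 rt)); last first.
      apply: ksorted_unblossom; [by [] | by apply: oL | by apply: bL |].
      by have /(P_treesP P_prime)[] := Pt.
    rewrite (canon_in_reorders (@kP L) (@kM L) r1 O1) (canon_in_reorders (@kP L) (@kM L) rt O2).
    by rewrite (canon_in_reorders (@kP L) (@kM L) r1 tO).
  exists (t, tt) => //; apply/SE; split=> //=.
  by rewrite -bpath_types_blossoming -bE.
(* Restoring the blossom gives a reordering of t, and sorting this by minimal leaf gives t back. *)
- move=> [t []] [u []] /SE[/= Pt tL Wt] /SE[/= Pu uL Wu] tu; congr pair.
  have /andP[wt _] := P_trees_regular Pt; have /andP[wu _] := P_trees_regular Pu.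
  have O1 : unblossom L (blossoming L t) \in reorders t.
    by rewrite -{2}(sLL t) //; apply: reO; rewrite // once_mem ?oL.
  have O2 : unblossom L (blossoming L u) \in reorders u.
    by rewrite -{2}(sLL u) //; apply: reO; rewrite // once_mem ?oL.
  have /(P_treesP P_prime)[_ st _] := Pt; have /(P_treesP P_prime)[_ su _] := Pu.
  rewrite -(canon_id perm_minleaf mem_minleaf (P_trees_regular Pt) st).
  rewrite -(canon_id perm_minleaf mem_minleaf (P_trees_regular Pu) su).
  rewrite -(canon_in_reorders perm_minleaf mem_minleaf (P_trees_regular Pt) O1).
  by rewrite -(canon_in_reorders perm_minleaf mem_minleaf (P_trees_regular Pu) O2) tu.
Qed.

Lemma btree_single (W : seq (option bool) -> Prop) (C : set btree) :
  (forall b, C b <-> P_btrees P b /\ W (bpath_types b)) -> fps_z * egf C bsize = single_gf P W.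
Proof.
move=> CE; apply: zM_single => n.
apply: (mulfI (x := n`!%:R)); first by rewrite pnatr_eq0 -lt0n fact_gt0.
rewrite -card_btrees [coefs _ _]/= mulrCA mulfV ?mulr1; last first.
  by rewrite pnatr_eq0 -lt0n fact_gt0.
by congr (#|` fset_set _|%:R); apply/seteqP; split=> b [/CE].
Qed.

(** The default [None] for the empty word matches the convention that the single blossom is
    replaceable for both signs. *)
Lemma bparent_last b : replaceable true b = (last None (bpath_types b) != Some true)
  /\ replaceable false b = (last None (bpath_types b) != Some false).
Proof.
rewrite /replaceable; suff E c : is_lin c (bparent_dec b) = (last None (bpath_types b) == Some c).
  by rewrite !E.
elim: b => //= d ts b; case: b => [_|d' ts' b'] /=; first by case: d => //= c'; case: c c' => [] [].
by move=> ->.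
Qed.

Lemma broot_head c b : is_lin c (broot_dec b) = (head None (bpath_types b) == Some c).
Proof. by case: b => //= -[c'|n H] ts b //=; case: c c' => [] []. Qed.

End BSeries.

(** * Exchanging the signs of linear nodes *)

Definition swap_type : option bool -> option bool := omap negb.

(** Prime decorations are kept rather than complemented, so that P is preserved; only the conditions
    on signs have to be exchanged. *)
Fixpoint swap_tree (t : tree) : tree :=
  match t with
  | Leaf l => Leaf l
  | Node d ts => Node (if d is Lin b then Lin (~~ b) else d) (map swap_tree ts)
  end.

Lemma swap_typeK : involutive swap_type.
Proof. by case=> [[]|]. Qed.

Lemma no_clash_swap a b : no_clash (swap_type a) (swap_type b) = no_clash a b.
Proof. by case: a b => [[]|] [[]|]. Qed.

Lemma swap_treeK : involutive swap_tree.
Proof.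
elim/tree_nind => // d ts IH /=; congr Node; first by case: d => //= b; rewrite negbK.
rewrite -map_comp -[RHS]map_id; apply/eq_in_map => _ /(nthP (Leaf 0%N))[i ilt <-].
exact: IH.
Qed.

Lemma leaves_swap t : leaves (swap_tree t) = leaves t.
Proof.
elim/tree_nind: t => // d ts IH /=; rewrite -map_comp; congr flatten.
by apply/eq_in_map => _ /(nthP (Leaf 0%N))[i ilt <-] /=; apply: IH.
Qed.

Lemma weight_swap t : weight (swap_tree t) = weight t.
Proof.
elim/tree_nind: t => // d ts IH; rewrite [swap_tree _]/= !weightE size_map big_map.
congr (_ * _); rewrite !(big_nth (Leaf 0%N)) !big_nat; apply: eq_bigr => i /andP[_].
exact: IH.
Qed.

Lemma root_type_swap t : root_type (swap_tree t) = swap_type (root_type t).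
Proof. by case: t => //= -[]. Qed.

Lemma path_types_swap l t : path_types l (swap_tree t) = map swap_type (path_types l t).
Proof.
elim/tree_nind: t => // d ts IH /=; congr cons; first by case: d.
rewrite find_map -map_comp.
rewrite (eq_find (a2 := fun u => l \in leaves u)) => [|u /=]; last by rewrite leaves_swap.
set k := find _ _; have [klt|klt] := ltnP k (size ts).
  by rewrite !(nth_map (Leaf 0%N)) //= IH.
by rewrite !nth_default ?size_map.
Qed.

(* A tree with root type r can be plugged at the end of a path with node types wd,
   and the result has a root type compatible with a. *)
Definition path_ok (a r : option bool) (wd : seq (option bool)) : bool :=
  no_clash a (head r wd) && no_clash r (last None wd).

Lemma path_ok_swap a r wd : path_ok (swap_type a) (swap_type r) (map swap_type wd) = path_ok a r wd.
Proof.
rewrite /path_ok -[None]/(swap_type None) last_map.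
have -> : head (swap_type r) (map swap_type wd) = swap_type (head r wd) by case: wd.
by rewrite !no_clash_swap.
Qed.

(** * Plugging a tree in place of a mark *)

Fixpoint plug (c : tree) (t : tree) : tree :=
  match t with
  | Leaf l => if l == 1%N then c else Leaf l
  | Node d ts => Node d (map (plug c) ts)
  end.

Lemma marks_node d ts : marks (Node d ts) = flatten (map marks ts).
Proof. by rewrite /marks /= filter_flatten -map_comp. Qed.

Lemma marks_node1 d ts i : (i < size ts)%N -> (forall j, (j < size ts)%N -> j != i -> unmarked (nt ts j)) ->
  marks (Node d ts) = marks (nt ts i).
Proof.
rewrite marks_node; elim: ts i => // t ts IH [|i] /= ilt H.
  suff -> : flatten (map marks ts) = [::] by rewrite cats0.
  elim: ts {IH ilt} H => //= u ts IH H; have /eqP -> := H 1%N isT isT.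
  by apply: IH => -[|j] //= jlt _; apply: (H j.+2).
have /eqP -> /= := H 0%N isT isT; apply: IH => // j jlt ji.
exact: (H j.+1).
Qed.

Lemma flatten1 (T : eqType) (ss : seq (seq T)) x : flatten ss = [:: x] ->
  exists i, [/\ (i < size ss)%N, nth [::] ss i = [:: x]
    & forall j, (j < size ss)%N -> j != i -> nth [::] ss j = [::]].
Proof.
elim: ss => // -[|y s] ss IH /=.
  move=> /IH[i [ilt ix H]]; exists i.+1; split=> // -[|j] //.
  by rewrite ltnS eqSS; apply: H.
case: s => //= -[-> E]; exists 0%N; split=> // -[|j] //= jlt _.
elim: ss j E jlt {IH} => // -[|z s] ss IH [|j] //= E jlt; exact: IH.
Qed.

Lemma single_ind (R : tree -> Prop) : R (Leaf 1%N) ->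
  (forall d ts i, (i < size ts)%N -> marks (nt ts i) = [:: 1%N] -> R (nt ts i) ->
    (forall j, (j < size ts)%N -> j != i -> unmarked (nt ts j)) -> R (Node d ts)) ->
  forall v, marks v = [:: 1%N] -> R v.
Proof.
move=> RL RN; elim/tree_nind => [l|d ts IH]; first by rewrite /marks /=; case: eqP => //= _ [->].
rewrite marks_node => /flatten1[i []]; rewrite size_map => ilt; rewrite (nth_map (Leaf 0%N)) // => E H.
apply: (RN d ts i) => //; first exact: IH.
by move=> j jlt ji; have := H j jlt ji; rewrite (nth_map (Leaf 0%N)) // /unmarked => ->.
Qed.

Lemma plug_unmarked c t : unmarked t -> plug c t = t.
Proof.
elim/tree_nind: t => [l|d ts IH]; first by rewrite /unmarked /marks /=; case: (l =P 0%N) => [->|].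
rewrite /unmarked marks_node => /eqP E /=; congr Node.
rewrite -[RHS]map_id; apply/eq_in_map => t tts; have := tts.
move=> /(nthP (Leaf 0%N))[i ilt it]; rewrite -it; apply: IH => //; rewrite it.
apply/eqP/nilP; rewrite /nilp -leqn0 leqNgt -has_predT; apply/hasP => -[x xt _].
have : x \in flatten (map marks ts) by apply/flatten_mapP; exists t.
by rewrite E.
Qed.

(** Stated for any number of marks 1: the exponents then add up over the children, whichever of them
    contain marks. *)
Lemma weight_plug c v : weight (plug c v) = weight v * weight c ^+ count_mem 1%N (leaves v).
Proof.
elim/tree_nind: v => [l|d ts IH].
  by rewrite /=; case: eqP => _; rewrite /= ?mul1r ?expr1 ?mulr1.
rewrite [plug _ _]/= !weightE size_map big_map -mulrA; congr (_ * _).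
rewrite /= count_flatten -map_comp.
elim: ts IH => [|t ts IHts] IH; first by rewrite !big_nil mul1r.
rewrite !big_cons /= (IH 0%N isT) IHts; last by move=> i; apply: (IH i.+1).
by rewrite exprD mulrACA.
Qed.

Lemma nleaves_plug c v : (nleaves (plug c v) + count_mem 1%N (leaves v) =
  nleaves v + count_mem 1%N (leaves v) * nleaves c)%N.
Proof.
elim/tree_nind: v => [l|d ts IH].
  by rewrite /=; case: eqP => _; rewrite /nleaves /= ?mul1n // addnC.
rewrite [plug _ _]/= !nleaves_node /= count_flatten -!map_comp.
elim: ts IH => [|t ts IHts] IH //=.
have := IH 0%N isT; rewrite /= => E.
have {}IHts := IHts (fun i => IH i.+1); move: E IHts.
by rewrite mulnDl; lia.
Qed.

Lemma once_marks1 v : marks v = [:: 1%N] -> count_mem 1%N (leaves v) = 1%N.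
Proof. by move=> /marks1_once/eqP. Qed.

Lemma marks_plug c v : marks v = [:: 1%N] -> marks (plug c v) = marks c.
Proof.
move: v; apply: single_ind => [|d ts i ilt vi IH H] //=.
rewrite (@marks_node1 _ _ i) ?size_map //; first by rewrite (nth_map (Leaf 0%N)).
by move=> j jlt ji; rewrite (nth_map (Leaf 0%N)) // plug_unmarked; apply: H.
Qed.

Lemma root_type_plug c v : marks v = [:: 1%N] -> root_type (plug c v) = head (root_type c) (path_types 1 v).
Proof. by move: v; apply: single_ind. Qed.

(** Says that the marks separate at the root itself, or that the tree is one marked leaf. This
    locates the end of a path intrinsically. *)
Definition branching (c : tree) : bool :=
  match c with
  | Leaf l => l != 0%N
  | Node _ ts => (1 < count (fun u => ~~ unmarked u) ts)%N
  end.

Lemma branching_unmarked c : branching c -> ~~ unmarked c.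
Proof.
case: c => [l|d ts] /=; first by rewrite /unmarked /marks /=; case: eqP.
move=> b2; have : has (fun u => ~~ unmarked u) ts by rewrite has_count; apply: leq_trans b2.
move=> /hasP[u uts]; apply: contra; rewrite /unmarked marks_node => /eqP E.
apply/eqP/nilP; rewrite /nilp -leqn0 leqNgt -has_predT; apply/hasP => -[x xu _].
have : x \in flatten (map marks ts) by apply/flatten_mapP; exists u.
by rewrite E.
Qed.

Lemma count_le1 (T : Type) (a : pred T) x0 s i :
  (forall j, (j < size s)%N -> j != i -> ~~ a (nth x0 s j)) -> (count a s <= 1)%N.
Proof.
elim: s i => //= x s IH [|i] H.
  suff -> : count a s = 0%N by case: (a x).
  apply/eqP; rewrite -leqn0 leqNgt -has_count; apply/(has_nthP x0) => -[j jlt].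
  by have /= := H j.+1; rewrite ltnS => /(_ jlt isT)/negbTE ->.
have /= /negbTE -> := H 0%N isT isT; rewrite add0n; apply: (IH i) => j jlt ji.
exact: (H j.+1).
Qed.

Lemma plug_not_branching c d ts i : (i < size ts)%N ->
  (forall j, (j < size ts)%N -> j != i -> unmarked (nt ts j)) ->
  branching (plug c (Node d ts)) = false.
Proof.
move=> ilt H; apply/negbTE; rewrite /= -leqNgt.
apply: (@count_le1 _ _ (Leaf 0%N) _ i) => j; rewrite size_map => jlt ji.
by rewrite (nth_map (Leaf 0%N)) // negbK plug_unmarked; apply: H.
Qed.

(** The nodes strictly above the plugged tree have a single child containing marks, hence are not
    branching. Descending from the root, the first branching node is the root of the plugged
    tree. *)
Lemma plug_inj c c' v v' : marks v = [:: 1%N] -> marks v' = [:: 1%N] ->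
  branching c -> branching c' -> plug c v = plug c' v' -> v = v' /\ c = c'.
Proof.
move=> nv nv' bc bc'; move: v nv v' nv'.
apply: single_ind => [|d ts i ilt vi IH H]; apply: single_ind => [|d' ts' i' ilt' vi' _ H'].
- by [].
- by move=> E; have := plug_not_branching c' d' ilt' H'; rewrite -E /= bc.
- by move=> E; have := plug_not_branching c d ilt H; rewrite E /= bc'.
rewrite /= => -[-> E].
have sE : size ts = size ts' by have := congr1 size E; rewrite !size_map.
have Ej j : (j < size ts)%N -> plug c (nt ts j) = plug c' (nt ts' j).
  move=> jlt; have := congr1 (fun s => nt s j) E.
  by rewrite !(nth_map (Leaf 0%N)) // -sE.
(* Otherwise the child of rank i would contain the marks of c on the left-hand side and no mark on
   the right-hand side. *)
have ii' : i = i'.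
  apply/eqP/negPn/negP => ii'; have := Ej i ilt.
  rewrite [RHS]plug_unmarked ?H' -?sE // => E'.
  have := H' i; rewrite -sE ilt ii' -E' => /(_ isT isT).
  by rewrite /unmarked marks_plug // => /(negP (branching_unmarked bc)).
subst i'; have [Ei ->] := IH _ vi' (Ej i ilt); split=> //; congr Node.
apply: (@eq_from_nth _ (Leaf 0%N)) => // j jlt; have [->//|ji] := eqVneq j i.
have := Ej j jlt; rewrite plug_unmarked; last exact: H.
by rewrite plug_unmarked //; apply: H'; rewrite -?sE.
Qed.

(* The trees in which some subtree is in C and contains all the marks. *)
Inductive up (C : tree -> Prop) : tree -> Prop :=
| up_here c : C c -> up C c
| up_step d us k : (k < size us)%N -> up C (nt us k) ->
    (forall j, (j < size us)%N -> j != k -> unmarked (nt us j)) -> up C (Node d us).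

Lemma up_plug C s : up C s <-> exists v c, [/\ marks v = [:: 1%N], C c & s = plug c v].
Proof.
split=> [|[v [c [nv Cc ->]]]].
  elim=> [c Cc|d us k klt _ [v [c [nv Cc E]]] H]; first by exists (Leaf 1%N), c.
  pose vs := set_nth (Leaf 0%N) us k v.
  have szv : size vs = size us by rewrite size_set_nth (maxn_idPr klt).
  have vsj j : nt vs j = if j == k then v else nt us j by rewrite nth_set_nth.
  exists (Node d vs), c; split=> //.
    rewrite (@marks_node1 _ _ k) ?szv // ?vsj ?eqxx // => j jlt jk.
    by rewrite vsj (negbTE jk) H.
  rewrite /=; congr Node; apply: (@eq_from_nth _ (Leaf 0%N)); rewrite ?size_map ?szv // => j jlt.
  rewrite (nth_map (Leaf 0%N)) ?szv // vsj; case: eqP => [->|/eqP jk] //.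
  by rewrite plug_unmarked ?H.
move: v nv; apply: single_ind => [|d ts i ilt vi IH H]; first exact: up_here.
rewrite /=; apply: (@up_step _ _ _ i); rewrite ?size_map // ?(nth_map (Leaf 0%N)) //.
by move=> j jlt ji; rewrite (nth_map (Leaf 0%N)) // plug_unmarked; apply: H.
Qed.

Lemma up_marks C s : up C s -> exists2 c, C c & marks s = marks c.
Proof. by move=> /up_plug[v [c [nv Cc ->]]]; exists c => //; apply: marks_plug. Qed.

Section Paths.
Variable P : forall n, {set lgraph n}.

Lemma good_swap t : good P (swap_tree t) = good P t.
Proof.
elim/tree_nind: t => // d ts IH /=; rewrite size_map !all_map; congr [&& _, _, _ & _].
- by case: d.
- apply: eq_all => u /=; rewrite root_type_swap -[RHS]no_clash_swap; congr no_clash; by case: d.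
- by apply: eq_in_all => _ /(nthP (Leaf 0%N))[i ilt <-] /=; apply: IH.
Qed.

Lemma locfin_single W : locfin nleaves (single_cls P W).
Proof. by apply: (@locfin_good P 1) => t [gt nt _]; split=> //; apply: marks_le; rewrite nt. Qed.

Lemma locfin_unmarked a : locfin nleaves (unmarked_cls P a).
Proof. by apply: (@locfin_good P 0) => t [gt /eqP nt _]; split=> //; apply: marks_le; rewrite nt. Qed.

Lemma single_gf_swap W : single_gf P (fun wd => W (map swap_type wd)) = single_gf P W.
Proof.
apply: fps_eqP => n /=; symmetry.
rewrite (@wsum_bij _ _ [set x | single_cls P (fun wd => W (map swap_type wd)) x /\ nleaves x = n]%classic
  _ swap_tree) //.
- by apply: eq_wsum => t _ /=; rewrite weight_swap.
- exact: locfin_single.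
- have H t : single_cls P W t /\ nleaves t = n <-> single_cls P (fun wd => W (map swap_type wd)) (swap_tree t)
      /\ nleaves (swap_tree t) = n.
    rewrite /single_cls /= good_swap /marks /nleaves leaves_swap path_types_swap -map_comp.
    by rewrite (eq_map swap_typeK) map_id.
  move=> t; split=> [/H Ht|[u Hu ->]]; first by exists (swap_tree t) => //; rewrite swap_treeK.
  by apply/H; rewrite swap_treeK.
- by move=> t u _ _ /(can_inj swap_treeK).
Qed.

Lemma unmarked_gf_swap a : unmarked_gf P (swap_type a) = unmarked_gf P a.
Proof.
apply: fps_eqP => n /=; symmetry.
rewrite (@wsum_bij _ _ [set x | unmarked_cls P (swap_type a) x /\ nleaves x = n]%classic
  _ swap_tree) //.
- by apply: eq_wsum => t _ /=; rewrite weight_swap.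
- exact: locfin_unmarked.
- have H t : unmarked_cls P a t /\ nleaves t = n <-> unmarked_cls P (swap_type a) (swap_tree t)
      /\ nleaves (swap_tree t) = n.
    by rewrite /unmarked_cls /= good_swap /unmarked /marks /nleaves leaves_swap root_type_swap no_clash_swap.
  move=> t; split=> [/H Ht|[u Hu ->]]; first by exists (swap_tree t) => //; rewrite swap_treeK.
  by apply/H; rewrite swap_treeK.
- by move=> t u _ _ /(can_inj swap_treeK).
Qed.

(** The index is shifted because the mark at the end of the path is not counted: it will be replaced
    by a tree with its own leaves. *)
Definition path_gf a r := Fps (fun n => coefs (single_gf P (path_ok a r)) n.+1).

Lemma zM_path a r : fps_z * path_gf a r = single_gf P (path_ok a r).
Proof. exact: zM_single. Qed.

Lemma path_gf_swap a r : path_gf (swap_type a) (swap_type r) = path_gf a r.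
Proof.
apply: fps_zI; rewrite !zM_path -single_gf_swap; apply: eq_gf => s.
by rewrite /single_cls /= path_ok_swap.
Qed.

(** Plugging creates a single new adjacency, between the parent of the mark and the root of c. *)
Lemma good_plug c v : marks v = [:: 1%N] ->
  good P (plug c v) <-> [/\ good P v, good P c & no_clash (root_type c) (last None (path_types 1 v))].
Proof.
move: v; apply: single_ind => [|d ts i ilt vi IH H].
  by rewrite /= nclC; split=> [gc|[]].
have lu j : (j < size ts)%N -> 1%N \in leaves (nt ts j) -> j = i.
  move=> jlt lj; apply/eqP/negPn/negP => ji; have /eqP := H j jlt ji.
  by move=> /(congr1 (fun s => 1%N \in s)); rewrite mem_filter /= lj.
rewrite (path_types_node d ilt (once_mem (marks1_once vi)) lu) [plug _ _]/= [last _ _]/=.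
have nE j : (j < size ts)%N -> nt (map (plug c) ts) j = if j == i then plug c (nt ts i) else nt ts j.
  move=> jlt; rewrite (nth_map (Leaf 0%N)) //; case: eqP => [->//|/eqP ji].
  by rewrite plug_unmarked // H.
(* The step from the child to its parent d. If the path in the child is empty, the root of c becomes
   adjacent to d itself; otherwise the root type of the child is unchanged by plugging. *)
have LE : (no_clash (dec_type d) (root_type (plug c (nt ts i))) && no_clash (root_type c) (last None (path_types 1 (nt ts i))))
   = (no_clash (dec_type d) (root_type (nt ts i)) && no_clash (root_type c) (last (dec_type d) (path_types 1 (nt ts i)))).
  rewrite root_type_plug // (root_type_path_types 1 (nt ts i)).
  have nclN x : no_clash x None by case: x.
  case: (path_types 1 (nt ts i)) => [|x wd] //.
  by rewrite [head _ _]/= [head None _]/= [last None _]/= [last (dec_type d) _]/= !nclN andbT nclC.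
split=> [/good_node|[/good_node[sz dg G] gc nc]].
  rewrite size_map => -[sz dg G]; have := G i ilt; rewrite nE // eqxx => -[n1 /IH[g1 gc n2]].
  have /andP[n3 n4] : no_clash (dec_type d) (root_type (nt ts i)) && no_clash (root_type c) (last (dec_type d) (path_types 1 (nt ts i))).
    by rewrite -LE n1.
  split=> //; apply/good_node; split=> // j jlt; have [->//|ji] := eqVneq j i.
  by have := G j jlt; rewrite nE // (negbTE ji).
have [n1 g1] := G i ilt.
have /andP[n3 n4] : no_clash (dec_type d) (root_type (plug c (nt ts i))) && no_clash (root_type c) (last None (path_types 1 (nt ts i))).
  by rewrite LE n1.
apply/good_node; rewrite size_map; split=> // j jlt; rewrite nE //; case: eqP => [ji|_]; last exact: G.
by split=> //; apply/IH.
Qed.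

(** By [plug_inj] a tree s factors uniquely into a path v and a branching tree c of C; the path has
    one leaf too many, whence the multiplication by z. *)
Lemma up_gf (C : set tree) a r : locfin nleaves [set c | C c /\ good P c]%classic ->
  (forall c, C c -> root_type c = r /\ branching c) ->
  gf weight nleaves [set s | [/\ up C s, good P s & no_clash a (root_type s)]]%classic =
  path_gf a r * gf weight nleaves [set c | C c /\ good P c]%classic.
Proof.
move=> finC Cr; apply: fps_zI; rewrite mulrA zM_path; apply: fps_eqP => -[|n]; rewrite coefs_zM.
  by rewrite coefsM big_ord1 single_gf0 mul0r.
apply: (wsumX_conv (g := fun p => plug p.2 p.1)) => //.
- exact: locfin_single.
- move=> s; split=> [[[us gs ns] sn]|[[v c] /= [[gv nv /andP[W1 W2]] [Cc gc] vc] ->]].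
    have [v [c [nv Cc sE]]] := (up_plug _ _).1 us; have [cr bc] := Cr c Cc.
    rewrite sE in gs ns sn; have /(good_plug c nv)[gv gc nc] := gs.
    exists (v, c) => //=; split=> //.
      by split=> //; rewrite /path_ok -cr -root_type_plug // ns.
    by have := nleaves_plug c v; rewrite once_marks1 // sn; lia.
  have [cr bc] := Cr c Cc; split; last first.
    by have := nleaves_plug c v; rewrite once_marks1 //; lia.
  split; first by apply/up_plug; exists v, c.
    by apply/good_plug => //; rewrite cr.
  by rewrite root_type_plug // cr.
- move=> [v c] [v' c'] /= [_ nv _] [Cc _] [_ nv' _] [Cc' _] E.
  have [_ bc] := Cr c Cc; have [_ bc'] := Cr c' Cc'.
  by have [-> ->] := plug_inj nv nv' bc bc' E.
- by move=> [v c] /= [_ nv _] _; rewrite weight_plug once_marks1.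
Qed.

End Paths.

(** * Trees rooted at the node corresponding to the root of tau *)

Section Occurrences.

Definition kseqs n k : seq (seq nat) :=
  [seq map val (tval t) | t <- enum [set t : k.-tuple 'I_n | uniq t]].

Lemma mem_kseqs n k ks : (ks \in kseqs n k) = [&& uniq ks, size ks == k & all (gtn n) ks].
Proof.
apply/mapP/and3P => [[t + ->]|[uks /eqP sz /allP lt]].
  rewrite mem_enum inE => ut; rewrite map_inj_uniq; last exact: val_inj.
  by split=> //; [rewrite size_map size_tuple | apply/allP => _ /mapP[i _ ->] /=].
have E : map val (pmap (insub : nat -> option 'I_n) ks) = ks.
  rewrite (pmap_filter (insubK _)) -[RHS]filter_predT; apply: eq_in_filter => i /lt /= ilt.
  by rewrite insubT.
have szt : size (pmap (insub : nat -> option 'I_n) ks) == k by rewrite -sz -{2}E size_map.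
exists (Tuple szt) => //; rewrite mem_enum inE /=.
by rewrite -(map_inj_uniq val_inj) E.
Qed.

Lemma uniq_kseqs n k : uniq (kseqs n k).
Proof.
rewrite map_inj_uniq ?enum_uniq // => t u /(inj_map val_inj); exact: val_inj.
Qed.

Lemma size_kseqs n k : size (kseqs n k) = n ^_ k.
Proof.
rewrite size_map -cardE -[n in RHS]card_ord -card_uniq_tuples; apply: eq_card => t.
by rewrite !inE (eq_all (a2 := predT)) ?all_predT.
Qed.

(** A partial injection onto the labels of G is the inverse of the list giving the vertex of H with
    each label. In list form it becomes the list of positions of the marked children. *)
Lemma OccE k n (G : lgraph k) (H : lgraph n) :
  Occ G H = count (fun ks => Gr (induced_graph H ks) == Gr G) (kseqs n k).
Proof.
pose cond (t : k.-tuple 'I_n) := [forall a, forall b, adj H (tnth t a) (tnth t b) == adj G a b].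
have condE (t : k.-tuple 'I_n) : uniq t -> (Gr (induced_graph H (map val t)) == Gr G) = cond t.
  move=> ut; have nE (a : 'I_k) : nth 0%N (map val t) a = tnth t a.
    by rewrite [in RHS](tnth_nth (tnth t a)) (nth_map (tnth t a)) ?size_tuple.
  have sz : size (map val t) = k by rewrite size_map size_tuple.
  apply/eqP/forallP => [/Gr_inj[_ E] a|E].
    apply/forallP => b; have := E a b; rewrite adjn_induced sz !ltn_ord !nE /= !adjnE.
    by move=> ->.
  apply: Gr_ext => // a b; rewrite adjn_induced sz => ak bk; rewrite ak bk /=.
  rewrite -[a]/(val (Ordinal ak)) -[b]/(val (Ordinal bk)) !nE !adjnE.
  by have /forallP/(_ (Ordinal bk))/eqP := E (Ordinal ak).
(* For a vertex outside t, [index] returns k, out of the range of ['I_k], and [insub] gives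
   [None]. *)
pose f (t : k.-tuple 'I_n) : {ffun 'I_n -> option 'I_k} := [ffun u => insub (index u t)].
have fP (t : k.-tuple 'I_n) u a : uniq t -> (f t u == Some a) = (tnth t a == u).
  move=> ut; rewrite ffunE; apply/eqP/eqP => [|<-].
    case: insubP => // b bk bE [<-]; rewrite (tnth_nth u) bE nth_index //.
    by rewrite -index_mem size_tuple.
  rewrite (tnth_nth (tnth t a)) index_uniq ?size_tuple //.
  by rewrite -[X in insub X]/(val a) valK.
rewrite /kseqs count_map -size_filter.
transitivity #|[set t : k.-tuple 'I_n | uniq t && cond t]|; last first.
  rewrite cardE; apply: perm_size; apply: uniq_perm => [||t]; [exact: enum_uniq | exact/filter_uniq/enum_uniq |].
  rewrite [RHS]mem_filter !mem_enum !inE /=; case ut: (uniq t); rewrite ?andbF ?andbT //=.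
  by rewrite condE.
rewrite -(@card_in_imset _ _ f); last first.
  move=> t t'; rewrite !inE => /andP[ut _] /andP[ut' _] E; apply: eq_from_tnth => a.
  by apply/eqP; rewrite eq_sym -fP // -E fP.
apply: eq_card => I; rewrite inE; apply/and3P/imsetP => [[/forallP inj /forallP onto /forallP adjI]|].
  have /fin_all_exists[u uE] : forall a, exists u, I u = Some a.
    by move=> a; have /existsP[u /eqP] := onto a; exists u.
  have injI v w : I v = I w -> I v != None -> v = w.
    move=> E nN; apply/eqP; have /forallP/(_ w) := inj v.
    by move/implyP; apply; rewrite nN andbT; apply/eqP.
  pose t := [tuple u a | a < k].
  have ut : uniq t.
    by rewrite map_inj_uniq ?enum_uniq // => a b E; have := uE a; rewrite E uE => -[].
  have tE a : tnth t a = u a by rewrite tnth_mktuple.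
  exists t.
    rewrite inE ut /=; apply/forallP => a; apply/forallP => b; rewrite !tE.
    by have /forallP/(_ (u b)) := adjI (u a); rewrite !uE.
  apply/ffunP => v; case E: (I v) => [a|].
    symmetry; apply/eqP; rewrite fP // tE; apply/eqP.
    by apply: injI; rewrite uE ?E.
  symmetry; case E': (f t v) => [a|] //; move/eqP: E'; rewrite fP // tE => /eqP vE.
  by rewrite -vE uE in E.
move=> [t]; rewrite inE => /andP[ut /forallP ct] ->; split.
- apply/forallP => v; apply/forallP => w; apply/implyP => /andP[/eqP E].
  case E': (f t v) => [a|] // _; move/eqP: (E'); rewrite fP // => /eqP <-.
  by move/eqP: E'; rewrite E fP.
- by apply/forallP => a; apply/existsP; exists (tnth t a); rewrite fP.
- apply/forallP => v; apply/forallP => w.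
  case E: (f t v) => [a|] //; case E': (f t w) => [b|] //.
  move/eqP: E; move/eqP: E'; rewrite !fP // => /eqP <- /eqP <-.
  by have /forallP := ct a.
Qed.

End Occurrences.

(** * Nodes with prescribed classes at some of their children *)

Section Slots.
Variable P : forall n, {set lgraph n}.
Variables (a : option bool) (Fs : seq (set tree)) (K : nat) (DK : nat -> seq (dec * seq nat)).
Local Notation k := (size Fs).
Local Notation F := (nth set0 Fs).
Hypothesis F_good : forall i s, (i < k)%N -> F i s ->
  [/\ good P s, no_clash a (root_type s), ~~ unmarked s & all (leq^~ K) (leaves s)].
Hypothesis F_disj : forall i j s, (i < k)%N -> (j < k)%N -> F i s -> F j s -> i = j.
Hypothesis k2 : (1 < k)%N.
Hypothesis DK_uniq : forall n, uniq (DK n).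
Hypothesis DKP : forall n d ks, (d, ks) \in DK n ->
  [/\ uniq ks, size ks = k, all (gtn n) ks, dec_type d = a & dgood P n d].

(** The child at the i-th position of [ks] is taken in the i-th prescribed class, all other children
    are unmarked; [DK n] lists the admissible decorations and positions for n children. *)
Definition slots n ks : seq (set tree) :=
  mkseq (fun j => if j \in ks then F (index j ks) else unmarked_cls P a) n.

Definition slot_cls : set tree :=
  [set s | exists d ks us, [/\ s = Node d us, (d, ks) \in DK (size us)
     & seqcls (slots (size us) ks) us]]%classic.

Let slot_good n ks j s : uniq ks -> size ks = k -> (j < n)%N -> nth set0 (slots n ks) j s ->
  [/\ good P s, no_clash a (root_type s) & all (leq^~ K) (leaves s)].
Proof.
move=> uks sz jlt; rewrite nth_mkseq //; case: ifP => [jk|_]; last first.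
  case=> gs /eqP us ns; split=> //; apply: (@marks_le K); by rewrite us.
by move/F_good; rewrite -sz index_mem => /(_ jk)[].
Qed.

Lemma slot_cls_good s : slot_cls s -> good P s /\ all (leq^~ K) (leaves s).
Proof.
move=> [d [ks [us [-> /DKP[uks sz lt da dg]]]]] /(seqclsP (Leaf 0%N)).
rewrite size_mkseq => -[_ H]; have {}H j (jlt : (j < size us)%N) := slot_good uks sz jlt (H j jlt).
split.
  apply/good_node; split=> //; last by move=> j /H[]; rewrite da.
  apply: (leq_trans k2); rewrite -sz -[size us](size_iota 0).
  by apply: uniq_leq_size => // j /(allP lt); rewrite mem_iota.
apply/allP => x /= /flatten_mapP[_ /(nthP (Leaf 0%N))[j jlt <-] xj].
by have [_ _ /allP] := H j jlt; apply.
Qed.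

Let locfin_slots n ks C : uniq ks -> size ks = k -> C \in slots n ks -> locfin nleaves C.
Proof.
move=> uks sz /(nthP set0)[j]; rewrite size_mkseq => jlt <-.
by apply: (@locfin_good P K) => s /(slot_good uks sz jlt)[].
Qed.

Lemma prod_slots n ks : uniq ks -> size ks = k -> all (gtn n) ks ->
  \prod_(C <- slots n ks) gf weight nleaves C =
  (\prod_(C <- Fs) gf weight nleaves C) * unmarked_gf P a ^+ (n - k).
Proof.
move=> uks sz /allP lt; pose rest := filter (fun j => j \notin ks) (iota 0 n).
have pk : perm_eq (iota 0 n) (ks ++ rest).
  apply: uniq_perm; first exact: iota_uniq.
    rewrite cat_uniq uks filter_uniq ?iota_uniq // andbT.
    by apply/hasPn => j; rewrite mem_filter => /andP[].
  move=> j; rewrite mem_cat mem_filter mem_iota /=; have := lt j.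
  by case: (j \in ks) => //= -> .
have szr : size rest = (n - k)%N.
  by have := perm_size pk; rewrite size_iota size_cat sz => ->; rewrite addKn.
rewrite big_map (perm_big _ pk) big_cat /=; congr (_ * _).
  rewrite (big_nth 0%N) sz [RHS](big_nth set0) !big_nat; apply: eq_bigr => i /andP[_ ilt].
  by rewrite mem_nth ?sz // index_uniq ?sz.
rewrite big_seq (eq_bigr (fun=> unmarked_gf P a)); last first.
  by move=> j; rewrite mem_filter => /andP[/negbTE ->].
by rewrite -big_seq big_const_seq count_predT szr -Monoid.iteropE.
Qed.

Lemma unmarked_gf0 : coefs (unmarked_gf P a) 0 = 0.
Proof.
rewrite /= (@wsum_seq _ [::]) ?big_nil // => s; split=> // -[[/good_arity_ok/leaves_gt0 + _ _]].
by rewrite /nleaves => /[swap] ->.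
Qed.

(** The prescribed classes are disjoint and contain no unmarked tree, so the children themselves
    tell the positions. *)
Lemma slots_inj n ks ks' us : uniq ks -> size ks = k -> all (gtn n) ks ->
  uniq ks' -> size ks' = k -> all (gtn n) ks' ->
  seqcls (slots n ks) us -> seqcls (slots n ks') us -> ks = ks'.
Proof.
move=> uk sk /allP lk uk' sk' lk' /(seqclsP (Leaf 0%N))[] + H /(seqclsP (Leaf 0%N))[] _.
rewrite !size_mkseq in H * => szu H'.
apply: (@eq_from_nth _ 0%N); rewrite ?sk ?sk' // => i ilt.
have jk : nth 0%N ks i \in ks by rewrite mem_nth ?sk.
have jn := lk _ jk; have := H _ jn; rewrite nth_mkseq // jk index_uniq ?sk // => Fi.
have := H' _ jn; rewrite nth_mkseq //; case: ifP => [jk'|_ [_ us0 _]].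
  move/(F_disj ilt) => /(_ _ Fi) E; rewrite [in RHS]E ?nth_index //.
  by rewrite -sk' index_mem.
by have [_ _] := F_good ilt Fi; rewrite us0.
Qed.

(** With j unmarked children among j + k, the root weighs 1/(j + k)! and there are
    [size (DK (j + k))] choices of decoration and positions. Summing over j yields a composition
    with the series of unmarked trees. *)
Lemma slots_gf : gf weight nleaves slot_cls =
  fps_comp (Fps (fun j => (size (DK (j + k)))%:R / (j + k)`!%:R)) (unmarked_gf P a)
  * \prod_(C <- Fs) gf weight nleaves C.
Proof.
apply: fps_eqP => m; rewrite mulrC (@coefs_mul_comp _ _ _ _ m.+1) ?unmarked_gf0 //.
set PF := \prod_(C <- Fs) _.
(* The root has at least k and, with m leaves, at most m children. The longer range up to k + m
   matches the truncation of the composition. *)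
pose r := [seq (n, dk) | n <- iota k m.+1, dk <- DK n].
pose B (i : nat * (dec * seq nat)) := [set us | seqcls (slots i.1 i.2.2) us
  /\ sumn (map nleaves us) = m]%classic.
rewrite [LHS]/= (@wsum_sigma _ _ _ r B _ (fun i us => Node i.2.1 us)).
- rewrite big_allpairs_dep.
  transitivity (\sum_(n <- iota k m.+1) (size (DK n))%:R / n`!%:R * coefs (PF * unmarked_gf P a ^+ (n - k)) m).
    apply: eq_bigr => n _; rewrite big_seq.
    rewrite (eq_bigr (fun=> n`!%:R^-1 * coefs (PF * unmarked_gf P a ^+ (n - k)) m)).
      rewrite -big_seq big_const_seq count_predT iter_addr_0 -mulrA.
      by rewrite -[LHS]mulr_natl.
    move=> [d ks] /DKP[uks sz lt _ _]; rewrite -(prod_slots uks sz lt).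
    rewrite -gf_seqcls; last by move=> C; apply: locfin_slots.
    rewrite mulrC [coefs _ _]/= -wsumMr; apply: eq_wsum => us [/(seqclsP (Leaf 0%N))[] + _ _].
    by rewrite size_mkseq -[weight _]/(weight (Node d us)) weightE => ->; rewrite mulrC.
  rewrite -[k in iota k]addn0 iotaDl big_map -[m.+1]subn0 -/(index_iota 0 m.+1) big_mkord.
  by apply: eq_bigr => j _; rewrite [coefs (Fps _) _]/= [(k + j)%N]addnC addnK.
- apply: allpairs_uniq_dep => [|n _|]; [exact: iota_uniq | exact: DK_uniq |].
  by move=> [n x] [n' x'] _ _ /= [-> ->].
- move=> _ /allpairsPdep[n [[d ks] [_ /DKP[uks sz _ _ _] ->]]].
  by apply: locfin_seqcls => C; apply: locfin_slots.
- move=> s; split=> [[[d [ks [us [-> dk sc]]]] sm]|].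
    exists (size us, (d, ks)), us; split=> //; last by rewrite /B /= -(nleaves_node d).
    have [uks sz lt _ _] := DKP dk.
    apply/allpairsPdep; exists (size us), (d, ks); split=> //.
    have [gs _] : good P (Node d us) /\ all (leq^~ K) (leaves (Node d us)).
      by apply: slot_cls_good; exists d, ks, us.
    rewrite mem_iota; apply/andP; split; last first.
      by rewrite (leq_ltn_trans (size_good gs)) // sm; lia.
    rewrite -sz -[size us](size_iota 0); apply: uniq_leq_size => // j /(allP lt).
    by rewrite mem_iota.
  move=> [_ [us [/allpairsPdep[n [[d ks] [_ dk ->]]] [/= sc sm] ->]]].
  have szu : size us = n by have /(seqclsP (Leaf 0%N))[] := sc; rewrite size_mkseq.
  by rewrite nleaves_node; split=> //; exists d, ks, us; rewrite szu.
- move=> _ _ us us' /allpairsPdep[n [[d ks] [_ dk ->]]] /allpairsPdep[n' [[d' ks'] [_ dk' ->]]].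
  move=> [/= sc _] [/= sc' _] [dE usE]; split=> //.
  have szu : size us = n by have /(seqclsP (Leaf 0%N))[] := sc; rewrite size_mkseq.
  have szu' : size us' = n' by have /(seqclsP (Leaf 0%N))[] := sc'; rewrite size_mkseq.
  have nn : n = n' by rewrite -szu usE.
  rewrite /= in dE; rewrite -nn in dk' sc'; rewrite -usE in sc'.
  have [uk sk lk _ _] := DKP dk; have [uk' sk' lk' _ _] := DKP dk'.
  by rewrite -nn -dE (slots_inj uk sk lk uk' sk' lk' sc sc').
Qed.

End Slots.

(** A linear node of tau may come from a prime node whose chosen children induce a complete or
    edgeless graph, so inside N decorations are compared as graphs. Outside N the sign is
    inherited. *)
Definition dec_match (inN : bool) (dt d : dec) (ks : seq nat) : Prop :=
  if inN then dec_type d = None /\ sel_dec ks d = Gr (dec_graph (size ks) dt) else d = dt.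

(* The trees without labels which induce tau, the set of nodes with a non-linear
   image being N, and whose root is the image of the root of tau; [up (core tau N)]
   consists of all those which induce tau with this set of nodes. *)
Fixpoint core (tau : tree) : pred (seq nat) -> tree -> Prop :=
  match tau with
  | Leaf m => fun _ s => s = Leaf m
  | Node dt taus => fun N s => exists d us ks,
      [/\ s = Node d us, dec_match (N [::]) dt d ks, uniq ks & size ks = size taus] /\
      [/\ all (gtn (size us)) ks,
          forall j, (j < size us)%N -> j \notin ks -> unmarked (nt us j)
        & forall i, (i < size taus)%N ->
            up (nth (fun _ _ => False) (map core taus) i (fun p => N (i :: p)))
               (nt us (nth 0%N ks i))]
  end.

Lemma coreE dt taus N s : core (Node dt taus) N s <-> exists d us ks,
  [/\ s = Node d us, dec_match (N [::]) dt d ks, uniq ks & size ks = size taus] /\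
  [/\ all (gtn (size us)) ks,
      forall j, (j < size us)%N -> j \notin ks -> unmarked (nt us j)
    & forall i, (i < size taus)%N ->
        up (core (nt taus i) (fun p => N (i :: p))) (nt us (nth 0%N ks i))].
Proof.
by split=> -[d [us [ks [A [B C D]]]]]; exists d, us, ks; split=> //; split=> // i ilt;
  have := D i ilt; rewrite (nth_map (Leaf 0%N)).
Qed.

(** A form of the hypotheses that passes to subtrees: labels are only distinct and nonzero, 0 being
    reserved for unmarked leaves, and N is a predicate on addresses. *)
Definition tau_ok (tau : tree) (N : pred (seq nat)) : Prop :=
  [/\ wf_nodes tau, uniq (leaves tau), 0%N \notin leaves tau
    & forall p, nonlinear_at tau p -> N p].

Lemma wf_arity_ok t : wf_nodes t -> arity_ok t.
Proof.
elim/tree_nind: t => // d ts IH /= /and4P[-> ar _ /allP wts] /=.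
apply/andP; split; first by case: d ar => //= n H /andP[].
by apply/allP => _ /(nthP (Leaf 0%N))[i ilt <-]; apply: IH => //; apply/wts/mem_nth.
Qed.

Lemma nonlinear_cons dt taus i p : (i < size taus)%N ->
  nonlinear_at (Node dt taus) (i :: p) = nonlinear_at (nt taus i) p.
Proof.
by move=> ilt; rewrite /nonlinear_at /dec_at /= onthE (nth_map (Leaf 0%N)).
Qed.

Lemma tau_ok_nth dt taus N i : tau_ok (Node dt taus) N -> (i < size taus)%N ->
  tau_ok (nt taus i) (fun p => N (i :: p)).
Proof.
move=> [wt ut zt nl] ilt; have rt : regular (Node dt taus) by rewrite /regular wf_arity_ok.
split.
- by case/and4P: wt => _ _ _ /allP; apply; apply: mem_nth.
- by case/andP: (regular_node rt ilt).
- by apply: contra zt; apply: mem_leaves_nth.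
- by move=> p; rewrite -(nonlinear_cons dt) //; apply: nl.
Qed.

Lemma tau_ok_lin dt taus N : tau_ok (Node dt taus) N -> ~~ N [::] -> exists b, dt = Lin b.
Proof.
case: dt => [b|n H] [_ _ _ nl] NN; first by exists b.
by move: NN; rewrite nl.
Qed.

(** The marks reveal which subtree of tau is induced, so distinct children of a node of tau lead to
    disjoint classes. *)
Lemma core_marks tau N s : tau_ok tau N -> core tau N s -> perm_eq (marks s) (leaves tau).
Proof.
elim/tree_nind: tau N s => [m|dt taus IH] N s ok.
  by move=> ->; case: ok => _ _ + _; rewrite /marks /= inE eq_sym => /negbTE ->.
move=> /coreE[d [us [ks [[-> _ uks szk] [/allP lt un upk]]]]]; rewrite marks_node.
pose rest := filter (fun j => j \notin ks) (iota 0 (size us)).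
have pk : perm_eq (iota 0 (size us)) (ks ++ rest).
  apply: uniq_perm; first exact: iota_uniq.
    rewrite cat_uniq uks filter_uniq ?iota_uniq // andbT.
    by apply/hasPn => j; rewrite mem_filter => /andP[].
  move=> j; rewrite mem_cat mem_filter mem_iota /=; have := lt j.
  by case: (j \in ks) => //= -> .
have usE : us = map (nt us) (iota 0 (size us)) by rewrite map_nth_iota0 // take_size.
apply: (@perm_trans _ (flatten (map marks (map (nt us) ks)))).
  rewrite {1}usE; apply: (@perm_trans _ (flatten (map marks (map (nt us) (ks ++ rest))))).
    by apply: perm_flatten; do 2 apply: perm_map.
  rewrite !map_cat flatten_cat.
  suff -> : flatten (map marks (map (nt us) rest)) = [::] by rewrite cats0.
  have : {subset rest <= rest} by [].
  elim: {1 3}rest => //= j r IHr sub.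
  have := sub j; rewrite inE eqxx => /(_ isT); rewrite mem_filter mem_iota => /andP[jk jlt].
  by have /eqP -> := un j jlt jk; apply: IHr => x xr; apply: sub; rewrite inE xr orbT.
rewrite -map_comp; apply: perm_flatten_nth; rewrite !size_map // szk => i ilt.
rewrite (nth_map 0%N) ?szk // (nth_map (Leaf 0%N)) //=.
have [c Cc ->] := up_marks (upk i ilt); apply: (IH i ilt _ _ _ Cc).
exact: tau_ok_nth ok ilt.
Qed.

Lemma up_core_marks tau N s : tau_ok tau N -> up (core tau N) s -> perm_eq (marks s) (leaves tau).
Proof. by move=> ok /up_marks[c Cc ->]; apply: core_marks Cc. Qed.

Lemma tau_leaves_gt0 tau N : tau_ok tau N -> (0 < size (leaves tau))%N.
Proof. by case=> /wf_arity_ok/leaves_gt0. Qed.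

Lemma up_core_unmarked tau N s : tau_ok tau N -> up (core tau N) s -> ~~ unmarked s.
Proof.
move=> ok us; rewrite /unmarked -size_eq0 (perm_size (up_core_marks ok us)) -lt0n.
exact: tau_leaves_gt0 ok.
Qed.

Lemma core_branching tau N s : tau_ok tau N -> core tau N s -> branching s.
Proof.
case: tau => [m|dt taus] ok.
  by move=> ->; case: ok => _ _ + _; rewrite /= inE eq_sym.
move=> /coreE[d [us [ks [[-> _ uks szk] [/allP lt un upk]]]]] /=.
have -> : us = map (nt us) (iota 0 (size us)) by rewrite map_nth_iota0 // take_size.
rewrite count_map -size_filter.
have t2 : (1 < size taus)%N by case: ok => /and4P[].
apply: (leq_trans t2); rewrite -szk; apply: uniq_leq_size => // j jk.
have jlt : (j < size us)%N := lt j jk.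
rewrite mem_filter mem_iota jlt /= andbT.
have ilt : (index j ks < size taus)%N by rewrite -szk index_mem.
rewrite -[j](nth_index 0%N jk).
exact: up_core_unmarked (tau_ok_nth ok ilt) (upk _ ilt).
Qed.

(** For an address in N the type is [None] even when the node of tau is linear, because its image is
    a prime node. *)
Definition core_type (tau : tree) (N : pred (seq nat)) : option bool :=
  if N [::] then None else root_type tau.

Lemma core_root_type tau N s : core tau N s -> root_type s = core_type tau N.
Proof.
case: tau => [m -> |dt taus /coreE[d [us [ks [[-> + _ _] _]]]]]; rewrite /core_type.
  by case: (N [::]).
by rewrite /dec_match; case: (N [::]) => [[/= -> _]|->].
Qed.

Section Cores.
Variable P : forall n, {set lgraph n}.

Definition core_gf tau N := gf weight nleaves [set c | core tau N c /\ good P c]%classic.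

Definition up_cls a tau N : set tree :=
  [set s | [/\ up (core tau N) s, good P s & no_clash a (root_type s)]]%classic.

Lemma up_core_le tau N s : tau_ok tau N -> up (core tau N) s ->
  all (leq^~ (\max_(x <- leaves tau) x)) (leaves s).
Proof.
move=> ok us; apply: marks_le; rewrite (perm_all _ (up_core_marks ok us)).
by apply/allP => x xt; apply: (@leq_bigmax_seq _ _ xpredT id).
Qed.

Lemma locfin_core tau N : tau_ok tau N -> locfin nleaves [set c | core tau N c /\ good P c]%classic.
Proof.
move=> ok; apply: (@locfin_good P (\max_(x <- leaves tau) x)) => c [Cc gc]; split=> //.
by apply: up_core_le ok _; apply: up_here.
Qed.

Lemma up_cls_gf a tau N : tau_ok tau N ->
  gf weight nleaves (up_cls a tau N) = path_gf P a (core_type tau N) * core_gf tau N.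
Proof.
move=> ok; apply: up_gf; first exact: locfin_core.
by move=> c Cc; split; [apply: core_root_type | apply: core_branching Cc].
Qed.

Lemma core_leaf_gf m N : core_gf (Leaf m) N = fps_z.
Proof.
apply: fps_eqP => n; rewrite /core_gf /=.
rewrite (@wsum_seq _ (if n == 1%N then [:: Leaf m] else [::])).
- by case: eqP => _; rewrite ?big_seq1 ?big_nil.
- by case: eqP.
- move=> s; case: eqP => [->|n1] /=; rewrite inE; split.
  + by move=> [[-> _] _].
  + by move=> /eqP ->.
  + by move=> [[-> _] /esym].
  + by [].
Qed.

(** The rule for nodes with prescribed classes, the i-th class being the trees that induce the i-th
    subtree of tau below a node of type [a]. Linear and prime images differ only in the count of
    decorations and positions. *)
Lemma core_node_gf dt taus N : tau_ok (Node dt taus) N ->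
  core_gf (Node dt taus) N =
  (if N [::] then fps_comp (OccP P (dec_graph (size taus) dt)) (unmarked_gf P None)
   else fps_exp (unmarked_gf P (dec_type dt)))
  * \prod_(i < size taus)
      (path_gf P (core_type (Node dt taus) N) (core_type (nt taus i) (fun p => N (nat_of_ord i :: p)))
       * core_gf (nt taus i) (fun p => N (nat_of_ord i :: p))).
Proof.
move=> ok; set a := core_type (Node dt taus) N; set k := size taus.
have k2 : (1 < k)%N by case: ok => /and4P[].
pose Fs : seq (set tree) := mkseq (fun i => up_cls a (nt taus i) (fun p => N (i :: p))) k.
have szF : size Fs = k by rewrite size_mkseq.
have FE i : (i < k)%N -> nth set0 Fs i = up_cls a (nt taus i) (fun p => N (i :: p)).
  by move=> ilt; rewrite nth_mkseq.
pose G := dec_graph k dt.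
(* For a prime image, the positions are the occurrences of the decoration in a graph of P; for a
   linear one, any list of k distinct ranks is allowed. *)
pose DK n : seq (dec * seq nat) :=
  if N [::] then [seq (Gr H, ks) | H <- enum (P n),
    ks <- [seq ks <- kseqs n k | Gr (induced_graph H ks) == Gr G]]
  else [seq (dt, ks) | ks <- kseqs n k].
have ltax i x : (i < k)%N -> x \in leaves (nt taus i) -> x \in leaves (Node dt taus).
  exact: mem_leaves_nth.
have F_good i s : (i < size Fs)%N -> nth set0 Fs i s ->
    [/\ good P s, no_clash a (root_type s), ~~ unmarked s & all (leq^~ (\max_(x <- leaves (Node dt taus)) x)) (leaves s)].
  rewrite szF => ilt; rewrite FE // => -[us gs ns]; have oki := tau_ok_nth ok ilt.
  split=> //; first exact: up_core_unmarked oki us.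
  apply: marks_le; rewrite (perm_all _ (up_core_marks oki us)).
  by apply/allP => x /(ltax _ _ ilt) xt; apply: (@leq_bigmax_seq _ _ xpredT id).
have F_disj i j s : (i < size Fs)%N -> (j < size Fs)%N -> nth set0 Fs i s -> nth set0 Fs j s -> i = j.
  rewrite szF => ilt jlt; rewrite !FE // => -[ui _ _] [uj _ _].
  have pi := up_core_marks (tau_ok_nth ok ilt) ui; have pj := up_core_marks (tau_ok_nth ok jlt) uj.
  have ti := tau_leaves_gt0 (tau_ok_nth ok ilt).
  have mi := mem_minleaf ti; have ut : uniq (flatten (map leaves taus)) by case: ok.
  apply: (@uniq_flatten_nth _ _ (minleaf (nt taus i)) _ _ ut); rewrite (nth_map (Leaf 0%N)) //.
  by rewrite -(perm_mem pj) (perm_mem pi).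
have DK_uniq n : uniq (DK n).
  rewrite /DK; case: ifP => _; last first.
    by rewrite map_inj_uniq ?uniq_kseqs // => ks ks' [].
  apply: allpairs_uniq_dep => [|H _|]; [exact: enum_uniq | exact/filter_uniq/uniq_kseqs |].
  move=> [H ks] [H' ks'] _ _ E; have /= E1 := congr1 fst E; have /= -> := congr1 snd E.
  have -> // : H = H'.
  by apply: lgraph_ext => u v; have [_ E'] := Gr_inj E1; rewrite -!adjnE.
have DKE n d ks : (d, ks) \in DK n <->
    [/\ [&& uniq ks, size ks == k & all (gtn n) ks], dec_match (N [::]) dt d ks & dgood P n d].
  rewrite /DK; case NE: (N [::]); rewrite /dec_match.
    split=> [/allpairsPdep[H [ks' [HP + [-> ->]]]]|[kk [dd se] dg]].
      rewrite mem_filter mem_kseqs => /andP[/eqP GE kk]; split=> //=.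
        case/and3P: kk => _ /eqP szk _; split=> //.
        exact: etrans GE (congr1 (fun m => Gr (dec_graph m dt)) (esym szk)).
      by rewrite eqxx -mem_enum.
    case: d dd se dg => // n' H _ se /andP[/eqP nE HP]; subst n'.
    apply/allpairsPdep; exists H, ks; split=> //; first by rewrite mem_enum.
    rewrite mem_filter mem_kseqs kk andbT; case/and3P: kk => _ /eqP szk _; apply/eqP.
    exact: etrans se (congr1 (fun m => Gr (dec_graph m dt)) szk).
  have [b dtE] := tau_ok_lin ok (negbT NE).
  split=> [/mapP[ks' + [-> ->]]|[kk -> _]]; first by rewrite mem_kseqs => kk; rewrite dtE.
  by apply/mapP; exists ks => //; rewrite mem_kseqs.
have aE d ks : dec_match (N [::]) dt d ks -> dec_type d = a.
  by rewrite /a /core_type /dec_match; case: (N [::]) => [[]|->].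
have DKP n d ks : (d, ks) \in DK n ->
    [/\ uniq ks, size ks = size Fs, all (gtn n) ks, dec_type d = a & dgood P n d].
  move=> /DKE[/and3P[uk /eqP sk lk] dm dg]; split=> //; first by rewrite szF.
  exact: aE dm.
have F2 : (1 < size Fs)%N by rewrite szF.
have SG := slots_gf F_good F_disj F2 DK_uniq DKP.
have -> : core_gf (Node dt taus) N = gf weight nleaves (slot_cls P a Fs DK).
  apply: eq_gf => s; split=> [[/coreE[d [us [ks [[-> dm uks szk] [lt un upk]]]]] /good_node[sz dg Gd]]|ss].
    exists d, ks, us; split=> //; first by apply/DKE; rewrite uks szk eqxx lt.
    apply/(seqclsP (Leaf 0%N)); rewrite size_mkseq; split=> // j jlt; rewrite nth_mkseq //.
    have [nj gj] := Gd j jlt; rewrite (aE _ _ dm) in nj.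
    case: ifP => [jk|/negbT jk]; last by split=> //; apply: un.
    have ilt : (index j ks < k)%N by rewrite /k -szk index_mem.
    by rewrite FE //; split=> //; have := upk _ ilt; rewrite nth_index.
  split; last by have [] := slot_cls_good F_good F2 DKP ss.
  have [d [ks [us [-> dk]]]] := ss; move=> /(seqclsP (Leaf 0%N)); rewrite size_mkseq => -[_ sc].
  have /DKE[_ dm _] := dk; have [uks szk lt _ _] := DKP _ _ _ dk; rewrite szF in szk.
  apply/coreE; exists d, us, ks; split=> //; split=> //.
    by move=> j jlt jk; have := sc j jlt; rewrite nth_mkseq // (negbTE jk) => -[].
  move=> i ilt; have jk : nth 0%N ks i \in ks by rewrite mem_nth ?szk.
  have jn : (nth 0%N ks i < size us)%N := allP lt _ jk.
  have := sc _ jn; rewrite nth_mkseq // jk index_uniq ?szk //.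
  by rewrite FE // => -[].
rewrite SG szF; congr (_ * _).
  have compE f g h : (forall n, coefs f n = coefs g n) -> fps_comp f h = fps_comp g h.
    by move=> fg; congr fps_comp; apply: fps_eqP.
  rewrite /a /core_type /DK; case: (N [::]).
    apply: compE => j /=; rewrite -mulr_suml; congr (_ / _).
    rewrite size_allpairs_dep sumnE big_map -natr_sum big_enum /=; congr (_ %:R).
    by apply: eq_bigr => H _; rewrite OccE size_filter.
  (* With n = j + k, the falling factorial counting the positions divided by n! is 1/j!, the
     coefficient of the exponential. *)
  apply: compE => j /=; rewrite size_map size_kseqs.
  have kj : (k <= j + k)%N by rewrite leq_addl.
  rewrite -(ffact_fact kj) addnK natrM invfM mulrA mulfV ?mul1r //.
  by rewrite pnatr_eq0 -lt0n ffact_gt0.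
rewrite big_map (_ : iota 0 k = index_iota 0 k) ?big_mkord; last by rewrite /index_iota subn0.
apply: eq_bigr => i _.
by rewrite -up_cls_gf //; apply: tau_ok_nth ok _.
Qed.

End Cores.

(** Undoes the identification of graphs on two vertices with signs, since the pair 0, 1 determines
    such a graph. *)
Lemma dec_graphK n (H : lgraph n) : dec_graph n (dec_of H) = H.
Proof.
rewrite /dec_of; case: eqP => [n2|_]; last first.
  apply: lgraph_ext => u v; rewrite adj_graph_of !adjnE [adj H v u]adj_sym orbb.
  by case: eqP => // ->; rewrite adj_irr.
subst n; apply: lgraph_ext => u v; rewrite -[RHS]adjnE.
have E : adj (dec_graph 2 (Lin (adjn H 0 1))) u v = (u != v) && adjn H 0 1.
  by rewrite /dec_graph; case: (adjn H 0 1); rewrite adj_graph_of ?orbb ?andbT ?andbF.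
rewrite E; have [->|] := eqVneq u v; first by rewrite adjn_irr.
case: u v {E} => [[|[|//]] ?] [[|[|//]] ?] //= _.
by rewrite adjn_sym.
Qed.

Lemma lin_graph_inj k b c : (1 < k)%N ->
  Gr (dec_graph k (Lin b)) = Gr (dec_graph k (Lin c)) -> b = c.
Proof.
move=> k2 /Gr_inj[_ /(_ 0%N 1%N)].
have E e : adjn (dec_graph k (Lin e)) 0 1 = e.
  rewrite -[0%N]/(val (Ordinal (ltnW k2))) -[1%N]/(val (Ordinal k2)) adjnE.
  by case: e; rewrite adj_graph_of.
by rewrite !E.
Qed.

Lemma leaves_graph_tree t : leaves (graph_tree t) = leaves t.
Proof.
elim/tree_nind: t => // d ts IH /=; rewrite -map_comp; congr flatten.
by apply/eq_in_map => _ /(nthP (Leaf 0%N))[i ilt <-] /=; apply: IH.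
Qed.

Lemma mem_inodes_cons d ts i p : (i :: p \in inodes (Node d ts)) =
  (i < size ts)%N && (p \in inodes (nt ts i)).
Proof.
rewrite /= inE /=; apply/flattenP/andP => [[_ /mapP[[s j] sj ->] /mapP[q qs [-> ->]]]|[ilt pi]].
  have /(nthP ([::], 0%N))[k] := sj; rewrite size_zip size_map size_iota minnn => klt.
  rewrite nth_zip ?size_map ?size_iota // (nth_map (Leaf 0%N)) // nth_iota // add0n => -[E1 E2].
  by rewrite -E2 klt; split=> //; rewrite E1.
exists [seq i :: q | q <- inodes (nt ts i)]; last exact: map_f.
apply/mapP; exists (inodes (nt ts i), i) => //.
have -> : (inodes (nt ts i), i) = nth ([::], 0%N) (zip (map inodes ts) (iota 0 (size ts))) i.
  by rewrite nth_zip ?size_map ?size_iota // (nth_map (Leaf 0%N)) // nth_iota.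
by rewrite mem_nth // size_zip size_map size_iota minnn.
Qed.

Lemma mem_kept us k u : ((k, u) \in kept us) = (k < size us)%N && (nth None us k == Some u).
Proof.
rewrite /kept mem_sort mem_pmap; apply/mapP/andP => [[[j o] jo]|[klt /eqP E]].
  case: o jo => // v jv [-> ->].
  have /(nthP (0%N, None))[i] := jv; rewrite size_zip size_iota minnn => ilt.
  by rewrite nth_zip ?size_iota // nth_iota // add0n => -[<- ->].
exists (k, Some u) => //.
have -> : (k, Some u) = nth (0%N, None) (zip (iota 0 (size us)) us) k.
  by rewrite nth_zip ?size_iota // nth_iota // E.
by rewrite mem_nth // size_zip size_iota minnn.
Qed.

Lemma uniq_kept us : uniq (unzip1 (kept us)).
Proof.
rewrite /kept /unzip1 (perm_uniq (perm_map _ (permEl (perm_sort _ _)))).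
apply: (@subseq_uniq _ _ (iota 0 (size us))); last exact: iota_uniq.
elim: us 0%N => //= o us IH m; case: o => [u|] /=; first by rewrite eqxx.
by apply: subseq_trans (IH m.+1) (subseq_cons _ _).
Qed.

(** Minimal leaves strictly increase along [vs], so sorting the same pairs leaves no choice. *)
Lemma kept_zip us ks (vs : seq tree) : uniq ks -> size ks = size vs ->
  (forall k u, (k, u) \in zip ks vs <-> (k < size us)%N /\ nth None us k = Some u) ->
  sorted (relpre minleaf ltn) vs -> kept us = zip ks vs.
Proof.
move=> uks sz memE sv.
have pz : perm_eq (kept us) (zip ks vs).
  apply: uniq_perm.
  - by apply: (@map_uniq _ _ fst); apply: uniq_kept.
  - by apply: (@map_uniq _ _ fst); rewrite -/(unzip1 _) unzip1_zip ?sz.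
  - move=> [k u]; rewrite mem_kept; apply/andP/idP => [[klt /eqP E]|/memE[klt ->]]; last by [].
    exact/memE.
have sz' : sorted (relpre (fun a : nat * tree => minleaf a.2) ltn) (zip ks vs).
  by rewrite -(@sorted_map _ _ snd (relpre minleaf ltn)) -/(unzip2 _) unzip2_zip ?sz.
apply: (sorted_key_eq pz _ sz').
rewrite -sorted_map ltn_sorted_uniq_leq in sz'; have /andP[uz _] := sz'.
rewrite -sorted_map ltn_sorted_uniq_leq (perm_uniq (perm_map _ pz)) uz /= sorted_map.
by apply: sort_sorted => a b; apply: leq_total.
Qed.

Lemma up_leaf (C : tree -> Prop) m : up C (Leaf m) -> C (Leaf m).
Proof. by move=> H; inversion H. Qed.

Lemma up_nodeE (C : tree -> Prop) d us : up C (Node d us) -> C (Node d us) \/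
  exists k, [/\ (k < size us)%N, up C (nt us k)
    & forall j, (j < size us)%N -> j != k -> unmarked (nt us j)].
Proof. by move=> H; inversion H; [left | right; exists k]. Qed.

(** * Induced subtrees *)

Section Link.
Variable J : {fmap nat -> nat}.
Hypothesis J0 : forall l, J.[? l]%fmap <> Some 0%N.

Definition mark (I : {fmap nat -> nat}) (l : nat) : nat := odflt 0%N I.[? l]%fmap.

Local Notation ind := (induced_subtree J).

Lemma ind_one d ts k u : kept (map ind ts) = [:: (k, u)] -> ind (Node d ts) = Some u.
Proof. by move=> /= ->. Qed.

Lemma ind_many d ts : (1 < size (kept (map ind ts)))%N ->
  ind (Node d ts) = Some (Node (induced_dec d (unzip1 (kept (map ind ts))))
                               (unzip2 (kept (map ind ts)))).
Proof. by rewrite /=; case: kept => [|[? ?] [|? ?]]. Qed.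

Lemma ind_none d ts : kept (map ind ts) = [::] -> ind (Node d ts) = None.
Proof. by move=> /= ->. Qed.

Lemma nth_phi ts k q : (k < size ts)%N ->
  nth (fun=> [::]) (map (phi J) ts) k q = phi J (nt ts k) q.
Proof. by move=> klt; rewrite (nth_map (Leaf 0%N)). Qed.

Lemma phi_one d ts k u p : kept (map ind ts) = [:: (k, u)] -> (k < size ts)%N ->
  phi J (Node d ts) p = k :: phi J (nt ts k) p.
Proof. by move=> E klt; rewrite /= E /= nth_phi. Qed.

Lemma phi_many_nil d ts : (1 < size (kept (map ind ts)))%N -> phi J (Node d ts) [::] = [::].
Proof. by rewrite /=; case: kept => [|[? ?] [|? ?]]. Qed.

Lemma phi_many_cons d ts j p : (1 < size (kept (map ind ts)))%N ->
  (nth 0%N (unzip1 (kept (map ind ts))) j < size ts)%N ->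
  phi J (Node d ts) (j :: p) = nth 0%N (unzip1 (kept (map ind ts))) j ::
     phi J (nt ts (nth 0%N (unzip1 (kept (map ind ts))) j)) p.
Proof.
move=> k2 jlt; rewrite -nth_phi //.
by move: k2 {jlt}; rewrite /=; case: kept => [|[? ?] [|? ?]].
Qed.

Lemma nth_ind ts k : (k < size ts)%N -> nth None (map ind ts) k = ind (nt ts k).
Proof. by move=> klt; rewrite (nth_map (Leaf 0%N)). Qed.

Lemma mem_kept_ind ts k u : ((k, u) \in kept (map ind ts)) = (k < size ts)%N && (ind (nt ts k) == Some u).
Proof.
rewrite mem_kept size_map; case: ltnP => //= klt.
by rewrite nth_ind.
Qed.

Lemma unmarked_nodeE d ts : unmarked (Node d ts) <-> forall i, (i < size ts)%N -> unmarked (nt ts i).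
Proof.
rewrite /unmarked marks_node; split=> [/eqP E i ilt|H].
  have [/eqP//|] := eqVneq (marks (nt ts i)) [::]; rewrite -size_eq0 -lt0n -has_predT => /hasP[x xi _].
  have : x \in flatten (map marks ts) by apply/flatten_mapP; exists (nt ts i) => //; apply: mem_nth.
  by rewrite E.
elim: ts H => //= t ts IH H; have /eqP -> := H 0%N isT; apply: IH => i; exact: (H i.+1).
Qed.

Lemma ind_noneE t : ind t = None <-> unmarked (map_leaves (mark J) t).
Proof.
elim/tree_nind: t => [l|d ts IH].
  rewrite /= /unmarked /marks /= /mark; have := @J0 l; case: (J.[? l]%fmap) => [m|] m0 /=; last by split.
  by have -> : m != 0%N by apply/eqP => mE; rewrite mE in m0.
split=> [E|].
  apply/unmarked_nodeE => i; rewrite size_map => ilt; rewrite (nth_map (Leaf 0%N)) //.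
  apply/IH => //; case Ei: (ind (nt ts i)) => [u|] //.
  have iK : (i, u) \in kept (map ind ts) by rewrite mem_kept_ind ilt Ei eqxx.
  by move: E iK => /=; case: kept => [|[? ?] [|? ?]].
move=> /unmarked_nodeE; rewrite size_map => H; apply: ind_none.
case Ek: (kept (map ind ts)) => [|[k u] r] //.
have := mem_head (k, u) r; rewrite -Ek mem_kept_ind => /andP[klt].
by have := H k klt; rewrite (nth_map (Leaf 0%N)) // => /(IH k klt) ->.
Qed.

(** The condition defining [T_marked], for a predicate on addresses instead of a finite set, so that
    it can be restricted to subtrees. *)
Definition embeds tau (N : pred (seq nat)) t := exists u, [/\ ind t = Some u,
  graph_tree u = graph_tree tau
  & forall p, p \in inodes tau -> nonlinear_at t (phi J t p) = N p].


(** The cases are the number of children containing marks. With none, both sides fail; with one,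
    both descend to this child; with at least two, the root corresponds to the root of tau and the
    children are compared one by one. *)
Lemma embedsP tau N t : tau_ok tau N ->
  embeds tau N t <-> up (core tau N) (map_leaves (mark J) t).
Proof.
elim/tree_nind: t tau N => [l|d ts IH] tau N ok.
  rewrite /embeds /= /mark; have := @J0 l; case: (J.[? l]%fmap) => [m|] //= m0; last first.
    split=> [[u []]//|]; move/(up_core_unmarked ok); by rewrite /unmarked /marks.
  split=> [[u [[<-] E _]]|].
    by case: tau ok E => //= m' _ [->]; apply: up_here.
  move=> /up_leaf; case: tau ok => [m'|dt taus] ok /=.
    by move=> [->]; exists (Leaf m').
  by move=> [? [? [? [[]]]]].
set K := kept (map ind ts).
have Kn k u : ((k, u) \in K) = (k < size ts)%N && (ind (nt ts k) == Some u) by apply: mem_kept_ind.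
have tmj j : (j < size ts)%N -> nt (map (map_leaves (mark J)) ts) j = map_leaves (mark J) (nt ts j).
  by move=> jlt; rewrite (nth_map (Leaf 0%N)).
have Kunm j : (j < size ts)%N -> j \notin unzip1 K -> unmarked (map_leaves (mark J) (nt ts j)).
  move=> jlt jK; apply/ind_noneE; case E: (ind (nt ts j)) => [u|] //.
  by case/negP: jK; apply/mapP; exists (j, u); rewrite ?Kn ?jlt ?E ?eqxx.
have [K0|K1|K2] := ltngtP (size K) 1%N.
- have {}K0 : K = [::] by apply: size0nil; move: K0; rewrite ltnS leqn0 => /eqP.
  split=> [[u []]|]; first by rewrite ind_none.
  move=> /(up_core_unmarked ok)/negP[]; apply/unmarked_nodeE => i; rewrite size_map => ilt.
  by rewrite tmj //; apply: Kunm => //; rewrite K0.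
- have uK : uniq (unzip1 K) := uniq_kept _.
  have szK : (1 < size (unzip1 K))%N by rewrite size_map.
  have Klt i : (i < size K)%N -> (nth 0%N (unzip1 K) i < size ts)%N /\
      ind (nt ts (nth 0%N (unzip1 K) i)) = Some (nt (unzip2 K) i).
    move=> ilt; have := mem_nth (0%N, Leaf 0%N) ilt.
    case E: (nth _ K i) => [k u]; rewrite Kn => /andP[klt /eqP iu].
    by rewrite !(nth_map (0%N, Leaf 0%N)) // E.
  (* Two children contain marks, so the marks do not all lie below a single child and [up] cannot go
     down. *)
  have upE : up (core tau N) (map_leaves (mark J) (Node d ts)) <-> core tau N (map_leaves (mark J) (Node d ts)).
    split; last exact: up_here.
    move=> /up_nodeE[//|[k [klt _ un]]]; exfalso; rewrite size_map in klt un.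
    have [j [jlt jk jm]] : exists j, [/\ (j < size ts)%N, j != k & ~~ unmarked (map_leaves (mark J) (nt ts j))].
      have /orP[E|E] : (nth 0%N (unzip1 K) 0 != k) || (nth 0%N (unzip1 K) 1 != k).
        rewrite -negb_and; apply/andP => -[/eqP E0 /eqP E1].
        have : (0%N == 1%N) by rewrite -(nth_uniq 0%N (s := unzip1 K)) ?E0 ?E1 // ltnW.
        by [].
      + have [lt iE] := Klt 0%N (ltnW K1); exists (nth 0%N (unzip1 K) 0); split=> //.
        by apply/negP => /ind_noneE; rewrite iE.
      + have [lt iE] := Klt 1%N K1; exists (nth 0%N (unzip1 K) 1); split=> //.
        by apply/negP => /ind_noneE; rewrite iE.
    by case/negP: jm; rewrite -tmj //; apply: un.
  split=> [[u [iE gE nE]]|].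
    apply/upE; move: iE; rewrite ind_many // => -[uE]; subst u.
    case: tau ok gE nE {upE} => [m|dt taus] ok gE nE; first by [].
    have szt : size K = size taus.
      by have := congr1 (fun t => if t is Node _ s then size s else 0%N) gE; rewrite /= !size_map.
    have gi i : (i < size taus)%N -> graph_tree (nt (unzip2 K) i) = graph_tree (nt taus i).
      move=> ilt; have := congr1 (fun t => if t is Node _ s then nt s i else Leaf 0%N) gE.
      by rewrite /= !(nth_map (Leaf 0%N)) // size_map szt.
    have gd : Gr (dec_graph (size (unzip2 K)) (induced_dec d (unzip1 K))) = Gr (dec_graph (size taus) dt).
      exact: (congr1 (fun t => if t is Node e _ then e else Lin true) gE).
    (* The root of tau is mapped to this node, so membership of the empty address tells whether d is
       a graph. *)
    have n0 : N [::] = (dec_type d == None).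
      by rewrite -(nE [::]) // phi_many_nil //; case: (d).
    apply/coreE; exists d, (map (map_leaves (mark J)) ts), (unzip1 K); split; split=> //.
    + rewrite /dec_match n0; case: d {IH nE gE} gd n0 => [b|n H] /= gd n0; last first.
        split=> //; rewrite -[LHS]/(Gr (induced_graph H (unzip1 K))).
        rewrite -(dec_graphK (induced_graph H (unzip1 K))).
        have ks2 : size (unzip2 K) = size (unzip1 K) by rewrite !size_map.
        have ks1 : size taus = size (unzip1 K) by rewrite size_map.
        rewrite -(congr1 (fun m => Gr (dec_graph m (dec_of (induced_graph H (unzip1 K))))) ks2) gd.
        exact: (congr1 (fun m => Gr (dec_graph m dt)) ks1).
      have [c dtE] := tau_ok_lin ok (negbT n0).
      rewrite dtE in gd *; congr Lin; apply: (@lin_graph_inj (size taus)); first by rewrite -szt.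
      rewrite -gd; have ks2 : size taus = size (unzip2 K) by rewrite size_map.
      exact: (congr1 (fun m => Gr (dec_graph m (Lin b))) ks2).
    + by rewrite size_map.
    + apply/allP => k /(nthP 0%N)[i].
      rewrite (_ : size (unzip1 K) = size K) ?size_map // => ilt <-.
      by have [] := Klt i ilt.
    + by move=> j; rewrite size_map => jlt; rewrite tmj //; apply: Kunm.
    + move=> i ilt; have [kl ki] : (nth 0%N (unzip1 K) i < size ts)%N /\
        ind (nt ts (nth 0%N (unzip1 K) i)) = Some (nt (unzip2 K) i) by apply: Klt; rewrite szt.
      rewrite tmj //; apply/IH => //; first exact: tau_ok_nth ok ilt.
      exists (nt (unzip2 K) i); split=> //; first exact: gi.
      move=> p pi; rewrite -nE; last by rewrite mem_inodes_cons ilt.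
      by rewrite phi_many_cons // nonlinear_cons.
  move=> /upE; case: tau ok {upE} => [m|dt taus] ok //.
  move=> /coreE[d' [us [ks [[[dE <-] + uks szk] [/allP lt un upk]]]]]; rewrite -{}dE => dm.
  rewrite size_map in lt un.
  have kl i : (i < size taus)%N -> (nth 0%N ks i < size ts)%N.
    by move=> ilt; apply: lt; rewrite mem_nth ?szk.
  have em i : (i < size taus)%N -> embeds (nt taus i) (fun p => N (i :: p)) (nt ts (nth 0%N ks i)).
    move=> ilt; apply/IH; [exact: kl | exact: tau_ok_nth ok ilt |].
    by rewrite -tmj ?kl //; apply: upk.
  pose vs := map (fun k => odflt (Leaf 0%N) (ind (nt ts k))) ks.
  have szv : size vs = size taus by rewrite size_map.
  have vsE i : (i < size taus)%N -> ind (nt ts (nth 0%N ks i)) = Some (nt vs i) /\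
      graph_tree (nt vs i) = graph_tree (nt taus i).
    by move=> ilt; have [u [uE uG _]] := em i ilt; rewrite (nth_map 0%N) ?szk // uE.
  clearbody vs.
  (* The trees induced in the children have the leaves of the subtrees of tau, so they are already
     in the order in which [kept] sorts them. *)
  have vsm i : (i < size taus)%N -> minleaf (nt vs i) = minleaf (nt taus i).
    move=> ilt; apply: perm_minleaf; rewrite -leaves_graph_tree -[leaves (nt taus i)]leaves_graph_tree.
    by rewrite (vsE i ilt).2.
  have KE : K = zip ks vs.
    apply: kept_zip => //; first by rewrite szk.
    - move=> k u; rewrite size_map; split=> [/(nthP (0%N, Leaf 0%N))[i]|[klt]].
        rewrite size_zip szk szv minnn => ilt; rewrite nth_zip ?szk // => -[<- <-].
        by rewrite kl // nth_ind ?kl // (vsE i ilt).1.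
      rewrite nth_ind // => iE.
      have kk : k \in ks.
        apply/negP => /negP kk; have := un k klt kk; rewrite tmj //.
        by move=> /ind_noneE; rewrite iE.
      have ilt : (index k ks < size taus)%N by rewrite -szk index_mem.
      have [E _] := vsE _ ilt; rewrite nth_index // iE in E.
      apply/(nthP (0%N, Leaf 0%N)); exists (index k ks).
        by rewrite size_zip szk szv minnn.
      by rewrite nth_zip ?szk ?szv // nth_index //; case: E => <-.
    - rewrite -sorted_map; have -> : map minleaf vs = map minleaf taus.
        apply: (@eq_from_nth _ 0%N) => [|i]; rewrite !size_map szv // => ilt.
        by rewrite (nth_map (Leaf 0%N)) ?szv // vsm // (nth_map (Leaf 0%N)).
      by rewrite sorted_map; case: ok => /and4P[].
  have u1 : unzip1 K = ks by rewrite KE unzip1_zip // szk szv.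
  have u2 : unzip2 K = vs by rewrite KE unzip2_zip // szk szv.
  exists (Node (induced_dec d ks) vs); rewrite ind_many // -/K u1 u2; split=> //.
    rewrite /=; congr Node; last first.
      apply: (@eq_from_nth _ (Leaf 0%N)) => [|i]; rewrite !size_map szv // => ilt.
      by rewrite (nth_map (Leaf 0%N)) ?szv // (vsE i ilt).2 (nth_map (Leaf 0%N)).
    have vk : size vs = size ks by rewrite szv szk.
    rewrite -[RHS](congr1 (fun m => Gr (dec_graph m dt)) szk).
    rewrite [LHS](congr1 (fun m => Gr (dec_graph m (induced_dec d ks))) vk).
    move: dm; rewrite /dec_match; have [NE|NE] := boolP (N [::]); [case | move=> ->].
      by case: d {IH} => // n H _ /= <-; rewrite dec_graphK.
    by have [b ->] := tau_ok_lin ok NE.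
  move=> [|i p] pin.
    rewrite phi_many_nil //; move: dm; rewrite /dec_match; have [NE|NE] := boolP (N [::]); [case | move=> ->].
      by case: d {IH}.
    by have [b ->] := tau_ok_lin ok NE.
  move: pin; rewrite mem_inodes_cons => /andP[ilt pin].
  rewrite phi_many_cons -/K ?u1 ?kl // nonlinear_cons ?kl //.
  by have [u [_ _ ->]] := em i ilt.
(* A node with one child containing marks disappears from the induced subtree, as a step of the path
   above the core. *)
- have [[k u] KE] : exists x, K = [:: x] by case: (K) K2 => [|x [|y r]] //= _; exists x.
  have /andP[klt /eqP iE] : (k < size ts)%N && (ind (nt ts k) == Some u).
    by rewrite -Kn KE mem_head.
  have un j : (j < size ts)%N -> j != k -> unmarked (map_leaves (mark J) (nt ts j)).
    by move=> jlt jk; apply: Kunm => //; rewrite KE inE.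
  have mk : ~~ unmarked (map_leaves (mark J) (nt ts k)) by apply/negP => /ind_noneE; rewrite iE.
  have EE : embeds tau N (Node d ts) <-> embeds tau N (nt ts k).
    rewrite /embeds (ind_one d KE) iE.
    by split=> -[v [vE vG vN]]; exists v; split=> // p /vN; rewrite (phi_one d p KE) // nonlinear_cons.
  have IHk := IH k klt tau N ok.
  split=> [/EE/IHk H|H].
    apply: (@up_step _ _ _ k); rewrite ?size_map //; first by rewrite tmj.
    by move=> j jlt jk; rewrite tmj //; apply: un.
  apply/EE/IHk; move: H.
  move=> /up_nodeE[/(core_branching ok)|[k' [k'lt uk un']]].
    rewrite /branching ltnNge => /negP[]; apply: (@count_le1 _ _ (Leaf 0%N) _ k) => j.
    by rewrite size_map => jlt jk; rewrite negbK tmj //; apply: un.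
  rewrite size_map in k'lt un'; have [kk|kk] := eqVneq k k'; first by rewrite -tmj // kk.
  by case/negP: mk; rewrite -tmj //; apply: un'.
Qed.

End Link.

Lemma unmarked_reorders t0 t : t \in reorders t0 -> unmarked t0 -> unmarked t.
Proof. by move=> /marks_reorders/perm_size E; rewrite /unmarked -!size_eq0 E. Qed.

(** Which children are unmarked does not depend on their order; the list of positions is transported
    by the inverse permutation, and the selected graph stays the same. *)
Lemma up_core_reorders tau N t0 t : t \in reorders t0 -> tau_ok tau N ->
  up (core tau N) t0 -> up (core tau N) t.
Proof.
move=> tO; move: t0 t tO tau N; apply: reorders_ind => // d ts us ks pks sz usO IH tau N ok.
have szk : size ks = size ts by rewrite (perm_size pks) size_iota.
have uk : uniq ks by rewrite (perm_uniq pks) iota_uniq.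
have mk j : (j \in ks) = (j < size ts)%N by rewrite (perm_mem pks) mem_iota.
have nk j : (j < size ks)%N -> (nth 0%N ks j < size ts)%N by move=> jlt; rewrite -mk mem_nth.
have nm j : (j < size ks)%N -> nt (map (nt us) ks) j = nt us (nth 0%N ks j).
  by move=> jlt; rewrite (nth_map 0%N).
move=> /up_nodeE[Ct|[k [klt uk' un]]]; last first.
  have ilt : (index k ks < size ks)%N by rewrite index_mem mk.
  apply: (@up_step _ _ _ (index k ks)); rewrite ?size_map //.
    by rewrite nm // nth_index ?mk //; apply: IH.
  move=> j jlt jk; rewrite nm //; apply: (unmarked_reorders (usO _ (nk _ jlt))); apply: un; first exact: nk.
  by apply: contra jk => /eqP <-; rewrite index_uniq.
apply: up_here; case: tau ok Ct => [//|dt taus] ok.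
move=> /coreE[d' [ts' [ks0 [[[<- <-] dm uks0 szk0] [/allP lt un upk]]]]].
have ixlt j : j \in ks0 -> (index j ks < size ks)%N by move=> /lt jlt; rewrite index_mem mk.
have ixK : map (nth 0%N ks) (map (index^~ ks) ks0) = ks0.
  by rewrite -map_comp -[RHS]map_id; apply/eq_in_map => j /lt jlt /=; rewrite nth_index // mk.
(* The child of old rank j is now at position [index j ks], and by [ixK] selecting these positions
   after [ks] is selecting [ks0]. *)
apply/coreE; exists (sel_dec ks d), (map (nt us) ks), (map (index^~ ks) ks0).
rewrite !size_map; split; split=> //.
- move: dm; rewrite /dec_match; have [NE|NE] := boolP (N [::]); last first.
    by move=> ->; have [b ->] := tau_ok_lin ok NE.
  rewrite dec_type_sel sel_dec_comp ?ixK; last first.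
    by apply/allP => _ /mapP[j jk ->]; apply: ixlt.
  by move=> [-> ->]; rewrite size_map.
- by rewrite (@map_uniq _ _ (nth 0%N ks)) // ixK.
- by apply/allP => _ /mapP[j jk ->]; apply: ixlt.
- move=> j jlt jk; rewrite nm //; apply: (unmarked_reorders (usO _ (nk _ jlt))); apply: un; first exact: nk.
  by apply: contra jk => jk; apply/mapP; exists (nth 0%N ks j) => //; rewrite index_uniq.
- move=> i ilt; have jk : nth 0%N ks0 i \in ks0 by rewrite mem_nth ?szk0.
  have -> : nth 0%N (map (index^~ ks) ks0) i = index (nth 0%N ks0 i) ks.
    by rewrite (nth_map 0%N) ?szk0.
  have ji : (nth 0%N ks0 i < size ts)%N := lt _ jk.
  rewrite nm ?ixlt // nth_index ?mk //.
  apply: IH; [exact: lt | exact: tau_ok_nth ok ilt | exact: upk].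
Qed.

(** Serves to show that a marking inducing tau never takes the value 0, which codes the absence of a
    mark. *)
Lemma ind_mem (J : {fmap nat -> nat}) t l m : l \in leaves t -> J.[? l]%fmap = Some m ->
  exists2 u, induced_subtree J t = Some u & m \in leaves u.
Proof.
elim/tree_nind: t => [l'|d ts IH].
  by rewrite inE => /eqP <- /= ->; exists (Leaf m); rewrite ?mem_head.
move=> /flatten_mapP[_ /(nthP (Leaf 0%N))[i ilt <-] li] Jl.
have [u uE mu] := IH i ilt li Jl.
have uK : (i, u) \in kept (map (induced_subtree J) ts).
  by rewrite mem_kept_ind ilt uE eqxx.
have [K2|] := ltnP 1 (size (kept (map (induced_subtree J) ts))).
  rewrite ind_many //; eexists; first by [].
  by apply/flatten_mapP; exists u => //; apply/mapP; exists (i, u).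
case E: (kept _) uK => [|[k v] [|]] //; rewrite inE => /eqP[_ uv] _.
by exists u => //; rewrite (ind_one d E) uv.
Qed.

Lemma uniq_filter_nth (ms : seq nat) i j : uniq (filter (predC1 0%N) ms) ->
  nth 0%N ms i != 0%N -> nth 0%N ms i = nth 0%N ms j -> i = j.
Proof.
have mem_f s k : nth 0%N s k != 0%N -> nth 0%N s k \in filter (predC1 0%N) s.
  move=> k0; rewrite mem_filter /= k0 mem_nth //.
  by have [//|sk] := ltnP k (size s); rewrite nth_default in k0.
elim: ms i j => [|m ms IH] [|i] [|j] //=.
- by case: eqP => //= m0 /andP[mm _] _ E; case/negP: mm; rewrite {1}E mem_f // -E; apply/eqP.
- by move=> + i0 E; rewrite -E i0 /= mem_f.
- move=> u i0 E; congr S; apply: IH => //; move: u; case: ifP => //= _ /andP[_ //].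
Qed.

Section Marked.
Variable P : forall n, {set lgraph n}.
Hypothesis P_stable : forall (n : nat) (s : 'S_n) (H : lgraph n),
  H \in P n -> relabel s H \in P n.
Hypothesis P_prime : forall (n : nat) (H : lgraph n), H \in P n -> prime_graph H.
Variables (tau : tree) (N : {fset seq nat}).
Hypothesis N_internal : forall p : seq nat, p \in N -> p \in inodes tau.
Hypothesis ok : tau_ok tau (mem N).

Let valid (ls : seq nat) (J : {fmap nat -> nat}) : Prop :=
  [/\ forall l, l \in domf J -> l \in ls,
      forall l l' m, J.[? l]%fmap = Some m -> J.[? l']%fmap = Some m -> l = l'
    & forall l, J.[? l]%fmap <> Some 0%N].

Let mark_ex n s ls : up (core tau (mem N)) s -> nleaves s = n -> perm_eq ls (iota 1 n) ->
  exists2 J, valid ls J & map (mark J) ls = leaves s.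
Proof.
(* The mark of label l is the one found at the leaf where l is written; labels with mark 0 stay
   outside the domain. Injectivity holds because the nonzero marks are the distinct leaves of
   tau. *)
move=> us sn pls; pose mk l := nth 0%N (leaves s) (index l ls).
have uls : uniq ls by rewrite (perm_uniq pls) iota_uniq.
have szl : size ls = size (leaves s) by rewrite (perm_size pls) size_iota -sn.
pose D := [fset l in ls | mk l != 0%N]%fset.
pose J : {fmap nat -> nat} := [fmap x : D => mk (val x)].
have JE l : J.[? l]%fmap = if (l \in ls) && (mk l != 0%N) then Some (mk l) else None.
  case: fndP => [lJ|]; last by rewrite /= !inE /= => /negbTE ->.
  by rewrite ffunE /=; move: (lJ); rewrite /= !inE /= => ->.
have ut : uniq (marks s) by rewrite (perm_uniq (up_core_marks ok us)); case: ok.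
exists J.
  split=> [l|l l' m|l].
  - by rewrite -fndSome JE; case: (l \in ls).
  - rewrite !JE; case: ifP => // /andP[ll l0] [<-]; case: ifP => // /andP[ll' _] [E].
    have := uniq_filter_nth ut l0 (esym E) => E'.
    by rewrite -(nth_index 0%N ll) E' nth_index.
  - by rewrite JE; case: ifP => // /andP[_ /eqP H] [].
apply: (@eq_from_nth _ 0%N) => [|i]; rewrite size_map // => ilt.
rewrite (nth_map 0%N) // /mark JE mem_nth //= /mk index_uniq //.
by case: eqP => /= [->|].
Qed.

Let mark_uniq n (ls : seq nat) J J' : perm_eq ls (iota 1 n) -> valid ls J -> valid ls J' ->
  map (mark J) ls = map (mark J') ls -> J = J'.
Proof.
move=> _ [d _ z] [d' _ z'] /eq_in_map E; apply/fmapP => l.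
have [ll|ll] := boolP (l \in ls); last first.
  by rewrite !not_fnd //; apply: contra ll; [apply: d' | apply: d].
have := E l ll; rewrite /mark; have := z l; have := z' l.
by case: (J.[? l]%fmap) => [m|]; case: (J'.[? l]%fmap) => [m'|] //= H H' mm;
  rewrite ?mm // in H H' *; rewrite -?mm in H.
Qed.

(** The path above the core starts at the root of the whole tree, where no type is forbidden, hence
    the first index [None]. *)
Lemma T_markedE : T_marked P tau N = path_gf P None (core_type tau (mem N)) * core_gf P tau (mem N).
Proof.
rewrite -up_cls_gf //.
have Qle := @up_core_le tau (mem N) ^~ ok.
have QO s s' : s' \in reorders s -> good P s -> up (core tau (mem N)) s -> up (core tau (mem N)) s'.
  by move=> sO _; apply: up_core_reorders.
have validP ls ls' J : perm_eq ls' ls -> valid ls J -> valid ls' J.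
  by move=> pls [d i z]; split=> // l /d; rewrite (perm_mem pls).
have E := egf_erase P_stable P_prime Qle mark_ex mark_uniq QO validP.
transitivity (gf weight nleaves (shape_cls P (up (core tau (mem N))))).
  rewrite -E; congr egf; apply/seteqP; split=> -[t J] /=.
    move=> [[/= Pt [dJ iJ] [u uE iso]] nN].
    have lt : leaves u = leaves tau by rewrite -leaves_graph_tree iso leaves_graph_tree.
    (* A value 0 would be a leaf label of the induced tree, hence of tau. *)
    have J0 l : J.[? l]%fmap <> Some 0%N.
      move=> Jl; have ll : l \in leaves t by apply: dJ; rewrite -fndSome Jl.
      have [u' u'E] := ind_mem ll Jl; have [_ _ z _] := ok.
      by move: u'E; rewrite uE => -[<-]; rewrite lt (negbTE z).
    split=> //; apply/(embedsP J0 _ ok); exists u; split=> // p pt.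
    by have /fsetP/(_ p) := nN; rewrite !inE /= pt /= => ->.
  move=> [Pt [dJ iJ J0]] /(embedsP J0 _ ok)[u [uE iso nN]].
  split; first by split=> //; exists u.
  apply/fsetP => p; rewrite !inE /=; apply/andP/idP => [[pt]|pN]; first by rewrite nN.
  by have pt := N_internal pN; rewrite nN.
by apply: eq_gf => s; split=> [[gs us]|[us gs _]].
Qed.

End Marked.

(** * Unfolding the recursion into products over nodes and edges of tau *)

Lemma inodesE d ts : inodes (Node d ts) =
  [::] :: [seq i :: q | i <- iota 0 (size ts), q <- inodes (nt ts i)].
Proof.
rewrite /=; congr (_ :: flatten _).
have -> : zip (map inodes ts) (iota 0 (size ts)) = [seq (inodes (nt ts i), i) | i <- iota 0 (size ts)].
  rewrite -[X in zip (map _ X)](take_size ts) -(map_nth_iota0 (Leaf 0%N)) // -map_comp.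
  by rewrite -{2}[iota 0 _]map_id zip_map.
by rewrite -map_comp; apply: eq_map => i /=.
Qed.

Lemma uniq_inodes t : uniq (inodes t).
Proof.
elim/tree_nind: t => // d ts IH; rewrite inodesE cons_uniq; apply/andP; split.
  by apply/negP => /allpairsPdep[i [q []]].
apply: allpairs_uniq_dep => [|i|]; first exact: iota_uniq.
  by rewrite mem_iota => /= ilt; apply: IH.
by move=> [i q] [i' q'] _ _ /= [-> ->].
Qed.

Lemma subtree_cons d ts i p : (i < size ts)%N -> subtree (Node d ts) (i :: p) = subtree (nt ts i) p.
Proof. by move=> ilt; rewrite /= onthE (nth_map (Leaf 0%N)). Qed.

Lemma mem_inodes t p : (p \in inodes t) = (dec_at t p != None).
Proof.
elim/tree_nind: t p => [l|d ts IH] [|i p] //.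
rewrite mem_inodes_cons; have [ilt|ilt] := ltnP i (size ts).
  by rewrite IH // /dec_at subtree_cons.
by rewrite /dec_at /= onth_default.
Qed.

Lemma prodr_count (T : Type) (X : fps) (b : pred T) s :
  \prod_(e <- s) X ^+ b e = X ^+ count b s.
Proof. by elim: s => [|e s IH] /=; rewrite ?big_nil // big_cons IH -exprD. Qed.

Section Values.
Variable P : forall n, {set lgraph n}.
Hypothesis P_stable : forall (n : nat) (s : 'S_n) (H : lgraph n),
  H \in P n -> relabel s H \in P n.
Hypothesis P_prime : forall (n : nat) (H : lgraph n), H \in P n -> prime_graph H.

Lemma btree_path a r (C : set btree) :
  (forall b, C b <-> P_btrees P b /\ path_ok a r (bpath_types b)) -> egf C bsize = path_gf P a r.
Proof. by move=> CE; apply: fps_zI; rewrite zM_path; apply: btree_single. Qed.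

Lemma deriv_path a : fps_deriv (unmarked_gf P a) = path_gf P a None.
Proof.
apply: fps_zI; rewrite zM_path deriv_single //; apply: eq_gf => s.
by rewrite /single_cls /path_ok /= andbT.
Qed.

Lemma T_bloE : T_blo P = path_gf P None None.
Proof. by apply: btree_path => b; split=> [Pb|[]]. Qed.

Lemma T_blo_not_oplusE : T_blo_not_oplus P = path_gf P (Some true) None.
Proof.
apply: btree_path => b /=; rewrite broot_head.
by have -> : path_ok (Some true) None (bpath_types b) = (head None (bpath_types b) != Some true)
  by rewrite /path_ok /no_clash /= andbT eq_sym.
Qed.

Lemma T_oplusE : T_oplus P = path_gf P None (Some true).
Proof.
apply: btree_path => b /=; have [-> _] := bparent_last b.
by rewrite /path_ok /no_clash /= [Some true == _]eq_sym.
Qed.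

Lemma T_ominus_not_oplusE : T_ominus_not_oplus P = path_gf P (Some true) (Some false).
Proof.
apply: btree_path => b /=; have [_ ->] := bparent_last b; rewrite broot_head.
have -> : path_ok (Some true) (Some false) (bpath_types b) =
    (head None (bpath_types b) != Some true) && (last None (bpath_types b) != Some false).
  rewrite /path_ok /no_clash /= [Some false == _]eq_sym.
  by case: (bpath_types b) => [|x wd] //=; rewrite [Some true == _]eq_sym.
by split=> [[Pb -> ->]|[Pb /andP[]]].
Qed.

(** On the empty word the root condition of [path_ok] compares the two constraints with each other,
    and their equality rules out the single blossom. With opposite constraints the single blossom is
    allowed. *)
Lemma T_oplus_not_oplusE : T_oplus_not_oplus P = path_gf P (Some true) (Some true).
Proof.
apply: btree_path => b /=; have [-> _] := bparent_last b; rewrite broot_head.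
have -> : path_ok (Some true) (Some true) (bpath_types b) =
    [&& head None (bpath_types b) != Some true, last None (bpath_types b) != Some true & b != Blossom].
  rewrite /path_ok /no_clash /= ![Some true == _]eq_sym; case: b => [|d ts b] /=; first by rewrite eqxx.
  by have -> : BNode d ts b != Blossom by [apply/eqP]; rewrite andbT.
split=> [[Pb -> -> /eqP]|[Pb /and3P[h l /eqP]]]; by split.
Qed.

(** Exchanging signs reduces the four cases with an upper node $\ominus$, or without upper type and
    with a lower node $\ominus$, to series of the statement. *)
Lemma path_gfE a r : path_gf P a r = match a, r with
  | None, None => T_blo P
  | None, Some _ => T_oplus P
  | Some _, None => T_blo_not_oplus P
  | Some b, Some c => if b == c then T_oplus_not_oplus P else T_ominus_not_oplus P
  end.
Proof.
case: a r => [[]|] [[]|]; rewrite ?T_bloE ?T_oplusE ?T_blo_not_oplusE ?T_oplus_not_oplusE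
  ?T_ominus_not_oplusE //=.
- exact: (path_gf_swap P (Some true) (Some false)).
- exact: (path_gf_swap P (Some true) (Some true)).
- exact: (path_gf_swap P (Some true) None).
- exact: (path_gf_swap P None (Some true)).
Qed.

(** The same series as for an edge towards a node of N, since both lower ends have type [None]; this
    form yields the derivatives that the statement uses for edges to leaves. *)
Lemma path_gf_leaf a : path_gf P a None =
  if a is None then fps_deriv (T_all P) else fps_deriv (T_not_oplus P).
Proof.
rewrite T_allE // T_not_oplusE // !deriv_path.
by case: a => [[]|] //; exact: (path_gf_swap P (Some true) None).
Qed.

Definition node_type tau (N : pred (seq nat)) p : option bool :=
  if N p then None else obind dec_type (dec_at tau p).

Definition node_factor tau (N : pred (seq nat)) p : fps :=
  if N p then fps_comp (OccP_at P tau p) (T_all P) else fps_exp (T_not_oplus P).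

(** Each leaf of tau contributes a factor z, its core being a single leaf; every edge contributes
    the path inserted between the images of its ends. *)
Lemma core_gf_prod tau N : tau_ok tau N -> core_gf P tau N = fps_z ^+ nleaves tau *
  \prod_(p <- inodes tau) (node_factor tau N p *
    \prod_(k <- iota 0 (arity_at tau p))
      path_gf P (node_type tau N p) (node_type tau N (rcons p k))).
Proof.
elim/tree_nind: tau N => [m|dt taus IH] N ok.
  by rewrite core_leaf_gf big_nil mulr1.
rewrite core_node_gf // inodesE big_cons big_allpairs_dep nleaves_node.
have shiftE i p : (i < size taus)%N ->
    node_type (Node dt taus) N (i :: p) = node_type (nt taus i) (fun p => N (i :: p)) p.
  by move=> ilt; rewrite /node_type /dec_at subtree_cons.
have ctE i : (i < size taus)%N -> core_type (nt taus i) (fun p => N (i :: p)) =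
    node_type (nt taus i) (fun p => N (i :: p)) [::].
  move=> ilt; rewrite /core_type /node_type; case: (N [:: i]) => //.
  by rewrite /dec_at /=; case: (nt taus i).
have -> : (if N [::] then fps_comp (OccP P (dec_graph (size taus) dt)) (unmarked_gf P None)
    else fps_exp (unmarked_gf P (dec_type dt))) = node_factor (Node dt taus) N [::].
  rewrite /node_factor; have [NE|NE] := boolP (N [::]); first by rewrite T_allE.
  have [[] ->] := tau_ok_lin ok NE; rewrite T_not_oplusE //.
  by rewrite -(unmarked_gf_swap P (Some true)).
have -> : core_type (Node dt taus) N = node_type (Node dt taus) N [::] by [].
rewrite -(big_mkord xpredT (fun i => path_gf P (node_type (Node dt taus) N [::])
  (core_type (nt taus i) (fun p => N (i :: p))) * core_gf P (nt taus i) (fun p => N (i :: p)))).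
rewrite big_split /= /index_iota subn0.
have -> : \prod_(i <- iota 0 (size taus)) core_gf P (nt taus i) (fun p => N (i :: p)) =
    fps_z ^+ sumn (map nleaves taus) *
    \prod_(i <- iota 0 (size taus)) \prod_(q <- inodes (nt taus i))
      (node_factor (Node dt taus) N (i :: q) *
       \prod_(k <- iota 0 (arity_at (Node dt taus) (i :: q)))
          path_gf P (node_type (Node dt taus) N (i :: q)) (node_type (Node dt taus) N (rcons (i :: q) k))).
  have -> : fps_z ^+ sumn (map nleaves taus) =
      \prod_(i <- iota 0 (size taus)) fps_z ^+ nleaves (nt taus i).
    rewrite -{1}[taus](take_size taus) -(map_nth_iota0 (Leaf 0%N)) //.
    by elim: (iota _ _) => [|i r IHr] /=; rewrite ?big_nil // big_cons exprD IHr.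
  rewrite -big_split /= !big_seq; apply: eq_bigr => i; rewrite mem_iota /= => ilt.
  rewrite (IH i ilt) //; last exact: tau_ok_nth ok ilt.
  congr (_ * _); apply: eq_bigr => q _; rewrite shiftE //; congr (_ * _).
    by rewrite /node_factor /OccP_at subtree_cons.
  rewrite /arity_at subtree_cons //; apply: eq_bigr => k _.
  by rewrite (shiftE i (rcons q k)).
have -> : \prod_(i <- iota 0 (size taus)) path_gf P (node_type (Node dt taus) N [::])
    (core_type (nt taus i) (fun p => N (i :: p))) =
    \prod_(k <- iota 0 (arity_at (Node dt taus) [::]))
       path_gf P (node_type (Node dt taus) N [::]) (node_type (Node dt taus) N (rcons [::] k)).
  rewrite !big_seq; apply: eq_bigr => i; rewrite mem_iota /= => ilt.
  by rewrite ctE // shiftE.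
by rewrite [X in _ * X = _]mulrCA [LHS]mulrCA; congr (_ * _); rewrite mulrA.
Qed.

End Values.

Theorem theorem5p9 (P : forall n : nat, {set lgraph n})
    (P_prime : forall (n : nat) (H : lgraph n), H \in P n -> prime_graph H)
    (P_stable : forall (n : nat) (s : 'S_n) (H : lgraph n),
       H \in P n -> relabel s H \in P n)
    (tau : tree) (tau_subst : subst_tree tau) (tau_size : (2 <= nleaves tau)%N)
    (N : {fset seq nat})
    (N_internal : forall p : seq nat, p \in N -> p \in inodes tau)
    (N_nonlinear : forall p : seq nat, nonlinear_at tau p -> p \in N) :
  T_marked P tau N =
    fps_z ^+ nleaves tau
    * (if [::] \in N then T_blo P else T_oplus P)
    * T_oplus_not_oplus P ^+ d_eq tau N
    * T_ominus_not_oplus P ^+ d_neq tau N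
    * T_blo_not_oplus P ^+ d_out_in tau N
    * fps_deriv (T_not_oplus P) ^+ d_out_leaf tau N
    * fps_exp (T_not_oplus P *+ n_L tau N)
    * T_oplus P ^+ d_in_out tau N
    * T_blo P ^+ d_in_in tau N
    * fps_deriv (T_all P) ^+ d_in_leaf tau N
    * \prod_(p <- N) fps_comp (OccP_at P tau p) (T_all P).
Proof.
have ok : tau_ok tau (mem N).
  case/andP: tau_subst => wt pt; split=> //; first by rewrite (perm_uniq pt) iota_uniq.
  by rewrite (perm_mem pt) mem_iota.
rewrite (T_markedE P_stable P_prime N_internal ok) core_gf_prod //.
(* N contains all non-linear nodes, so the internal nodes outside N carry a sign. *)
have linP p : p \in inodes tau -> p \notin N -> exists b, dec_at tau p = Some (Lin b).
  rewrite mem_inodes => pt pN; have : ~~ nonlinear_at tau p by apply: contra pN; apply: N_nonlinear.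
  by rewrite /nonlinear_at; case: (dec_at tau p) pt => // -[b|] //; exists b.
have rootI : [::] \in inodes tau.
  by case: (tau) tau_size => [l|d ts _]; rewrite ?inE //.
have -> : path_gf P None (core_type tau (mem N)) = if [::] \in N then T_blo P else T_oplus P.
  rewrite path_gfE // /core_type /= -/(_ \in N); case: ifP => // /negbT rN.
  have [b] := linP _ rootI rN; rewrite /dec_at /=.
  by case: (tau) => // d ts [->].
rewrite big_split /=.
have -> : \prod_(p <- inodes tau) node_factor P tau (mem N) p =
    fps_exp (T_not_oplus P *+ n_L tau N) * \prod_(p <- N) fps_comp (OccP_at P tau p) (T_all P).
  rewrite (bigID (mem N)) /= mulrC; congr (_ * _).
    (* Turning the exponential of a multiple into a power requires that the series has no constant
       term. *)
    rewrite fps_expMn; last by rewrite T_not_oplusE // unmarked_gf0.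
    rewrite big_seq_cond (eq_bigr (fun=> fps_exp (T_not_oplus P))); last first.
      by move=> p /andP[_ /negbTE pN]; rewrite /node_factor /= pN.
    rewrite -big_seq_cond big_const_seq -Monoid.iteropE; congr (_ ^+ _).
    by apply: eq_in_count => p pt; rewrite /out_N pt.
  rewrite -big_filter (perm_big N) /=; last first.
    apply: uniq_perm; [exact/filter_uniq/uniq_inodes | exact: fset_uniq |].
    move=> p; rewrite mem_filter /=; apply/andP/idP => [[]//|pN]; split=> //.
    exact: N_internal.
  by rewrite !big_seq; apply: eq_bigr => p pN; rewrite /node_factor /= pN.
have -> : \prod_(p <- inodes tau) \prod_(k <- iota 0 (arity_at tau p))
      path_gf P (node_type tau (mem N) p) (node_type tau (mem N) (rcons p k)) =
    T_oplus_not_oplus P ^+ d_eq tau N * T_ominus_not_oplus P ^+ d_neq tau N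
    * T_blo_not_oplus P ^+ d_out_in tau N * fps_deriv (T_not_oplus P) ^+ d_out_leaf tau N
    * T_oplus P ^+ d_in_out tau N * T_blo P ^+ d_in_in tau N
    * fps_deriv (T_all P) ^+ d_in_leaf tau N.
  transitivity (\prod_(pq <- edges tau)
      path_gf P (node_type tau (mem N) pq.1) (node_type tau (mem N) pq.2)).
    by rewrite /edges big_allpairs_dep.
  rewrite /d_eq /d_neq /d_out_in /d_out_leaf /d_in_out /d_in_in /d_in_leaf /count_edges.
  (* Each edge satisfies exactly one of the seven counted conditions, so every power becomes a
     product over all edges with exponents 0 or 1, and the comparison is made edge by edge. *)
  rewrite -!prodr_count -!big_split /= !big_seq.
  apply: eq_bigr => -[p q] /allpairsPdep[p' [k [pt _ [-> _]]]] /=.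
  rewrite /node_type /out_N /in_N /is_leaf pt /=.
  have [pN|pN] := boolP (p' \in N).
    have [qt|qt] := boolP (q \in inodes tau) => /=.
      have [qN|qN] := boolP (q \in N) => /=.
        by rewrite path_gfE // !expr0 expr1 !mul1r !mulr1.
      have [b ->] := linP q qt qN.
      by rewrite path_gfE // !expr0 expr1 !mul1r !mulr1.
    have qN : (q \in N) = false by apply/negbTE; apply: contra qt; apply: N_internal.
    have -> : dec_at tau q = None by move: qt; rewrite mem_inodes negbK => /eqP.
    by rewrite qN path_gf_leaf // !expr0 expr1 !mul1r.
  have [b bE] := linP p' pt pN; rewrite bE.
  have [qt|qt] := boolP (q \in inodes tau) => /=.
    have [qN|qN] := boolP (q \in N) => /=.
      by rewrite path_gfE // !expr0 expr1 !mul1r !mulr1.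
    have [c cE] := linP q qt qN; rewrite cE /same_sign bE cE /= path_gfE //.
    by case: b c {bE cE} => [] [] /=; rewrite !expr0 expr1 ?mul1r !mulr1.
  have qN : (q \in N) = false by apply/negbTE; apply: contra qt; apply: N_internal.
  have -> : dec_at tau q = None by move: qt; rewrite mem_inodes negbK => /eqP.
  by rewrite qN path_gf_leaf // !expr0 expr1 !mul1r !mulr1.
ring.
Qed.
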